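(* Let $C_0\ge1$, $C_1>0$, $s>1/2$. For every integer $h\geq1$, there exists a constant $c_{C_1,s,h}>0$, depending only on $(C_1,s,h)$, such that, for every integer $N\geq h+1$ and every real $\alpha>0$, $$\inf_{K_{1:N}\in\mathcal M_\alpha^N}\ \inf_{\hat g}\ \sup_{f\in\mathcal F(C_0,C_1,s)}\mathbb E_{f,K_{1:N}}\left[|\hat g(Z)-\gamma_f(h)|^2\right]\ \geq\ c_{C_1,s,h}\left(1\wedge\left[(\alpha^4\wedge1)(N-h)\right]^{-1}\right),$$ where the second infimum is over all real-valued measurable functions $\hat g$ on the output space of $K_{1:N}$.
   Context: Notation: $u\wedge v=\min\{u,v\}$. A spectral density is a nonnegative, integrable, even function $f$ on $[-\pi,\pi]$; $\gamma_f(h)=\int_{-\pi}^{\pi}f(\lambda)e^{ih\lambda}\,d\lambda$, $h\in\mathbb Z$, and $\rho_f(h)=\gamma_f(h)/\gamma_f(0)$ when $\gamma_f(0)>0$. $\mathcal F(C_0,C_1,s)$ is the set of spectral densities $f$ with $\gamma_f(0)\in[C_0^{-1},C_0]$ and $\sum_{h\in\mathbb Z\setminus\{0\}}|h|^{2s}|\rho_f(h)|^2\le C_1^2$. A centered real-valued stationary Gaussian process $X=(X_t)_{t\in\mathbb Z}$ has spectral density $f$ if $\operatorname{Cov}(X_0,X_h)=\gamma_f(h)$ for all $h$. $\mathcal M_\alpha$ is the class of all Markov kernels $K$ from $\mathbb R$ to an arbitrary standard Borel space such that $K(S\mid x)\le e^\alpha K(S\mid x')$ for all $x,x'\in\mathbb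 R$ and all measurable $S$ in the output space of $K$. $\mathcal M_\alpha^N$ is the set of tuples $K_{1:N}=(K_1,\dots,K_N)$ with each $K_i\in\mathcal M_\alpha$; the output space of $K_{1:N}$ is the product of the output spaces of the $K_i$. For a spectral density $f$ and $K_{1:N}\in\mathcal M_\alpha^N$, $\mathbb E_{f,K_{1:N}}$ is expectation under the joint law of $(X,Z)$, where $X$ is a centered real stationary Gaussian process with spectral density $f$ and $Z=(Z_1,\dots,Z_N)$ is such that, conditionally on $X$, the $Z_i$ are independent with $Z_i\sim K_i(\cdot\mid X_i)$. *)

(* Defs.v *)
From HB Require Import structures.
From mathcomp Require Import all_boot all_order all_algebra.
From mathcomp Require Import all_classical all_reals all_analysis.
From mathcomp Require Import measurable_realfun complex.

Set Implicit Arguments.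
Unset Strict Implicit.
Unset Printing Implicit Defensive.

Import Order.TTheory GRing.Theory Num.Theory.
Import numFieldNormedType.Exports.

Local Open Scope classical_set_scope.
Local Open Scope ring_scope.

Section SpectralDensity.
Context {R : realType}.
Implicit Types (f : R -> R) (h : int).

Local Notation circle := (`[- pi, pi]%classic : set R).

Definition spectral_density f : Prop :=
  [/\ forall x, circle x -> 0 <= f x,
      forall x, circle x -> f (- x) = f x
    & lebesgue_measure.-integrable circle (EFin \o f)].

(* The integral of f(x) e^{ihx} over [-pi, pi]; complex integrals are taken
   componentwise. *)
Definition fourier_coef f h : R[i] :=
  (\int[lebesgue_measure]_(x in circle) (f x * cos (h%:~R * x))
   +i* \int[lebesgue_measure]_(x in circle) (f x * sin (h%:~R * x)))%C.

(* gamma_f(h) as a real number; see fourier_coef_real for the fact that the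
   Fourier coefficients of a spectral density are real. *)
Definition acov f h : R := complex.Re (fourier_coef f h).

Definition acor f h : R := acov f h / acov f 0.

Lemma fourier_coef_real f h :
  spectral_density f -> fourier_coef f h = (acov f h)%:C%C.
Proof.
move=> [_ feven fint]; rewrite /acov /fourier_coef /=; congr (_ +i* _)%C.
set g := fun x => f x * sin (h%:~R * x).
have mcirc : measurable circle by exact: measurable_itv.
have mg : measurable_fun circle (EFin \o g).
  apply/measurable_EFinP/measurable_funM.
    by have /measurable_int/measurable_EFinP := fint.
  apply: measurableT_comp; last exact: measurable_funM.
  by apply: continuous_measurable_fun; exact: continuous_sin.
have circN : (-%R : _ -> measurableTypeR R) @^-1` circle = circle.
  by rewrite opp_preimage_itvbndbnd /= opprK.
have gN x : circle x -> g (- x) = - g x.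
  by move=> cx; rewrite /g feven// mulrN sinN mulrN.
rewrite /Rintegral integralE.
suff -> : (\int[lebesgue_measure]_(x in circle) (EFin \o g)^\- x =
           \int[lebesgue_measure]_(x in circle) (EFin \o g)^\+ x)%E.
  by case: (integral _ _ _) => [r| |] //=; rewrite subrr.
transitivity (\int[lebesgue_measure]_(x in circle)
    ((EFin \o g)^\+ (- x)%R))%E.
  apply: eq_integral => x /set_mem cx.
  by rewrite funenegE funeposE /= gN.
rewrite -[in LHS]circN -[LHS](@ge0_integral_pushforward _ _
  (measurableTypeR R) (measurableTypeR R))//=;
  last exact: measurable_funepos.
apply: eq_measure_integral => B mB _.
exact: lebesgue_measureN.
Qed.

Definition density_class (C0 C1 s : R) (f : R -> R) : Prop :=
  [/\ spectral_density f,
      C0^-1 <= acov f 0 <= C0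
    & (\esum_(h in [set h : int | (h != 0)%R])
         ((`|h|%:~R `^ (2 * s)) * `|acor f h| ^+ 2)%:E <= (C1 ^+ 2)%:E)%E].

End SpectralDensity.

Section GaussianProcess.
Context {R : realType}.

(* normal_prob m 0 is not a Dirac mass, hence the case distinction. *)
Definition gaussian_law (m sigma : R) (A : set R) : \bar R :=
  if sigma == 0 then (\d_m A)%E else normal_prob m sigma A.

Context {d : measure_display} {Omega : measurableType d}.
Context (P : probability Omega R).
Implicit Types X : int -> {RV P >-> R}.

Definition gaussian_process X : Prop :=
  forall (n : nat) (t : 'I_n -> int) (a : 'I_n -> R), exists m sigma : R,
    forall A : set R, measurable A ->
      P ((fun w => \sum_(i < n) a i * X (t i) w) @^-1` A)
      = gaussian_law m sigma A.

(* Second-order stationarity (of a centered process); for Gaussian processes it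
   coincides with strict stationarity. *)
Definition stationary X : Prop :=
  forall t h : int, covariance P (X t) (X (t + h)) = covariance P (X 0) (X h).

Definition has_spectral_density (f : R -> R) X : Prop :=
  [/\ gaussian_process X,
      forall t, ('E_P[X t] = 0)%E,
      stationary X
    & forall h, covariance P (X 0) (X h) = (acov f h)%:E].

End GaussianProcess.

Section PrivateChannels.
Context {R : realType}.

Definition separable (Y : topologicalType) : Prop :=
  exists2 D : set Y, countable D & dense D.

(* T is isomorphic to a complete separable metric space (a Hausdorff pseudometric
   is a metric) with its Borel sigma-algebra. *)
Definition standard_borel (d : measure_display) (T : measurableType d) : Prop :=
  exists (Y : completePseudoMetricType R) (phi : T -> Y),
    [/\ hausdorff_space Y, separable Y, bijective phi
      & forall A : set T, measurable A <-> <<s @open Y >> (phi @` A)].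

Record channel (alpha : R) := Channel {
  out_display : measure_display;
  out : measurableType out_display;
  out_standard_borel : standard_borel out;
  kernel :> R.-pker (measurableTypeR R) ~> out;
  kernel_private : forall (x x' : R) (S : set out), measurable S ->
    (kernel x S <= (expR alpha)%:E * kernel x' S)%E }.

Context {alpha : R}.

Definition channel_law (K : channel alpha) (x : R) : set (out K) -> \bar R :=
  K x.

HB.instance Definition _ K x := Measure.on (@channel_law K x).

Let channel_lawT K x : channel_law x [set: out K] = 1%:E.
Proof. exact: prob_kernel. Qed.

HB.instance Definition _ K x :=
  Measure_isProbability.Build _ _ _ (@channel_law K x) (channel_lawT K x).

Implicit Types Ks : seq (channel alpha).

(* The output space T_1 * (T_2 * ... * (T_N * unit)) of K_1, ..., K_N. *)
Fixpoint outs_display Ks : measure_display :=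
  if Ks is K :: Ks' then
    measure_prod_display (out_display K, outs_display Ks')
  else default_measure_display.

Fixpoint outs Ks : measurableType (outs_display Ks) :=
  match Ks return measurableType (outs_display Ks) with
  | [::] => unit
  | K :: Ks' => (out K * outs Ks')%type
  end.

(* The product measure K_1(. | x_0) \x ... \x K_N(. | x_(N-1)). *)
Fixpoint outs_law Ks (x : nat -> R) : probability (outs Ks) R :=
  match Ks return probability (outs Ks) R with
  | [::] => \d_tt
  | K :: Ks' => (@channel_law K (x 0%N) \x outs_law Ks' (fun i => x i.+1))%E
  end.

End PrivateChannels.

Section MinimaxRisk.
Context {R : realType} {alpha : R}.

(* Conditionally on X, the vector Z = (Z_1, ..., Z_N) has law outs_law Ks
   (X_1, ..., X_N), so E[(g(Z) - gamma_f(h))^2] is an iterated integral. *)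
Definition process_risk (Ks : seq (channel alpha)) (g : outs Ks -> R)
    (f : R -> R) (h : int) (d : measure_display) (Omega : measurableType d)
    (P : probability Omega R) (X : int -> {RV P >-> R}) : \bar R :=
  (\int[P]_w \int[outs_law Ks (fun i => X (i.+1)%:Z w)]_z
     (`|g z - acov f h| ^+ 2)%:E)%E.

(* Realizations of the process with spectral density f exist and all have the
   same law: the supremum is the common value of process_risk. *)
Definition risk (Ks : seq (channel alpha)) (g : outs Ks -> R)
    (f : R -> R) (h : int) : \bar R :=
  ereal_sup [set r | exists (d : measure_display) (Omega : measurableType d)
    (P : probability Omega R) (X : int -> {RV P >-> R}),
    has_spectral_density f X /\ r = process_risk g f h X].

Definition max_risk (C0 C1 s : R) (Ks : seq (channel alpha)) (g : outs Ks -> R)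
    (h : int) : \bar R :=
  ereal_sup [set risk g f h | f in density_class C0 C1 s].

End MinimaxRisk.

(* K is a sequence and not an N.-tuple only because of the universe of tuples. *)
Definition minimax_risk (R : realType) (C0 C1 s alpha : R) (N : nat) (h : int) :
    \bar R :=
  ereal_inf [set r | exists2 K : seq (channel alpha), size K = N &
    r = ereal_inf [set max_risk C0 C1 s g h
                  | g in [set g : outs K -> R | measurable_fun setT g]]].

(* Main.v *)
(* Let a^2 + b^2 = 1, let xi be Gaussian white noise, and compare white noise
   with X_t = a xi_t + b xi_(t-h), whose autocovariance at lag h is ab and whose
   spectral density is (1 + 2ab cos(hx)) / (2 pi).  By the two-point method it
   suffices that the two laws of Z are close in total variation when
   N b^2 min(alpha^4, 1) is small.

   Pass from one process to the other one residue class modulo h at a time.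
   Between two consecutive hybrids the only memory is one noise variable y,
   handed on from X_t to X_(t+h).  For a test u with values in [0, 1], let F(y)
   be the conditional expectation of u(Z) under one hybrid and B that of u(Z)^2
   under the other.  Backward induction on time gives |F|^2 <= D^n B, n being the
   number of remaining channels, for a norm |.| on functions of y adapted to the
   channels.  Applied to u - p + s for all real s, this second moment bound yields
   the bound D^N - 1 on the squared difference of the two probabilities.

   Without privacy, |F|^2 is the supremum of F^2 / w for a Gaussian weight w, and
   D = 1 + O(b^2).  With privacy, put tau = e^alpha - 1, L = 20 b^2 tau^2 and
   |F|^2 = (E F)^2 + Var(F) / L for the Gaussian law.  One step turns a second
   moment s of the conditional means and a conditional variance v into a variance
   at most L s + 2 tau^2 v and changes the mean by at most tau sqrt(v), because a
   private channel transmits only a fraction tau of the fluctuations of its input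
   and the moving average only a fraction b; balancing the two terms gives
   D = 1 + O(b^2 tau^4). *)
Require Import Defs.
From HB Require Import structures.
From mathcomp Require Import all_boot all_order all_algebra.
From mathcomp Require Import all_classical all_reals all_analysis.
From mathcomp Require Import measurable_realfun.
From mathcomp Require Import ring lra zify.

Set Implicit Arguments.
Unset Strict Implicit.
Unset Printing Implicit Defensive.

Import Order.TTheory GRing.Theory Num.Theory.
Import numFieldNormedType.Exports.

Local Open Scope classical_set_scope.
Local Open Scope ring_scope.

(** * Bounded measurable functions *)

(** Why residue classes: the lag couples only times congruent modulo [h], so changing one class
    leaves a single noise variable in memory, while changing all at once would leave [h] of them.
    The price is [h] comparisons, each to within 1/(4h). Why second moments: the supremum of (E_1
    u)^2 / E_0 (u^2) over tests [u] is one plus the chi-square divergence, so [D ^ N] is a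
    multiplicative chi-square bound. In this dual form it needs no densities on the arbitrary output
    spaces. Why tau^4: a correlation shows only after crossing two channels, the one that reads a
    noise variable as new and the one that reads it again [h] steps later. Each crossing costs tau^2
    on the level of squares. The two norms meet at alpha = 1/8. Below, tau <= 2 alpha and tau^2 <=
    1/8; above, min(alpha^4, 1) >= 2^-12, so ignoring privacy costs only a constant. The risk is a
    supremum over realizations of the process, so a lower bound must exhibit one: hence the
    construction of Gaussian noise from coin tosses. *)

Section BoundedMeasurable.
Context {R : realType} d {T : measurableType d}.
Implicit Types f g : T -> R.

(** Boundedness rather than integrability: this class is stable under products, sections and partial
    integration, and its members are integrable for every probability, so Fubini and Jensen need no
    further side conditions. *)
Definition bm f := measurable_fun setT f /\ exists M, forall x, `|f x| <= M.

Lemma bm_cst (c : R) : bm (fun=> c).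
Proof. by split; [exact: measurable_cst|exists `|c|]. Qed.

Lemma bmD f g : bm f -> bm g -> bm (fun x => f x + g x).
Proof.
move=> [mf [M fM]] [mg [N gN]]; split; first exact: measurable_funD.
by exists (M + N) => x; apply: le_trans (ler_normD _ _) _; exact: lerD.
Qed.

Lemma bmM f g : bm f -> bm g -> bm (fun x => f x * g x).
Proof.
move=> [mf [M fM]] [mg [N gN]]; split; first exact: measurable_funM.
by exists (M * N) => x; rewrite normrM ler_pM.
Qed.

Lemma bmN f : bm f -> bm (fun x => - f x).
Proof.
move=> [mf [M fM]]; split; first exact: measurableT_comp.
by exists M => x; rewrite normrN.
Qed.

Lemma bmB f g : bm f -> bm g -> bm (fun x => f x - g x).
Proof. by move=> bf bg; apply: bmD => //; exact: bmN. Qed.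

Lemma bmX f n : bm f -> bm (fun x => f x ^+ n).
Proof.
move=> bf; elim: n => [|n IH]; first exact: bm_cst.
by rewrite (_ : (fun _ => _) = (fun x => f x * f x ^+ n));
  [exact: bmM|apply/funext => x; rewrite exprS].
Qed.

Lemma bm_abs f : bm f -> bm (fun x => `|f x|).
Proof.
move=> [mf [M fM]]; split; first exact: measurableT_comp.
by exists M => x; rewrite normr_id.
Qed.

Variable m : probability T R.

Lemma bm_integrable {f} : bm f -> m.-integrable setT (EFin \o f).
Proof.
move=> [mf [M fM]]; apply: measurable_bounded_integrable => //.
  by rewrite (@le_lt_trans _ _ 1%E) ?ltry// probability_le1.
by exists M; split; [exact: num_real|move=> y My x _; exact: le_trans (ltW My)].
Qed.

Lemma bintD f g : bm f -> bm g ->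
  \int[m]_x (f x + g x) = \int[m]_x f x + \int[m]_x g x.
Proof. by move=> bf bg; rewrite RintegralD//; exact: bm_integrable. Qed.

Lemma bintB f g : bm f -> bm g ->
  \int[m]_x (f x - g x) = \int[m]_x f x - \int[m]_x g x.
Proof. by move=> bf bg; rewrite RintegralB//; exact: bm_integrable. Qed.

Lemma bintZ f (c : R) : bm f -> \int[m]_x (c * f x) = c * \int[m]_x f x.
Proof. by move=> bf; rewrite RintegralZl//; exact: bm_integrable. Qed.

Lemma bint_cst (c : R) : \int[m]_x c = c.
Proof.
rewrite Rintegral_cst// [X in fine X](_ : _ = 1%E) ?mulr1//.
exact: probability_setT.
Qed.

Lemma le_bint f g : bm f -> bm g -> (forall x, f x <= g x) ->
  \int[m]_x f x <= \int[m]_x g x.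
Proof. by move=> bf bg fg; apply: le_Rintegral => //; exact: bm_integrable. Qed.

Lemma bint_abs f : bm f -> `|\int[m]_x f x| <= \int[m]_x `|f x|.
Proof. by move=> bf; apply: le_normr_Rintegral => //; exact: bm_integrable. Qed.

Lemma bint_bound f M : bm f -> (forall x, `|f x| <= M) -> `|\int[m]_x f x| <= M.
Proof.
move=> bf fM; apply: le_trans (bint_abs bf) _; rewrite -(bint_cst M).
by apply: le_bint => //; [exact: bm_abs|exact: bm_cst].
Qed.

Lemma bint_EFin f : bm f -> (\int[m]_x (f x)%:E)%E = (\int[m]_x f x)%:E.
Proof.
move=> bf; rewrite /Rintegral fineK//.
by apply: integrable_fin_num => //; exact: bm_integrable.
Qed.

Lemma bint_variance f : bm f -> let c := \int[m]_x f x in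
  \int[m]_x (f x - c) ^+ 2 = \int[m]_x f x ^+ 2 - c ^+ 2.
Proof.
move=> bf c; have b2 := bmX 2 bf.
rewrite (_ : (fun x => _) = (fun x => f x ^+ 2 - ((2 * c) * f x - c ^+ 2))).
  rewrite bintB//; last by apply: bmB; [apply: bmM => //|]; exact: bm_cst.
  rewrite bintB//; [|by apply: bmM => //; exact: bm_cst|exact: bm_cst].
  rewrite bintZ// bint_cst -/c; ring.
by apply/funext => x; ring.
Qed.

Lemma bint_sqr f : bm f -> (\int[m]_x f x) ^+ 2 <= \int[m]_x f x ^+ 2.
Proof.
move=> bf; rewrite -subr_ge0 -bint_variance//.
by apply: Rintegral_ge0 => x _; exact: sqr_ge0.
Qed.

End BoundedMeasurable.

Lemma bm_comp (R : realType) d (T : measurableType d) d' (T' : measurableType d')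
    (g : T' -> T) (f : T -> R) :
  measurable_fun setT g -> bm f -> bm (fun x => f (g x)).
Proof.
move=> mg [mf [M fM]]; split; first exact: measurableT_comp.
by exists M => x.
Qed.

Section BoundedFubini.
Context {R : realType} d1 d2 {T1 : measurableType d1} {T2 : measurableType d2}.
Implicit Types f : T1 * T2 -> R.

Lemma bm_pair1 f x : bm f -> bm (fun y => f (x, y)).
Proof. by move=> bf; apply: (bm_comp (g := pair x)) => //; exact: measurable_pair1. Qed.

Lemma bm_pair2 f y : bm f -> bm (fun x => f (x, y)).
Proof. by move=> bf; apply: (bm_comp (g := pair^~ y)) => //; exact: measurable_pair2. Qed.

Lemma bm_integral2 f (m2 : probability T2 R) :
  bm f -> bm (fun x => \int[m2]_y f (x, y)).
Proof.
move=> bf; split; last first.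
  by case: (bf) => _ [M fM]; exists M => x; apply: bint_bound => //; exact: bm_pair1.
apply/measurable_EFinP => /=.
rewrite (_ : _ \o _ = (fun x => \int[m2]_y (f (x, y))%:E)%E); last first.
  by apply/funext => x; rewrite bint_EFin//; exact: bm_pair1.
case: (bf) => mf _.
(* The Dirac mass is a dummy first factor: only measurability of the partial integral is wanted, but
   the theorem asks for integrability on a product. *)
exact: (measurable_fubini_F (m1 := (@dirac _ _ point R)) (f := EFin \o f)
  (bm_integrable (dirac point \x m2)%E bf)).
Qed.

Lemma bint_Fubini f (m1 : probability T1 R) (m2 : probability T2 R) : bm f ->
  \int[m1]_x \int[m2]_y f (x, y) = \int[m2]_y \int[m1]_x f (x, y).
Proof.
move=> bf; rewrite /Rintegral; congr fine.
transitivity (\int[m1]_x \int[m2]_y (f (x, y))%:E)%E.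
  by apply: eq_integral => x _; rewrite bint_EFin//; exact: bm_pair1.
transitivity (\int[m2]_y \int[m1]_x (f (x, y))%:E)%E.
  exact: (Fubini (f := EFin \o f) (bm_integrable (m1 \x m2)%E bf)).
by apply: eq_integral => y _; rewrite bint_EFin//; exact: bm_pair2.
Qed.

Lemma bint_prod f (m1 : probability T1 R) (m2 : probability T2 R) : bm f ->
  \int[(m1 \x m2)%E]_z f z = \int[m1]_x \int[m2]_y f (x, y).
Proof.
move=> bf; rewrite /Rintegral; congr fine.
rewrite -(integral12_prod_meas1 (f := EFin \o f) (bm_integrable (m1 \x m2)%E bf)).
by apply: eq_integral => x _; rewrite /fubini_F /= bint_EFin//; exact: bm_pair1.
Qed.

End BoundedFubini.

Section KernelPrecomposition.
Context {R : realType} d0 d1 d2 {T0 : measurableType d0} {T1 : measurableType d1}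
  {T2 : measurableType d2} (K : R.-pker T1 ~> T2) (g : T0 -> T1).

(** Lets the input of a channel depend on a parameter [x], so that measurability of integrals
    against kernels applies when the integrand depends on [x] as well. *)
Definition kernel_comp (mg : measurable_fun setT g) (x : T0) :
  {measure set T2 -> \bar R} := K (g x).

Variable mg : measurable_fun setT g.

Let kernel_comp_measurable U : measurable U ->
  measurable_fun [set: T0] (kernel_comp mg ^~ U).
Proof. by move=> mU; apply: (measurableT_comp (measurable_kernel K U mU)). Qed.

HB.instance Definition _ :=
  isKernel.Build _ _ _ _ _ (kernel_comp mg) kernel_comp_measurable.

Let kernel_compT x : kernel_comp mg x setT = 1%E.
Proof. exact: prob_kernel. Qed.

HB.instance Definition _ :=
  Kernel_isProbability.Build _ _ _ _ _ (kernel_comp mg) kernel_compT.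

End KernelPrecomposition.

Lemma bm_integral_channel (R : realType) (alpha : R) (K : channel alpha)
    d (T : measurableType d) (g : T -> R) (f : T * out K -> R) :
  measurable_fun setT g -> bm f ->
  bm (fun x => \int[@channel_law _ _ K (g x)]_z f (x, z)).
Proof.
move=> mg bf; have [mf [M fM]] := bf; split; last first.
  by exists M => x; apply: bint_bound => //; exact: bm_pair1.
(* Adding the bound makes the integrand nonnegative, as the measurability theorem for kernels
   requires; it can be subtracted again because a channel has mass one. *)
have bfM : bm (fun p => f p + M) by apply: bmD => //; exact: bm_cst.
rewrite (_ : (fun x => _) = (fun x =>
    \int[@channel_law _ _ K (g x)]_z (f (x, z) + M) - M)); last first.
  apply/funext => x; rewrite bintD ?bint_cst ?addrK//; first exact: bm_pair1.
  exact: bm_cst.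
apply: measurable_funB; last exact: measurable_cst.
apply/measurable_EFinP => /=.
rewrite (_ : _ \o _ = (fun x => \int[@channel_law _ _ K (g x)]_z (f (x, z) + M)%:E)%E).
  apply: (measurable_fun_integral_finite_kernel
    (fun p => (f p + M)%:E) (kernel_comp (Defs.kernel K) mg)) => //=.
    by move=> p; rewrite lee_fin; have := fM p; rewrite ler_norml => /andP[]; lra.
  by apply/measurable_EFinP; case: bfM.
apply/funext => x; rewrite bint_EFin//.
exact: (@bm_pair1 _ _ _ _ _ (fun p => f p + M)).
Qed.

(** * Gaussian integrals *)

Section Density.
Context {R : realType} d {T : measurableType d}.
Variables (mu nu : {measure set T -> \bar R}) (g : T -> R).
Hypotheses (mg : measurable_fun setT g) (g0 : forall x, 0 <= g x).
Hypothesis nuE : forall A, measurable A -> nu A = (\int[mu]_(x in A) (g x)%:E)%E.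

Import HBNNSimple.
Local Open Scope ereal_scope.

Let mgE : measurable_fun setT (EFin \o g).
Proof. exact/measurable_EFinP. Qed.

Let density_nnsfun (f : {nnsfun T >-> R}) :
  \int[nu]_x (f x)%:E = \int[mu]_x ((f x)%:E * (g x)%:E).
Proof.
under [in LHS]eq_integral do rewrite fimfunE -fsumEFin//.
rewrite ge0_integral_fsum//; last 2 first.
- by move=> r; exact/measurable_EFinP/measurable_funM.
- by move=> r x _; rewrite EFinM nnfun_muleindic_ge0.
under [in RHS]eq_integral.
  move=> x _; rewrite fimfunE -fsumEFin// ge0_mule_fsuml; last first.
    by move=> r; rewrite EFinM nnfun_muleindic_ge0.
  over.
rewrite ge0_integral_fsum//; last 2 first.
- move=> r; apply: emeasurable_funM => //.
  exact/measurable_EFinP/measurable_funM.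
- by move=> r x _; rewrite mule_ge0 ?lee_fin// -lee_fin EFinM nnfun_muleindic_ge0.
apply: eq_fsbigr => r _.
have mr : measurable (f @^-1` [set r]) by exact: measurable_funPTI.
rewrite integralZl_indic_nnsfun// integral_indic// setIT nuE//.
have [r0|r0] := leP 0%R r; last first.
  rewrite (_ : f @^-1` [set r] = set0); last exact: preimage_nnfun0.
  rewrite integral_set0 mule0 integral0_eq// => x _.
  by rewrite indic0 mulr0 mul0e.
rewrite integral_mkcond -ge0_integralZl//; last 2 first.
- by apply/(measurable_restrictT _ _).1 => //; exact: measurable_funTS.
- by move=> x _; apply: erestrict_ge0 => y _; rewrite lee_fin.
apply: eq_integral => x _; rewrite /patch indicE.
by case: ifPn => _; rewrite ?mulr1 ?mulr0 ?mul0e ?mule0.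
Qed.

Lemma ge0_integral_density (f : T -> \bar R) :
  measurable_fun setT f -> (forall x, 0 <= f x) ->
  \int[nu]_x f x = \int[mu]_x (f x * (g x)%:E).
Proof.
move=> mf f0.
pose f_ := nnsfun_approx measurableT mf.
have f_cvg x : (f_ n x)%:E @[n --> \oo] --> f x by exact: cvg_nnsfun_approx.
transitivity (\int[nu]_x (lim ((f_ n x)%:E @[n --> \oo]))).
  by apply/eq_integral => z _; apply/esym/cvg_lim.
rewrite monotone_convergence//; last 3 first.
- by move=> n; exact/measurable_EFinP.
- by move=> n z _; rewrite lee_fin.
- by move=> z _ a b ab; rewrite lee_fin; exact/lefP/nd_nnsfun_approx.
under eq_fun do rewrite density_nnsfun.
rewrite -monotone_convergence//; last 3 first.
- by move=> n; apply: emeasurable_funM => //; exact/measurable_EFinP.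
- by move=> n z _; rewrite mule_ge0// lee_fin.
- move=> z _ a b ab; rewrite lee_wpmul2r// ?lee_fin//.
  exact/lefP/nd_nnsfun_approx.
apply/eq_integral => z _; apply/cvg_lim => //.
by apply: cvgeZr.
Qed.

End Density.

Section AffineLebesgue.
Context {R : realType}.
Local Notation mu := (@lebesgue_measure R).
Variables (a m : R) (a0 : 0 < a).

Let aff (x : R) : measurableTypeR R := a * x + m.

Let maff : measurable_fun setT aff.
Proof. by apply: measurable_funD => //; exact: measurable_funM. Qed.

(** The image of Lebesgue measure under [aff], multiplied by [a], gives half-open intervals their
    length, hence is Lebesgue measure. *)
Lemma ge0_integral_affine (f : R -> \bar R) :
  measurable_fun setT f -> (forall x, (0 <= f x)%E) ->
  (\int[mu]_x f x = a%:E * \int[mu]_x f (a * x + m)%R)%E.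
Proof.
move=> mf f0.
rewrite -[X in (_ * X)%E]/(\int[mu]_(x in aff @^-1` setT) (f \o aff) x)%E.
rewrite -ge0_integral_pushforward//.
have a0' : 0 <= a by exact: ltW.
rewrite -(ge0_integral_mscale _ measurableT (NngNum a0'))//.
apply: eq_measure_integral => A mA _; apply: lebesgue_measure_unique => //.
move=> _ [[b c] _ <-] /=.
rewrite /mscale /= /pushforward.
have affE x : aff x = x * a + m by rewrite /aff mulrC.
have -> : aff @^-1` `]b, c] = `](b - m) / a, (c - m) / a]%classic.
  by apply/seteqP; split => x /=;
    rewrite !in_itv /= ltr_pdivrMr// ler_pdivlMr// ltrBlDr lerBrDr affE.
rewrite !lebesgue_measure_itv /= !lte_fin ltr_pM2r ?invr_gt0// ltrD2r.
case: ifPn => bc; last by rewrite mule0.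
rewrite -!EFinB -EFinM; congr EFin; by field; rewrite gt_eqF.
Qed.

End AffineLebesgue.

Section Gaussian.
Context {R : realType}.
Local Notation mu := (@lebesgue_measure R).
Implicit Types a b m s : R.

Definition gauss : probability (measurableTypeR R) R := normal_prob 0 1.

Lemma ge0_integral_normal m s (f : R -> \bar R) :
  measurable_fun setT f -> (forall x, (0 <= f x)%E) ->
  (\int[normal_prob m s]_x f x = \int[mu]_x (f x * (normal_pdf m s x)%:E))%E.
Proof.
move=> mf f0; apply: ge0_integral_density => //.
- exact: measurable_normal_pdf.
- exact: normal_pdf_ge0.
Qed.

Lemma normal_pdf_gt0E m s x : 0 < s -> normal_pdf m s x =
  (Num.sqrt (pi *+ 2))^-1 * (s^-1 * expR (- (x - m) ^+ 2 / (s ^+ 2 *+ 2))).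
Proof.
move=> s0; rewrite normal_pdfE ?gt_eqF// /normal_peak /normal_fun.
rewrite -mulrnAr sqrtrM ?sqr_ge0// sqrtr_sqr gtr0_norm// invfM mulrCA mulrA.
by rewrite (mulrC s^-1).
Qed.

Lemma normal_pdf_affine a m x : 0 < a ->
  normal_pdf 0 1 x = a * normal_pdf m a (a * x + m).
Proof.
move=> a0; rewrite !normal_pdf_gt0E// subr0 addrK invr1 mul1r (mulrCA a) (mulrA a) divff ?gt_eqF// mul1r.
congr (_ * expR _).
by field; rewrite gt_eqF.
Qed.

Lemma ge0_gauss_affine a m (f : R -> \bar R) : 0 < a ->
  measurable_fun setT f -> (forall x, (0 <= f x)%E) ->
  (\int[gauss]_x f (a * x + m)%R = \int[normal_prob m a]_x f x)%E.
Proof.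
move=> a0 mf f0.
have maff : measurable_fun [set: R] (fun x => a * x + m).
  by apply: measurable_funD => //; exact: measurable_funM.
rewrite (ge0_integral_normal m a mf f0).
rewrite (ge0_integral_normal 0 1 (measurableT_comp mf maff) (fun x => f0 _)).
rewrite [RHS](ge0_integral_affine m a0); last 2 first.
- by apply: emeasurable_funM => //; apply/measurable_EFinP; exact: measurable_normal_pdf.
- by move=> x; rewrite mule_ge0// lee_fin normal_pdf_ge0.
rewrite -ge0_integralZl//; last 3 first.
- apply: emeasurable_funM; first exact: (measurableT_comp mf maff).
  apply/measurable_EFinP.
  exact: (measurableT_comp (measurable_normal_pdf _ _) maff).
- by move=> x _; rewrite mule_ge0// lee_fin normal_pdf_ge0.
- by rewrite lee_fin ltW.
apply: eq_integral => x _.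
by rewrite (normal_pdf_affine m x a0) EFinM muleCA.
Qed.

(** Completing the square: the integrand times the standard density is a constant times the density
    of N(v/p, 1/p), where p = 1 - 2t. *)
Lemma gauss_exp_quadratic (t v : R) : t < 2^-1 ->
  (\int[gauss]_x (expR (t * x ^+ 2 + v * x))%:E =
   ((Num.sqrt (1 - 2 * t))^-1 * expR (v ^+ 2 / (2 * (1 - 2 * t))))%:E)%E.
Proof.
move=> t2; set p := 1 - 2 * t; have p0 : 0 < p by rewrite /p; lra.
have s0 : 0 < Num.sqrt p by rewrite sqrtr_gt0.
have sE : Num.sqrt p ^+ 2 = p by rewrite sqr_sqrtr// ltW.
rewrite ge0_integral_normal; last 2 first.
- apply/measurable_EFinP; apply: measurableT_comp => //.
  apply: measurable_funD; apply: measurable_funM => //.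
- by move=> x; rewrite lee_fin expR_ge0.
transitivity (\int[mu]_x (((Num.sqrt p)^-1 * expR (v ^+ 2 / (2 * p)))%:E *
    (normal_pdf (v / p) (Num.sqrt p)^-1 x)%:E))%E.
  apply: eq_integral => x _; rewrite -!EFinM; congr EFin.
  rewrite !normal_pdf_gt0E ?invr_gt0// invrK invr1 mul1r subr0 mulrCA -expRD.
  rewrite [RHS]mulrCA; congr (_ * _).
  rewrite mulrACA mulVf ?gt_eqF// mul1r -expRD; congr expR.
  by rewrite exprVn sE /p; field; rewrite -/p gt_eqF.
rewrite ge0_integralZl//; last 2 first.
- by apply/measurable_EFinP; exact: measurable_normal_pdf.
- by move=> x _; rewrite lee_fin normal_pdf_ge0.
by rewrite integral_normal_pdf mule1.
Qed.

End Gaussian.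

(** * Gaussian likelihood ratios and rotations *)

(** The optimal weight would be sqrt(B/A); the weight |x|/A gives the same conclusion without a
    square root, [A = 0] being treated apart. *)
Lemma sqr_le_of_amgm (R : realFieldType) (x A B : R) : 0 <= A -> 0 <= B ->
  (forall s, 0 < s -> 2 * `|x| <= s * A + B / s) -> x ^+ 2 <= A * B.
Proof.
move=> A0 B0 H; rewrite -real_normK ?num_real//.
have [->|x0] := eqVneq x 0; first by rewrite normr0 expr0n mulr_ge0.
have {x0} := x0; rewrite -normr_gt0; set y := `|x| in H * => y0.
move: A0; rewrite le_eqVlt => /predU1P[A0|A0].
  have := H ((B + 1) / y) (divr_gt0 (ltr_wpDl B0 ltr01) y0).
  rewrite -A0 mulr0 add0r invf_div mulrCA => yB.
  have : B / (B + 1) < 1 by rewrite ltr_pdivrMr; lra.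
  by rewrite -(ltr_pM2l y0) mulr1; lra.
have := H (y / A) (divr_gt0 y0 A0).
rewrite divfK ?gt_eqF// invf_div => yB.
have : y <= B * A / y by rewrite -mulrA; lra.
by rewrite ler_pdivlMr// -expr2 mulrC.
Qed.

(** With [x] a difference of means and [v] a variance, the freedom to add constants to a test
    improves the factor [Q] to [Q - 1]. The best shift is x/(Q - 1). *)
Lemma sqr_le_of_shifts (R : realFieldType) (x v Q : R) : 1 <= Q -> 0 <= v ->
  (forall c, (x + c) ^+ 2 <= Q * (v + c ^+ 2)) -> x ^+ 2 <= (Q - 1) * v.
Proof.
rewrite le_eqVlt => /predU1P[<-|Q1] v0 H.
  (* For [Q = 1] the best shift is infinite; the shift v/x already excludes a nonzero [x]. *)
  rewrite subrr mul0r; have [->|x0] := eqVneq x 0; first by rewrite expr0n.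
  have := H (v / x); rewrite sqrrD mul1r (mulrC x) divfK//.
  by lra.
have Q0 : 0 < Q - 1 by lra.
have := H (x / (Q - 1)).
rewrite (_ : x + _ = x * (Q / (Q - 1))); last by field; rewrite gt_eqF.
rewrite -subr_ge0.
rewrite (_ : _ - _ = (Q / (Q - 1)) * ((Q - 1) * v - x ^+ 2)).
  by rewrite pmulr_rge0 ?subr_ge0// divr_gt0//; lra.
by field; rewrite gt_eqF.
Qed.

Lemma invsqrt_le (R : rcfType) (p q : R) : 0 < p -> 0 <= q -> 1 <= q ^+ 2 * p ->
  (Num.sqrt p)^-1 <= q.
Proof.
move=> p0 q0 qp; have s0 : 0 < Num.sqrt p by rewrite sqrtr_gt0.
rewrite -(ler_pM2r s0) mulVf ?gt_eqF// -(@ler_pXn2r _ 2) ?nnegrE ?mulr_ge0 ?(ltW s0)//.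
by rewrite expr1n exprMn sqr_sqrtr// ltW.
Qed.

Lemma invsqrt_ub (R : rcfType) (u : R) : 0 <= u -> u <= 2^-1 ->
  (Num.sqrt (1 - u))^-1 <= 1 + u.
Proof. by move=> u0 u1; apply: invsqrt_le; [lra|lra|nra]. Qed.

Section Ratio.
Context {R : realType}.
Implicit Types a b m x y e : R.

(* The density of N(m, a^2) with respect to N(0, 1). *)
Definition lr a m x := a^-1 * expR (x ^+ 2 / 2 - (x - m) ^+ 2 / (2 * a ^+ 2)).

Lemma lr_gt0 a m x : 0 < a -> 0 < lr a m x.
Proof. by move=> a0; rewrite mulr_gt0 ?invr_gt0 ?expR_gt0. Qed.

Lemma normal_pdf_lr a m x : 0 < a ->
  normal_pdf m a x = lr a m x * normal_pdf 0 1 x.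
Proof.
move=> a0; rewrite !normal_pdf_gt0E// /lr invr1 mul1r [RHS]mulrCA; congr (_ * _).
rewrite -mulrA -expRD; congr (_ * expR _).
by field; rewrite gt_eqF.
Qed.

Lemma measurable_lr d (T : measurableType d) a (m g : T -> R) :
  measurable_fun setT m -> measurable_fun setT g ->
  measurable_fun setT (fun z => lr a (m z) (g z)).
Proof.
move=> mm mg; apply: measurable_funM; first exact: measurable_cst.
apply: measurableT_comp; first exact: measurable_expR.
apply: measurable_funB; apply: measurable_funM; try exact: measurable_cst.
  exact: measurable_funX.
by apply: measurable_funX; apply: measurable_funB.
Qed.

Lemma measurable_affine a m : measurable_fun [set: R] (fun x => a * x + m).
Proof. by apply: measurable_funD => //; exact: measurable_funM. Qed.

Lemma ge0_gauss_shift a m (f : R -> \bar R) : 0 < a ->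
  measurable_fun setT f -> (forall x, (0 <= f x)%E) ->
  (\int[gauss]_x f (a * x + m)%R = \int[gauss]_x (f x * (lr a m x)%:E))%E.
Proof.
move=> a0 mf f0; rewrite (ge0_gauss_affine m a0 mf f0).
rewrite (ge0_integral_normal m a mf f0) [RHS](ge0_integral_normal 0 1).
- by apply: eq_integral => x _; rewrite normal_pdf_lr// EFinM muleA.
- apply: emeasurable_funM => //; apply/measurable_EFinP.
  by apply: measurable_lr.
- by move=> x; rewrite mule_ge0// lee_fin ltW// lr_gt0.
Qed.

(** The exponent is chosen so that [gauss_lr_weight] reproduces the weight up to the factor 1 +
    4b^2, which also bounds its Gaussian integral. *)
Definition weight b y := expR (2 * b ^+ 2 * y ^+ 2).

Lemma weight_ge1 b y : 1 <= weight b y.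
Proof. by rewrite -expR0 ler_expR; have := sqr_ge0 b; have := sqr_ge0 y; nra. Qed.

Variables (a b : R).
Hypotheses (a0 : 0 < a) (ab1 : a ^+ 2 + b ^+ 2 = 1) (b8 : b ^+ 2 <= 8^-1).

Lemma gauss_weight : (\int[gauss]_y (weight b y)%:E <= (1 + 4 * b ^+ 2)%:E)%E.
Proof.
move: (b8) => b8'.
have b0 := sqr_ge0 b.
rewrite (eq_integral (fun y : measurableTypeR R => (expR (2 * b ^+ 2 * y ^+ 2 + 0 * y))%:E)); last first.
  by move=> y _; rewrite mul0r addr0.
rewrite gauss_exp_quadratic; last by lra.
rewrite expr0n mul0r expR0 mulr1 lee_fin mulrA (_ : 2 * 2 = 4 :> R); last by ring.
by apply: invsqrt_ub; lra.
Qed.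

(** The mixture of N(be, a^2) over a standard normal [e] is N(0, 1) itself, so its density with
    respect to N(0, 1) is 1. *)
Lemma gauss_lr x : (\int[gauss]_e (lr a (b * e) x)%:E = 1)%E.
Proof.
move: (ab1) => ab1'.
have a20 : 0 < a ^+ 2 by rewrite exprn_gt0.
rewrite (eq_integral (fun e : measurableTypeR R => (a^-1 * expR (x ^+ 2 / 2 - x ^+ 2 / (2 * a ^+ 2)))%:E *
    (expR (- (b ^+ 2 / (2 * a ^+ 2)) * e ^+ 2 + (b * x / a ^+ 2) * e))%:E))%E; last first.
  move=> e _; rewrite -EFinM /lr -[in RHS](mulrA a^-1) -expRD; congr (_ * expR _)%:E.
  by field; rewrite gt_eqF.
rewrite ge0_integralZl//=; last 2 first.
- apply/measurable_EFinP; apply: measurableT_comp => //.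
  by apply: measurable_funD; apply: measurable_funM.
- by rewrite lee_fin mulr_ge0 ?invr_ge0 ?expR_ge0// ltW.
have pE : 1 - 2 * (- (b ^+ 2 / (2 * a ^+ 2))) = a ^- 2.
  by rewrite (_ : b ^+ 2 = 1 - a ^+ 2); [field; rewrite gt_eqF|lra].
rewrite gauss_exp_quadratic; last first.
  by rewrite (@le_lt_trans _ _ 0)// oppr_le0 divr_ge0// ?sqr_ge0// mulr_ge0// ltW.
rewrite -EFinM pE -exprVn sqrtr_sqr gtr0_norm ?invr_gt0// invrK.
rewrite mulrACA mulVf ?gt_eqF// mul1r -expRD [X in expR X](_ : _ = 0) ?expR0//.
by rewrite !exprMn (_ : b ^+ 2 = 1 - a ^+ 2); [field; rewrite gt_eqF|lra].
Qed.

(** The integrand is the exponential of a quadratic with leading coefficient 3b^2/2. The prefactor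
    1/sqrt((1 - b^2)(1 - 3b^2)) is at most 1/sqrt(1 - 4b^2), and the exponents compare because 8b^2
    <= 2. *)
Lemma gauss_lr_weight e :
  (\int[gauss]_y (lr a (b * e) (a * y + b * e) * weight b y)%:E <=
   ((1 + 4 * b ^+ 2) * weight b e)%:E)%E.
Proof.
move: (a0) (ab1) (b8) => a0' ab1' b8'.
have b0 := sqr_ge0 b; have a20 : 0 < a ^+ 2 by rewrite exprn_gt0.
rewrite (eq_integral (fun y : measurableTypeR R => (a^-1 * expR (b ^+ 2 * e ^+ 2 / 2))%:E *
    (expR ((3 * b ^+ 2 / 2) * y ^+ 2 + (a * b * e) * y))%:E))%E; last first.
  move=> y _; rewrite -EFinM /lr /weight -!(mulrA a^-1) -!expRD; congr (_ * expR _)%:E.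
  have ab0 : a ^+ 2 + b ^+ 2 - 1 = 0 by lra.
  rewrite -[RHS]addr0 -(mul0r (y ^+ 2 / 2)) -ab0.
  by field; rewrite gt_eqF.
rewrite ge0_integralZl//=; last 2 first.
- apply/measurable_EFinP; apply: measurableT_comp => //.
  by apply: measurable_funD; apply: measurable_funM.
- by rewrite lee_fin mulr_ge0 ?invr_ge0 ?expR_ge0// ltW.
rewrite gauss_exp_quadratic; last by lra.
rewrite -EFinM lee_fin mulrACA; apply: ler_pM.
- by rewrite mulr_ge0 ?invr_ge0 ?sqrtr_ge0// ltW.
- by rewrite mulr_ge0 ?expR_ge0.
- apply: (@le_trans _ _ (Num.sqrt (1 - 4 * b ^+ 2))^-1); last by apply: invsqrt_ub; lra.
  have -> : a = Num.sqrt (1 - b ^+ 2).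
    by rewrite (_ : 1 - b ^+ 2 = a ^+ 2) ?sqrtr_sqr ?gtr0_norm//; lra.
  rewrite -invfM -sqrtrM; last by lra.
  rewrite lef_pV2 ?posrE ?sqrtr_gt0; [|nra|lra].
  by rewrite ler_wsqrtr//; nra.
- rewrite -expRD ler_expR.
  have p0 : 0 < 2 * (1 - 2 * (3 * b ^+ 2 / 2)) by lra.
  rewrite -lerBrDl ler_pdivrMr// !exprMn.
  rewrite (_ : a ^+ 2 = 1 - b ^+ 2); last by lra.
  rewrite -subr_ge0 (_ : _ - _ = (b ^+ 2 * e ^+ 2) * (2 - 8 * b ^+ 2)); last by field.
  apply: mulr_ge0; last by lra.
  by rewrite mulr_ge0 ?sqr_ge0.
Qed.

(** For fixed [e] the inner integral becomes one against [lr a (b * e)]; after Tonelli, [gauss_lr]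
    integrates the ratio out. *)
Lemma ge0_gauss_rotation (q : R -> \bar R) :
  measurable_fun setT q -> (forall x, (0 <= q x)%E) ->
  (\int[gauss]_e \int[gauss]_y q (a * y + b * e)%R = \int[gauss]_x q x)%E.
Proof.
move=> mq q0.
transitivity (\int[gauss]_e \int[gauss]_x (q x * (lr a (b * e) x)%:E))%E.
  by apply: eq_integral => e _; exact: ge0_gauss_shift.
transitivity (\int[gauss]_x \int[gauss]_e (q x * (lr a (b * e) x)%:E))%E.
  apply: (fubini_tonelli (m1 := gauss) (m2 := gauss)
    (fun p => q p.2 * (lr a (b * p.1) p.2)%:E)%E).
  - apply: emeasurable_funM; first exact: (measurableT_comp mq).
    apply/measurable_EFinP; apply: measurable_lr => //.
    exact: measurable_funM.
  - by move=> p; rewrite mule_ge0// lee_fin ltW// lr_gt0.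
apply: eq_integral => x _; rewrite ge0_integralZl//=.
- by rewrite gauss_lr mule1.
- apply/measurable_EFinP; apply: measurable_lr; last exact: measurable_cst.
  exact: measurable_funM.
- by move=> e _; rewrite lee_fin ltW// lr_gt0.
Qed.

Lemma measurable_mix : measurable_fun setT (fun p : R * R => a * p.2 + b * p.1).
Proof. by apply: measurable_funD; apply: measurable_funM. Qed.

Lemma gauss_rotation (G : R -> R) : bm G ->
  \int[gauss]_e \int[gauss]_y G (a * y + b * e) = \int[gauss]_x G x.
Proof.
move=> bG; have [mG [M GM]] := bG.
have bGM : bm (fun x => G x + M) by apply: bmD => //; exact: bm_cst.
have bGab e : bm (fun y => G (a * y + b * e)).
  by apply: (bm_comp (measurable_affine _ _) bG).
have bGI : bm (fun e => \int[gauss]_y G (a * y + b * e)).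
  by apply: (bm_integral2 (f := fun p : R * measurableTypeR R => G (a * p.2 + b * p.1)) gauss);
     apply: (bm_comp measurable_mix bG).
have bM : bm (T := measurableTypeR R) (fun=> M) by exact: bm_cst.
have bMab e : bm (fun y => G (a * y + b * e) + M) by apply: bmD.
have bMI : bm (fun e => \int[gauss]_y (G (a * y + b * e) + M)).
  apply: (bm_integral2
    (f := fun p : R * measurableTypeR R => G (a * p.2 + b * p.1) + M) gauss).
  by apply: (bm_comp measurable_mix bGM).
apply: (addIr M); transitivity (\int[gauss]_x (G x + M)); last first.
  by rewrite bintD// bint_cst.
transitivity (\int[gauss]_e \int[gauss]_y (G (a * y + b * e) + M)).
  rewrite -[X in _ + X](bint_cst gauss M) -bintD//.
  by apply: eq_Rintegral => e _; rewrite (bintD gauss (bGab e) bM) (bint_cst gauss).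
suff: (\int[gauss]_e \int[gauss]_y (G (a * y + b * e) + M))%:E =
  (\int[gauss]_x (G x + M))%:E by case.
rewrite -[LHS]bint_EFin// -[RHS]bint_EFin//.
rewrite -(ge0_gauss_rotation (q := fun x => (G x + M)%:E)).
- by apply: eq_integral => e _; rewrite (bint_EFin gauss (bMab e)).
- by apply/measurable_EFinP; case: bGM.
- by move=> x; rewrite lee_fin; have := GM x; rewrite ler_norml => /andP[]; lra.
Qed.

(* AM-GM against the likelihood ratio, optimised over the weight s. *)
Lemma gauss_weighted_sqr (G beta : R -> R) e : bm G -> bm beta ->
  (forall y, G y ^+ 2 <= weight b y * beta (a * y + b * e)) ->
  (\int[gauss]_y G y) ^+ 2 <=
    (1 + 4 * b ^+ 2) * weight b e * \int[gauss]_x beta x.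
Proof.
move=> bG bbeta Gbeta; have w0 y : 0 < weight b y by exact: expR_gt0.
have beta0 x : 0 <= beta x.
  have := Gbeta ((x - b * e) / a); rewrite mulrCA divff ?gt_eqF// mulr1 subrK => H.
  by rewrite -(pmulr_rge0 _ (w0 ((x - b * e) / a))) (le_trans _ H)// sqr_ge0.
have l0 y : 0 < lr a (b * e) (a * y + b * e) by exact: lr_gt0.
apply: sqr_le_of_amgm.
- by rewrite mulr_ge0 ?ltW// ltr_wpDr// mulr_ge0 ?sqr_ge0.
- by apply: Rintegral_ge0.
move=> s s0.
apply: (@le_trans _ _ (\int[gauss]_y (2 * `|G y|))).
  by rewrite bintZ ?ler_pM2l ?bint_abs//; exact: bm_abs.
have b2G : bm (fun y => 2 * `|G y|).
  by apply: bmM; [exact: bm_cst|exact: bm_abs].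
rewrite -lee_fin -bint_EFin//.
have mr : measurable_fun [set: R] (fun x => beta x / lr a (b * e) x).
  apply: measurable_funM; first by case: bbeta.
  rewrite (_ : (fun _ => _) = (fun x => a * expR (- (x ^+ 2 / 2 -
      (x - b * e) ^+ 2 / (2 * a ^+ 2))))); last first.
    by apply/funext => x; rewrite /lr expRN invfM invrK.
  apply: measurable_funM; first exact: measurable_cst.
  apply: measurableT_comp; first exact: measurable_expR.
  apply: measurableT_comp => //; apply: measurable_funB; apply: measurable_funM => //.
  by apply: measurable_funX; apply: measurable_funB.
have mab := measurable_affine a (b * e).
have mlW : measurable_fun [set: R]
    (fun y => lr a (b * e) (a * y + b * e) * weight b y).
  apply: measurable_funM; first exact: measurable_lr.
  apply: measurableT_comp; first exact: measurable_expR.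
  by apply: measurable_funM => //; exact: measurable_funX.
have mq : measurable_fun [set: R]
    (fun y => beta (a * y + b * e) / lr a (b * e) (a * y + b * e)).
  exact: (measurableT_comp mr mab).
(* The ratio is inserted so that the second term, changed to the variable x = ay + be, integrates to
   that of [beta]; the first term is what [gauss_lr_weight] bounds. *)
apply: (@le_trans _ _ (\int[gauss]_y ((s * (lr a (b * e) (a * y + b * e) *
    weight b y))%:E +
  (s^-1 * (beta (a * y + b * e) / lr a (b * e) (a * y + b * e)))%:E))%E).
  apply: ge0_le_integral => //=.
  - by apply/measurable_EFinP; case: b2G.
  - by apply: emeasurable_funD; apply/measurable_EFinP; exact: measurable_funM.
  - move=> y _; rewrite lee_fin.
    set l := lr _ _ _; set B := beta _; set W := weight b y.
    have B0 : 0 <= B by exact: beta0.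
    have lp : 0 < l by exact: l0.
    have sl0 : 0 < s * l by rewrite mulr_gt0.
    rewrite (_ : s^-1 * _ = B / (s * l)); last by field; rewrite !gt_eqF.
    have GW : `|G y| ^+ 2 <= W * B by rewrite real_normK ?num_real// Gbeta.
    have W0 : 0 < W := w0 y.
    have sq : 0 <= (s * l * W - `|G y|) ^+ 2 / (s * l * W).
      by rewrite divr_ge0 ?sqr_ge0// ltW// (mulr_gt0 sl0 W0).
    have GB : `|G y| ^+ 2 / (s * l * W) <= B / (s * l).
      rewrite ler_pdivrMr; last by exact: mulr_gt0.
      have -> : B / (s * l) * (s * l * W) = W * B by field; rewrite !gt_eqF.
      exact: GW.
    have sqE : (s * l * W - `|G y|) ^+ 2 / (s * l * W) =
        s * (l * W) - 2 * `|G y| + `|G y| ^+ 2 / (s * l * W).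
      by field; rewrite !gt_eqF.
    by move: sq; rewrite sqE; lra.
have s0' : 0 <= s by exact: ltW.
have si0 : 0 <= s^-1 by rewrite invr_ge0.
have lW0 y : 0 <= lr a (b * e) (a * y + b * e) * weight b y.
  by apply: mulr_ge0; exact: ltW.
have q0 y : 0 <= beta (a * y + b * e) / lr a (b * e) (a * y + b * e).
  by apply: divr_ge0 => //; exact: ltW.
rewrite ge0_integralD//=; first last.
- exact/measurable_EFinP/measurable_funM.
- by move=> y _; rewrite lee_fin mulr_ge0.
- exact/measurable_EFinP/measurable_funM.
- by move=> y _; rewrite lee_fin mulr_ge0.
under eq_integral do rewrite EFinM.
rewrite ge0_integralZl//; first last.
- by move=> y _; rewrite lee_fin.
- exact/measurable_EFinP.
under [X in (_ + X)%E]eq_integral do rewrite EFinM.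
rewrite ge0_integralZl//; first last.
- by move=> y _; rewrite lee_fin.
- exact/measurable_EFinP.
rewrite EFinD leeD//.
  by rewrite EFinM lee_pmul2l ?lte_fin// gauss_lr_weight.
rewrite (@ge0_gauss_shift a (b * e) (fun x => (beta x / lr a (b * e) x)%:E) a0); last 2 first.
- exact/measurable_EFinP.
- by move=> x; rewrite lee_fin mulr_ge0// invr_ge0 ltW// lr_gt0.
rewrite (eq_integral (fun x : measurableTypeR R => (beta x)%:E)); last first.
  by move=> x _; rewrite -EFinM divfK// gt_eqF// lr_gt0.
by rewrite bint_EFin// -EFinM mulrC.
Qed.

(** As the weight is at least 1, [gauss_weighted_sqr] applies to [G + c] with [beta] its square.
    Since [G] is centered, that square integrates to the one of [G] plus c^2, and [sqr_le_of_shifts]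
    brings in the [- 1] that makes the factor small with [b]. *)
Lemma gauss_centered_sqr (G : R -> R) (M e : R) : bm G ->
  (forall x, `|G x| <= M) -> \int[gauss]_x G x = 0 ->
  (\int[gauss]_y G (a * y + b * e)) ^+ 2 <=
    ((1 + 4 * b ^+ 2) * weight b e - 1) * M ^+ 2.
Proof.
move: (a0) (ab1) (b8) => a0' ab1' b8'.
move=> bG GM G0; have b0 := sqr_ge0 b; have w1 := weight_ge1 b e.
have bGab : bm (fun y => G (a * y + b * e)).
  by apply: (bm_comp (measurable_affine _ _) bG).
apply: (@le_trans _ _ (((1 + 4 * b ^+ 2) * weight b e - 1) *
    \int[gauss]_x G x ^+ 2)); last first.
  apply: ler_wpM2l; first by nra.
  rewrite -(bint_cst gauss (M ^+ 2)); apply: le_bint; [exact: bmX|exact: bm_cst|].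
  by move=> x; rewrite -[G x ^+ 2]real_normK ?num_real// ler_pXn2r// ?nnegrE// (le_trans _ (GM x)).
apply: sqr_le_of_shifts; first by nra.
  by apply: Rintegral_ge0 => x _; exact: sqr_ge0.
move=> c.
have bGc : bm (fun x => G x + c) by apply: bmD => //; exact: bm_cst.
have -> : \int[gauss]_x G x ^+ 2 + c ^+ 2 = \int[gauss]_x (G x + c) ^+ 2.
  have := bint_variance gauss bGc; rewrite bintD ?G0 ?bint_cst ?add0r//; last exact: bm_cst.
  move/eqP; rewrite eq_sym subr_eq => /eqP ->; congr (_ + _).
  by apply: eq_Rintegral => x _; rewrite addrK.
rewrite -{1}(bint_cst gauss c) -bintD//; last exact: bm_cst.
apply: (gauss_weighted_sqr (beta := fun x => (G x + c) ^+ 2)).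
- by apply: bmD => //; exact: bm_cst.
- exact: bmX.
- by move=> y; rewrite ler_peMl ?sqr_ge0 ?weight_ge1.
Qed.

End Ratio.

(** * Potentials and the non-private bound *)

Lemma ratio_dist (R : realFieldType) (e x y : R) : 1 <= e -> 0 <= x -> 0 <= y ->
  x <= e * y -> y <= e * x -> `|x - y| <= (e - 1) * y.
Proof. by move=> e1 x0 y0 xy yx; rewrite ler_norml; apply/andP; split; nra. Qed.

Section Privacy.
Context {R : realType} {alpha : R} (K : channel alpha).
Implicit Types g : out K -> R.

Local Notation "'K_' x" := (@channel_law _ _ K x) (at level 10, x at level 9).

Lemma channel_private_ge0 g (x x' : R) : bm g -> (forall z, 0 <= g z) ->
  \int[K_ x]_z g z <= expR alpha * \int[K_ x']_z g z.
Proof.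
move=> bg g0; have mg : measurable_fun setT (EFin \o g).
  by apply/measurable_EFinP; case: bg.
rewrite -lee_fin EFinM -!bint_EFin//.
rewrite -[X in (X%:E * _)%E]/((NngNum (expR_ge0 alpha))%:num).
rewrite -(ge0_integral_mscale (K_ x') measurableT (NngNum (expR_ge0 alpha)))//.
- apply: ge0_le_measure_integral; [|by []| |by []].
    by move=> S mS; exact: (@kernel_private _ _ K x x' S mS).
  by move=> z; rewrite lee_fin.
- by move=> z _; rewrite lee_fin.
Qed.

(** The privacy ratio passes to integrals of nonnegative functions only; it is applied to the
    positive and negative parts [p] and [n], whose sum is |g|. *)
Lemma channel_private g (x x' : R) : 0 <= alpha -> bm g ->
  `|\int[K_ x]_z g z - \int[K_ x']_z g z| <=
  (expR alpha - 1) * \int[K_ x']_z `|g z|.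
Proof.
move=> alpha0 bg.
have ge0_case g' : bm g' -> (forall z, 0 <= g' z) ->
  `|\int[K_ x]_z g' z - \int[K_ x']_z g' z| <= (expR alpha - 1) * \int[K_ x']_z g' z.
  move=> bg' g'0.
  apply: ratio_dist; [|exact: Rintegral_ge0|exact: Rintegral_ge0| |].
  - by rewrite -expR0 ler_expR.
  - exact: channel_private_ge0.
  - exact: channel_private_ge0.
pose p z := (`|g z| + g z) / 2; pose n z := (`|g z| - g z) / 2.
have bp : bm p.
  by apply: bmM; [apply: bmD => //; exact: bm_abs|exact: bm_cst].
have bn : bm n.
  by apply: bmM; [apply: bmB => //; exact: bm_abs|exact: bm_cst].
have p0 z : 0 <= p z by rewrite /p; have := ler_norm (- g z); rewrite normrN; lra.
have n0 z : 0 <= n z by rewrite /n; have := ler_norm (g z); lra.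
have -> : g = (fun z => p z - n z) by apply/funext => z; rewrite /p /n; field.
have -> : (fun z => `|p z - n z|) = (fun z => p z + n z).
  apply/funext => z; rewrite (_ : p z - n z = g z); last by rewrite /p /n; field.
  by rewrite /p /n; field.
rewrite !bintB// bintD//.
rewrite opprD addrACA mulrDr; apply: le_trans (ler_normD _ _) _.
rewrite lerD ?ge0_case// -normrN opprD !opprK ge0_case//.
Qed.

End Privacy.

Section MixLaw.
Context {R : realType} {alpha : R} (K : channel alpha).
Implicit Types g : out K -> R.

Local Notation "'K_' x" := (@channel_law _ _ K x) (at level 10, x at level 9).

Lemma bm_channel g : bm g -> bm (fun x : R => \int[K_ x]_z g z).
Proof.
move=> bg; apply: (bm_integral_channel (g := id) (f := fun p => g p.2)) => //.
exact: (bm_comp measurable_snd bg).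
Qed.

(** Expectation under the output law of [K] for a standard normal input, that is, under white
    noise. *)
Definition mix_law g := \int[gauss]_x \int[K_ x]_z g z.

Lemma mix_lawB g g' : bm g -> bm g' ->
  mix_law (fun z => g z - g' z) = mix_law g - mix_law g'.
Proof.
move=> bg bg'; rewrite /mix_law -bintB; [|exact: bm_channel|exact: bm_channel].
by apply: eq_Rintegral => x _; rewrite bintB.
Qed.

Lemma mix_lawZ g c : bm g -> mix_law (fun z => c * g z) = c * mix_law g.
Proof.
move=> bg; rewrite /mix_law -bintZ; last exact: bm_channel.
by apply: eq_Rintegral => x _; rewrite bintZ.
Qed.

Lemma mix_lawD g g' : bm g -> bm g' ->
  mix_law (fun z => g z + g' z) = mix_law g + mix_law g'.
Proof.
move=> bg bg'; rewrite /mix_law -bintD; [|exact: bm_channel|exact: bm_channel].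
by apply: eq_Rintegral => x _; rewrite bintD.
Qed.

Lemma mix_law_cst c : mix_law (fun=> c) = c.
Proof. by rewrite /mix_law; under eq_Rintegral do rewrite bint_cst; rewrite bint_cst. Qed.

Lemma le_mix_law g g' : bm g -> bm g' -> (forall z, g z <= g' z) ->
  mix_law g <= mix_law g'.
Proof.
move=> bg bg' gg'; apply: le_bint; [exact: bm_channel|exact: bm_channel|].
by move=> x; apply: le_bint.
Qed.

Lemma mix_law_ge0 g : (forall z, 0 <= g z) -> 0 <= mix_law g.
Proof. by move=> g0; apply: Rintegral_ge0 => x _; apply: Rintegral_ge0. Qed.

Lemma mix_law_sqr g : bm g -> mix_law g ^+ 2 <= mix_law (fun z => g z ^+ 2).
Proof.
move=> bg; apply: (le_trans (bint_sqr gauss (bm_channel bg))).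
apply: le_bint; [by apply: bmX; exact: bm_channel|by apply: bm_channel; exact: bmX|].
by move=> x; exact: bint_sqr.
Qed.

Let bm_channel_pair d (T : measurableType d) (f : out K * T -> R) : bm f ->
  bm (fun p : T * measurableTypeR R => \int[K_ p.2]_z f (z, p.1)).
Proof.
move=> bf.
apply: (bm_integral_channel (g := snd) (f := fun q => f (q.2, q.1.1))) => //.
apply: (bm_comp _ bf); apply: measurable_fun_pair => //=.
exact: (measurableT_comp measurable_fst).
Qed.

Lemma bm_mix_law d (T : measurableType d) (f : out K * T -> R) : bm f ->
  bm (fun y => mix_law (fun z => f (z, y))).
Proof. by move=> bf; exact: (bm_integral2 gauss (bm_channel_pair bf)). Qed.

Lemma mix_law_Fubini d (T : measurableType d) (m : probability T R)
    (f : out K * T -> R) : bm f ->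
  \int[m]_y mix_law (fun z => f (z, y)) = mix_law (fun z => \int[m]_y f (z, y)).
Proof.
move=> bf; rewrite /mix_law.
rewrite (bint_Fubini m gauss (bm_channel_pair bf)) /=.
apply: eq_Rintegral => x _.
rewrite -(bint_Fubini (K_ x) m bf) //.
Qed.

Lemma channel_mix_law g x : 0 <= alpha -> bm g ->
  `|\int[K_ x]_z g z - mix_law g| <= (expR alpha - 1) * mix_law (fun z => `|g z|).
Proof.
move=> alpha0 bg; have bKg := bm_channel bg.
have bKag := bm_channel (bm_abs bg).
rewrite -mix_lawZ; last exact: bm_abs.
rewrite -[X in `|X - _|](bint_cst gauss) -bintB//; last exact: bm_cst.
have bd : bm (fun x' : R => \int[K_ x]_z g z - \int[K_ x']_z g z).
  by apply: bmB => //; exact: bm_cst.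
apply: (le_trans (bint_abs gauss bd)); apply: le_bint.
- exact: bm_abs.
- by apply: bm_channel; apply: bmM; [exact: bm_cst|exact: bm_abs].
- by move=> x'; rewrite bintZ ?channel_private//; exact: bm_abs.
Qed.

End MixLaw.
Arguments mix_law {R alpha} K g.

(* [Phi F B] should be read as |F|^2 <= B for some norm on functions of the
   current noise variable. *)
Record potential {R : realType} {alpha : R} (a b D c : R)
    (Phi : (R -> R) -> R -> Prop) : Prop := Potential {
  potential_cst : forall x, Phi (fun=> x) (x ^+ 2) ;
  potential_le : forall F B B', B <= B' -> Phi F B -> Phi F B' ;
  potential_mix : forall d (T : measurableType d) (rho : probability T R)
    (f : T * R -> R) (B : T -> R), bm f -> bm B ->
    (forall z, Phi (fun y => f (z, y)) (B z)) ->
    Phi (fun y => \int[rho]_z f (z, y)) (\int[rho]_z B z) ;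
  potential_step : forall (K : channel alpha) (f : out K * R -> R)
    (B : out K -> R), bm f -> bm B ->
    (forall z, Phi (fun y => f (z, y)) (B z)) ->
    Phi (fun e => \int[gauss]_y \int[@channel_law _ _ K (a * y + b * e)]_z f (z, y))
      (D * mix_law K B) ;
  potential_final : forall F B, bm F -> Phi F B ->
    (\int[gauss]_y F y) ^+ 2 <= c * B }.


Lemma gauss_le_weight (R : realType) (b : R) (F : R -> R) (B : R) :
  b ^+ 2 <= 8^-1 -> bm F -> 0 <= B ->
  (forall y, 0 <= F y <= weight b y * B) ->
  \int[gauss]_y F y <= (1 + 4 * b ^+ 2) * B.
Proof.
move=> b8 bF B0 FB; rewrite -lee_fin -bint_EFin//.
have mw : measurable_fun setT (fun y => (weight b y)%:E).
  apply/measurable_EFinP; apply: measurableT_comp; first exact: measurable_expR.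
  by apply: measurable_funM => //; exact: measurable_funX.
apply: (@le_trans _ _ (\int[gauss]_y (B%:E * (weight b y)%:E))%E).
  apply: ge0_le_integral => //.
  - by move=> y _; rewrite lee_fin; case/andP: (FB y).
  - by apply/measurable_EFinP; case: bF.
  - exact: emeasurable_funM.
  - by move=> y _; rewrite -EFinM lee_fin mulrC; case/andP: (FB y).
rewrite ge0_integralZl//; last by move=> y _; rewrite lee_fin expR_ge0.
rewrite mulrC EFinM lee_pmul ?lee_fin ?gauss_weight//.
by apply: integral_ge0 => y _; rewrite lee_fin expR_ge0.
Qed.

(** Jensen's inequality for the channel leaves the integral of [B] against [K] as the [beta] of
    [gauss_weighted_sqr]. The second constant bounds the integral of the weight and is paid once,
    when the initial noise is averaged. *)
Lemma potential_weight (R : realType) (alpha a b : R) :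
  0 < a -> a ^+ 2 + b ^+ 2 = 1 -> b ^+ 2 <= 8^-1 ->
  potential (alpha := alpha) a b (1 + 4 * b ^+ 2) (1 + 4 * b ^+ 2)
    (fun F B => forall y, F y ^+ 2 <= weight b y * B).
Proof.
move=> a0 ab1 b8; have w0 y : 0 < weight b y by exact: expR_gt0.
split.
- by move=> x y; rewrite ler_peMl ?sqr_ge0 ?weight_ge1.
- move=> F B B' BB' FB y; apply: (le_trans (FB y)).
  by rewrite ler_wpM2l// ltW.
- move=> d T rho f B bf bB fB y.
  have bfy : bm (fun z => f (z, y)) by exact: bm_pair2.
  apply: (le_trans (bint_sqr rho bfy)); rewrite -bintZ//; apply: le_bint => //.
    exact: bmX.
  by apply: bmM => //; exact: bm_cst.
- move=> K f B bf bB fB e; rewrite mulrCA mulrA.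
  apply: (gauss_weighted_sqr a0 ab1 b8).
  + apply: (bm_integral_channel (g := fun y => a * y + b * e)
      (f := fun p => f (p.2, p.1))).
      exact: measurable_affine.
    by apply: (bm_comp _ bf); exact: measurable_swap.
  + exact: bm_channel.
  + move=> y; have bfy : bm (fun z => f (z, y)) by exact: bm_pair2.
    apply: (le_trans (bint_sqr _ bfy)); rewrite -bintZ//; apply: le_bint => //.
      exact: bmX.
    by apply: bmM => //; exact: bm_cst.
- move=> F B bF FB; apply: (le_trans (bint_sqr gauss bF)).
  apply: gauss_le_weight => //; first exact: bmX.
  + by rewrite -(pmulr_rge0 _ (w0 0)) (le_trans _ (FB 0))// sqr_ge0.
  + by move=> y; rewrite sqr_ge0/=.
Qed.

(** * The potential for private channels *)

(** Here [t2] is tau^2, [m] the mean, [J] its change, [s] the variance of the conditional means and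
    [v] the mean conditional variance. Young's inequality splits (m + J)^2 with weight th = 4 t2 L.
    The terms in [v] then use (1 + th)/4 + 2 t2 of the available 1 + th, which is why t2 <= 1/8
    suffices. *)
Lemma private_scalar (R : realFieldType) (b2 t2 L m J s v V : R) :
  0 < b2 -> 0 < t2 -> b2 <= 8^-1 -> t2 <= 8^-1 -> L = 20 * b2 * t2 ->
  0 <= s -> 0 <= v -> J ^+ 2 <= t2 * v -> V <= L * s + 2 * t2 * v ->
  (m + J) ^+ 2 + L^-1 * V <=
    (1 + 80 * b2 * t2 ^+ 2) * (m ^+ 2 + s + L^-1 * v).
Proof.
move=> b0 t0 b8 t8 LE s0 v0 Jv Vs.
have L0 : 0 < L by rewrite LE !mulr_gt0.
set th := 80 * b2 * t2 ^+ 2.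
have th0 : 0 < th by rewrite /th !mulr_gt0// exprn_gt0.
have LV : L^-1 * V <= s + L^-1 * (2 * t2 * v).
  rewrite -(ler_pM2l L0) mulrDr !mulrA divff ?gt_eqF// !mul1r.
  exact: Vs.
have mJ : (m + J) ^+ 2 <= (1 + th) * m ^+ 2 + (1 + th^-1) * (t2 * v).
  apply: (@le_trans _ _ ((1 + th) * m ^+ 2 + (1 + th^-1) * J ^+ 2)).
    rewrite -subr_ge0 (_ : _ - _ = th^-1 * (th * m - J) ^+ 2).
      by rewrite mulr_ge0 ?sqr_ge0// invr_ge0 ltW.
    by field; rewrite gt_eqF.
  by rewrite lerD2l ler_wpM2l// addr_ge0// invr_ge0 ltW.
have key : (1 + th^-1) * (t2 * v) + L^-1 * (2 * t2 * v) <= (1 + th) * (L^-1 * v).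
  rewrite -subr_ge0 (_ : _ - _ = L^-1 * v * (1 + th - (t2 * L) * (1 + th^-1) - 2 * t2)).
    apply: mulr_ge0; first by rewrite mulr_ge0// invr_ge0 ltW.
    have -> : t2 * L = th / 4 by rewrite LE /th; field.
    rewrite (_ : th / 4 * (1 + th^-1) = (th + 1) / 4); first by lra.
    by field; rewrite gt_eqF.
  by field; rewrite !gt_eqF.
have : 0 <= th * s by rewrite mulr_ge0// ltW.
move: key mJ LV; rewrite !mulrDl !mulrDr !mul1r; lra.
Qed.

Section PrivatePotential.
Context {R : realType}.
Implicit Types F : R -> R.

Definition private_norm (L : R) F (B : R) : Prop :=
  (\int[gauss]_y F y) ^+ 2 +
    L^-1 * \int[gauss]_y (F y - \int[gauss]_x F x) ^+ 2 <= B.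

(** Jensen's inequality twice: for the squared mean and, at each [y], for the squared deviation from
    the mean. *)
Lemma private_norm_mix L d (T : measurableType d) (rho : probability T R)
    (f : T * R -> R) (B : T -> R) : 0 < L -> bm f -> bm B ->
  (forall z, private_norm L (fun y => f (z, y)) (B z)) ->
  private_norm L (fun y => \int[rho]_z f (z, y)) (\int[rho]_z B z).
Proof.
move=> L0 bf bB fB.
have bf' : bm (T := (T * measurableTypeR R)%type) f by exact: bf.
pose m z := \int[gauss]_y f (z, y).
have bm_m : bm m by exact: (bm_integral2 gauss bf').
pose g (p : T * measurableTypeR R) := (f p - m p.1) ^+ 2.
have bg0 : bm (fun p : T * measurableTypeR R => f p - m p.1).
  by apply: bmB => //; exact: (bm_comp measurable_fst bm_m).
have bg : bm g by exact: bmX.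
have bV : bm (fun z => \int[gauss]_y g (z, y)) by exact: (bm_integral2 gauss bg).
rewrite /private_norm.
rewrite -(bint_Fubini rho gauss bf').
have bm2 : bm (fun z => m z ^+ 2) by exact: bmX.
have bLV : bm (fun z => L^-1 * \int[gauss]_y g (z, y)).
  by apply: bmM => //; exact: bm_cst.
apply: (@le_trans _ _ (\int[rho]_z (m z ^+ 2 + L^-1 * \int[gauss]_y g (z, y)))).
  rewrite bintD// bintZ//.
  apply: lerD; first exact: bint_sqr.
  rewrite ler_pM2l ?invr_gt0// (bint_Fubini rho gauss bg).
  apply: le_bint.
  - apply: bmX; apply: bmB; last exact: bm_cst.
    by apply: (bm_integral2 (f := fun p : measurableTypeR R * T => f (p.2, p.1)));
      apply: (bm_comp _ bf); exact: measurable_swap.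
  - apply: (bm_integral2 (f := fun p : measurableTypeR R * T => g (p.2, p.1))).
    by apply: (bm_comp _ bg); exact: measurable_swap.
  - move=> y; rewrite -bintB//; last exact: (bm_pair2 y bf').
    by apply: bint_sqr; exact: (bm_pair2 y bg0).
by apply: le_bint => //; exact: bmD.
Qed.

Variables (alpha a b : R).
Hypotheses (a0 : 0 < a) (ab1 : a ^+ 2 + b ^+ 2 = 1) (b0 : b != 0)
  (b8 : b ^+ 2 <= 8^-1) (alpha0 : 0 < alpha)
  (alpha8 : (expR alpha - 1) ^+ 2 <= 8^-1).

Let tau : R := expR alpha - 1.

Let b81 : 0 <= 1 - 8 * b ^+ 2.
Proof. by move: (b8); lra. Qed.

Let tau0 : 0 < tau.
Proof. by rewrite subr_gt0 -expR0 ltr_expR. Qed.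

(* With the mean over the new noise in place of f, the conditional expectation
   is a Gaussian noise operator applied to a function of oscillation tau, whence
   the factor b^2. *)
Lemma private_mean_part (K : channel alpha) (Fb : out K -> R) : bm Fb ->
  let m := mix_law K Fb in
  let I e := \int[gauss]_y (\int[@channel_law _ _ K (a * y + b * e)]_z Fb z - m) in
  [/\ bm I, \int[gauss]_e I e = 0 &
   \int[gauss]_e I e ^+ 2 <=
     10 * b ^+ 2 * (tau ^+ 2 * (mix_law K (fun z => Fb z ^+ 2) - m ^+ 2))].
Proof.
move=> bFb m.
pose G x := \int[@channel_law _ _ K x]_z Fb z - m; move=> I.
have bG : bm G by apply: bmB; [exact: bm_channel|exact: bm_cst].
have bI : bm I.
  apply: (bm_integral2 (f := fun p : R * measurableTypeR R => G (a * p.2 + b * p.1)) gauss).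
  by apply: (bm_comp (measurable_mix a b) bG).
have G0 : \int[gauss]_x G x = 0.
  by rewrite /G bintB ?bint_cst ?subrr//; [exact: bm_channel|exact: bm_cst].
split => //; first by rewrite (gauss_rotation a0 ab1 bG).
pose h z := Fb z - m.
have bh : bm h by apply: bmB => //; exact: bm_cst.
have hm : mix_law K h = 0.
  by rewrite /h mix_lawB ?mix_law_cst ?subrr//; exact: bm_cst.
have h2 : mix_law K (fun z => h z ^+ 2) = mix_law K (fun z => Fb z ^+ 2) - m ^+ 2.
  rewrite (_ : (fun z => _) = (fun z => Fb z ^+ 2 - ((2 * m) * Fb z - m ^+ 2))).
    have b1 : bm (fun z => 2 * m * Fb z) by apply: bmM => //; exact: bm_cst.
    have bc : bm (T := out K) (fun=> m ^+ 2) by exact: bm_cst.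
    rewrite mix_lawB; [|exact: bmX|exact: bmB].
    by rewrite mix_lawB// mix_lawZ// mix_law_cst -/m; ring.
  by apply/funext => z; rewrite /h; ring.
pose M := tau * mix_law K (fun z => `|h z|).
have GM x : `|G x| <= M.
  have := channel_mix_law x (ltW alpha0) bh.
  rewrite hm subr0 /h bintB ?bint_cst//; exact: bm_cst.
have M2 : M ^+ 2 <= tau ^+ 2 * (mix_law K (fun z => Fb z ^+ 2) - m ^+ 2).
  rewrite exprMn ler_pM2l ?exprn_gt0// -h2.
  apply: (le_trans (mix_law_sqr (bm_abs bh))).
  apply: le_mix_law; [by apply: bmX; exact: bm_abs|exact: bmX|].
  by move=> z; rewrite real_normK ?num_real.
apply: (@le_trans _ _ (10 * b ^+ 2 * M ^+ 2)); last first.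
  by rewrite ler_wpM2l// mulr_ge0// sqr_ge0.
have IM e : I e ^+ 2 <= ((1 + 4 * b ^+ 2) * weight b e - 1) * M ^+ 2.
  exact: (gauss_centered_sqr a0 ab1 b8 e bG GM G0).
have M0 : 0 <= M ^+ 2 by exact: sqr_ge0.
have b20 : 0 <= b ^+ 2 by exact: sqr_ge0.
have bI2 : bm (fun e => I e ^+ 2) by exact: bmX.
(* Adding M^2 cancels the [- 1] in [IM], so the weight can be integrated. This leaves (8b^2 + 16b^4)
   M^2, and 16b^4 <= 2b^2 gives the constant 10. *)
have : \int[gauss]_e (I e ^+ 2 + M ^+ 2) <=
    (1 + 4 * b ^+ 2) * ((1 + 4 * b ^+ 2) * M ^+ 2).
  apply: gauss_le_weight => //.
  - by apply: bmD => //; exact: bm_cst.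
  - by rewrite mulr_ge0// addr_ge0// mulr_ge0.
  - move=> e; rewrite addr_ge0 ?sqr_ge0//=.
    by have := IM e; rewrite mulrBl mul1r lerBrDr (mulrC (1 + _)) -mulrA.
rewrite bintD// ?bint_cst; last exact: bm_cst.
rewrite -lerBrDr => /le_trans; apply.
rewrite -subr_ge0 (_ : _ - _ = 2 * b ^+ 2 * M ^+ 2 * (1 - 8 * b ^+ 2)); last by ring.
apply: mulr_ge0; last exact: b81.
by apply: mulr_ge0 => //; apply: mulr_ge0.
Qed.

Lemma bm_noisy_channel (K : channel alpha) (f : out K * R -> R) : bm f ->
  bm (fun p : R * measurableTypeR R =>
    \int[@channel_law _ _ K (a * p.2 + b * p.1)]_z f (z, p.2)).
Proof.
move=> bf; apply: (bm_integral_channel (f := fun q => f (q.2, q.1.2))).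
  exact: measurable_mix.
apply: (bm_comp _ bf); apply: measurable_fun_pair => //=.
exact: (measurableT_comp measurable_snd).
Qed.

(** For each [y] the channel is compared with its average [mix_law], whose contribution vanishes
    because [f] is centered in [y]. No factor [b] arises: [f] depends on the same [y] as the input,
    so only privacy damps this part. *)
Lemma private_fluctuation_part (K : channel alpha) (f : out K * R -> R) : bm f ->
  (forall z, \int[gauss]_y f (z, y) = 0) ->
  let J e := \int[gauss]_y \int[@channel_law _ _ K (a * y + b * e)]_z f (z, y) in
  bm J /\
  forall e, J e ^+ 2 <=
    tau ^+ 2 * mix_law K (fun z => \int[gauss]_y f (z, y) ^+ 2).
Proof.
move=> bf f0 J.
have bf' : bm (T := (out K * measurableTypeR R)%type) f by exact: bf.
have bfy y : bm (fun z => f (z, y)) by exact: bm_pair2.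
have bH := bm_noisy_channel bf.
split; first exact: (bm_integral2 gauss bH).
move=> e.
have bN : bm (fun y => mix_law K (fun z => f (z, y))) by exact: bm_mix_law.
have bNa : bm (fun y => mix_law K (fun z => `|f (z, y)|)).
  by apply: (bm_mix_law (f := fun p => `|f p|)); exact: bm_abs.
have bHe : bm (fun y : measurableTypeR R =>
  \int[@channel_law _ _ K (a * y + b * e)]_z f (z, y)).
  exact: (bm_pair1 e bH).
have N0 : \int[gauss]_y mix_law K (fun z => f (z, y)) = 0.
  rewrite (mix_law_Fubini gauss bf') (_ : (fun z => _) = (fun=> 0)) ?mix_law_cst//.
  by apply/funext => z; exact: f0.
have JE : `|J e| <= tau * \int[gauss]_y mix_law K (fun z => `|f (z, y)|).
  rewrite -(bintZ gauss tau bNa) -[J e]subr0 -N0 -(bintB gauss bHe bN).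
  have bd : bm (fun y : measurableTypeR R =>
    \int[@channel_law _ _ K (a * y + b * e)]_z f (z, y) - mix_law K (fun z => f (z, y))).
    exact: (bmB bHe bN).
  apply: (le_trans (bint_abs gauss bd)); apply: le_bint.
  - exact: bm_abs.
  - by apply: bmM => //; exact: bm_cst.
  - by move=> y; apply: channel_mix_law => //; exact: ltW.
rewrite -real_normK ?num_real//.
apply: (@le_trans _ _ ((tau * \int[gauss]_y mix_law K (fun z => `|f (z, y)|)) ^+ 2)).
  by rewrite ler_pXn2r// nnegrE (le_trans _ JE).
rewrite exprMn ler_pM2l ?exprn_gt0//.
apply: (le_trans (bint_sqr gauss bNa)).
have bf2 : bm (T := (out K * measurableTypeR R)%type) (fun p => f p ^+ 2) by exact: bmX.
rewrite -(mix_law_Fubini gauss bf2); apply: le_bint; first exact: bmX.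
  by apply: (bm_mix_law (f := fun p => f p ^+ 2)); exact: bmX.
move=> y; apply: (le_trans (mix_law_sqr (bm_abs (bfy y)))).
apply: le_mix_law; [by apply: bmX; exact: bm_abs|exact: bmX|].
by move=> z; rewrite real_normK ?num_real.
Qed.

Let L : R := 20 * b ^+ 2 * tau ^+ 2.

(** Splitting [f] into its mean [Fb] over [y] and the centered rest [g] gives the function m + I +
    J, with [I] coming from [Fb] and [J] from [g]. Since (I + J)^2 <= 2I^2 + 2J^2, the 20 in [L] is
    twice the 10 of [private_mean_part], and 80 = 4 * 20 by [private_scalar]. *)
Lemma private_norm_step (K : channel alpha) (f : out K * R -> R) (B : out K -> R) :
  bm f -> bm B -> (forall z, private_norm L (fun y => f (z, y)) (B z)) ->
  private_norm L
    (fun e => \int[gauss]_y \int[@channel_law _ _ K (a * y + b * e)]_z f (z, y))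
    ((1 + 80 * b ^+ 2 * (tau ^+ 2) ^+ 2) * mix_law K B).
Proof.
move=> bf bB fB.
have b20 : 0 < b ^+ 2 by rewrite exprn_even_gt0.
have t20 : 0 < tau ^+ 2 by rewrite exprn_gt0.
have L0 : 0 < L by apply: mulr_gt0 => //; exact: mulr_gt0.
have bf' : bm (T := (out K * measurableTypeR R)%type) f by exact: bf.
pose Fb z := \int[gauss]_y f (z, y).
have bFb : bm Fb by exact: (bm_integral2 gauss bf').
pose g (p : out K * R) := f p - Fb p.1.
have bg : bm g by apply: bmB => //; exact: (bm_comp measurable_fst bFb).
have g0 z : \int[gauss]_y g (z, y) = 0.
  have bc : bm (T := measurableTypeR R) (fun=> Fb z) by exact: bm_cst.
  by rewrite /g (bintB gauss (bm_pair1 z bf') bc) (bint_cst gauss) subrr.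
have [bI I0 I2] := private_mean_part bFb.
have [bJ J2] := private_fluctuation_part bg g0.
set m := mix_law K Fb in bI I0 I2 *.
set I := fun e => _ in bI I0 I2.
set J := fun e => _ in bJ J2.
pose V z := \int[gauss]_y g (z, y) ^+ 2.
have bV : bm V.
  by apply: (bm_integral2 (f := fun p : out K * measurableTypeR R => g p ^+ 2) gauss);
    exact: bmX.
have FE e : \int[gauss]_y \int[@channel_law _ _ K (a * y + b * e)]_z f (z, y) =
    m + (I e + J e).
  have bK : bm (fun y : measurableTypeR R =>
      \int[@channel_law _ _ K (a * y + b * e)]_z Fb z).
    exact: (bm_comp (measurable_affine a (b * e)) (bm_channel bFb)).
  have bm_m : bm (T := measurableTypeR R) (fun=> m) by exact: bm_cst.
  have bKg : bm (fun y : measurableTypeR R =>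
      \int[@channel_law _ _ K (a * y + b * e)]_z g (z, y)).
    exact: (bm_pair1 e (bm_noisy_channel bg)).
  rewrite /I /J (bintB gauss bK bm_m) (bint_cst gauss) addrA (addrC m) subrK.
  rewrite -(bintD gauss bK bKg).
  apply: eq_Rintegral => y _; rewrite -bintD//; last exact: bm_pair2.
  by apply: eq_Rintegral => z _; rewrite /g /= subrKC.
have -> : (fun e => \int[gauss]_y \int[@channel_law _ _ K (a * y + b * e)]_z f (z, y)) =
  (fun e => m + (I e + J e)) by exact/funext.
have {}I0 : \int[gauss]_e I e = 0 by exact: I0.
have {}J2 e : J e ^+ 2 <= tau ^+ 2 * mix_law K V by exact: J2.
have {}I2 : \int[gauss]_e I e ^+ 2 <=
  10 * b ^+ 2 * (tau ^+ 2 * (mix_law K (fun z => Fb z ^+ 2) - m ^+ 2)) by exact: I2.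
clear FE; clearbody I J; rewrite /private_norm.
have bH : bm (fun e => I e + J e) by exact: bmD.
have bm_m : bm (T := measurableTypeR R) (fun=> m) by exact: bm_cst.
have bFb2 : bm (fun z => Fb z ^+ 2) by exact: bmX.
have meanE : \int[gauss]_e (m + (I e + J e)) = m + \int[gauss]_e J e.
  by rewrite (bintD gauss bm_m bH) (bint_cst gauss) (bintD gauss bI bJ) I0 add0r.
rewrite meanE.
have JE2 : (\int[gauss]_e J e) ^+ 2 <= tau ^+ 2 * mix_law K V.
  apply: (le_trans (bint_sqr gauss bJ)); rewrite -[leRHS](bint_cst gauss).
  by apply: le_bint; [exact: (bmX 2 bJ)|exact: bm_cst|].
apply: (@le_trans _ _ ((1 + 80 * b ^+ 2 * (tau ^+ 2) ^+ 2) *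
    (m ^+ 2 + (mix_law K (fun z => Fb z ^+ 2) - m ^+ 2) + L^-1 * mix_law K V))).
  apply: private_scalar => //.
  - by rewrite subr_ge0 mix_law_sqr.
  - by apply: mix_law_ge0 => z; apply: Rintegral_ge0 => y _; exact: sqr_ge0.
  have -> : \int[gauss]_e (m + (I e + J e) - (m + \int[gauss]_x J x)) ^+ 2 =
      \int[gauss]_e ((I e + J e) - \int[gauss]_e (I e + J e)) ^+ 2.
    apply: eq_Rintegral => e _; rewrite bintD// I0 add0r; congr (_ ^+ 2).
    by rewrite opprD addrACA subrr add0r.
  rewrite bint_variance//.
  apply: (@le_trans _ _ (\int[gauss]_e (2 * I e ^+ 2 + 2 * J e ^+ 2))).
    rewrite lerBlDr; apply: ler_wpDr; first exact: sqr_ge0.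
    apply: le_bint; first exact: bmX.
      by apply: bmD; apply: bmM; [exact: bm_cst|exact: bmX|exact: bm_cst|exact: bmX].
    move=> e; rewrite -subr_ge0 (_ : _ - _ = (I e - J e) ^+ 2) ?sqr_ge0//; ring.
  rewrite bintD ?bintZ; last 4 first.
  - exact: bmX.
  - exact: bmX.
  - by apply: bmM; [exact: bm_cst|exact: bmX].
  - by apply: bmM; [exact: bm_cst|exact: bmX].
  apply: lerD.
    rewrite (_ : L * _ = 2 * (10 * b ^+ 2 *
      (tau ^+ 2 * (mix_law K (fun z => Fb z ^+ 2) - m ^+ 2)))); last by rewrite /L; ring.
    by rewrite ler_pM2l.
  rewrite -mulrA ler_pM2l// -[leRHS](bint_cst gauss).
  by apply: le_bint; [exact: bmX|exact: bm_cst|].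
have D0 : 0 < 1 + 80 * b ^+ 2 * (tau ^+ 2) ^+ 2.
  by rewrite ltr_wpDr// mulr_ge0 ?sqr_ge0// mulr_ge0// ltW.
rewrite ler_pM2l// (addrC (m ^+ 2)) subrK.
rewrite -mix_lawZ// -mix_lawD//; last by apply: bmM => //; exact: bm_cst.
apply: le_mix_law => //.
  by apply: bmD => //; apply: bmM => //; exact: bm_cst.
Qed.

Lemma potential_private : potential (alpha := alpha) a b
  (1 + 80 * b ^+ 2 * (tau ^+ 2) ^+ 2) 1 (private_norm L).
Proof.
have L0 : 0 < L.
  by apply: mulr_gt0; [apply: mulr_gt0 => //; rewrite exprn_even_gt0|exact: exprn_gt0].
split.
- move=> x; rewrite /private_norm bint_cst.
  under eq_Rintegral do rewrite subrr expr0n.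
  by rewrite bint_cst mulr0 addr0.
- by move=> F B B' BB' FB; exact: le_trans FB BB'.
- by move=> *; exact: private_norm_mix.
- by move=> *; exact: private_norm_step.
- move=> F B bF FB; rewrite mul1r; apply: le_trans FB.
  rewrite lerDl mulr_ge0 ?invr_ge0 ?(ltW L0)//.
  by apply: Rintegral_ge0 => y _; exact: sqr_ge0.
Qed.

End PrivatePotential.

(** * Outputs of noisy sequences *)

Section OutputIntegral.
Context {R : realType} {alpha : R}.
Implicit Types (Ks : seq (channel alpha)) (x : nat -> R).

Definition oint Ks x (u : outs Ks -> R) : R := \int[outs_law Ks x]_z u z.

Lemma oint_nil x u : oint (Ks := [::]) x u = u tt.
Proof.
rewrite /oint (_ : u = fun=> u tt); first exact: bint_cst.
by apply/funext; case.
Qed.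

Lemma oint_cons K Ks x (u : outs (K :: Ks) -> R) : bm u ->
  oint x u =
  \int[@channel_law _ _ K (x 0%N)]_z oint (fun i => x i.+1) (fun z' => u (z, z')).
Proof. by move=> bu; exact: bint_prod. Qed.

Lemma bm_oint Ks d (T : measurableType d) (x : T -> nat -> R)
    (u : T * outs Ks -> R) :
  (forall i, measurable_fun setT (x ^~ i)) -> bm u ->
  bm (fun w => oint (x w) (fun z => u (w, z))).
Proof.
elim: Ks d T x u => [|K Ks IH] d T x u mx bu.
  under eq_fun do rewrite oint_nil.
  exact: (bm_pair2 (tt : outs [::]) bu).
under eq_fun => w do rewrite (oint_cons _ (bm_pair1 w bu)).
apply: (bm_integral_channel (g := fun w => x w 0%N)
  (f := fun p => oint (fun i => x p.1 i.+1) (fun z' => u (p.1, (p.2, z'))))) => //.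
apply: (IH _ _ (fun (p : T * out K) i => x p.1 i.+1)
  (fun q => u (q.1.1, (q.1.2, q.2)))).
- by move=> i; exact: (measurableT_comp (mx i.+1) measurable_fst).
- apply: (bm_comp _ bu); apply: measurable_fun_pair => /=.
    exact: (measurableT_comp measurable_fst).
  apply: measurable_fun_pair => //.
  exact: (measurableT_comp measurable_snd).
Qed.

End OutputIntegral.

Section NoiseSource.
Context {R : realType} d {Omega : measurableType d} (P : probability Omega R).
Variables (xi : nat -> Omega -> R) (shift : Omega -> Omega).

(* (xi_0, shift) has law N(0, 1) x P, and xi_{n+1} = xi_n o shift *)
Definition noise_source : Prop :=
  [/\ forall n, measurable_fun setT (xi n),
      forall n w, xi n.+1 w = xi n (shift w)
    & forall f : R * Omega -> R, bm f ->
        \int[P]_w f (xi 0 w, shift w) = \int[gauss]_y \int[P]_w f (y, w)].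

Hypothesis src : noise_source.

Definition upd (e : nat -> R) k y : nat -> R := fun j => if j == k then y else e j.

(* Noise sequence whose first m values are prescribed *)
Definition fill (e : nat -> R) m w : nat -> R :=
  fun k => if (k < m)%N then e k else xi (k - m) w.

(** The first noise variable becomes the prescribed value number [m] and the rest is the shifted
    sequence. This is the form in which the defining identity of a noise source can be applied. *)
Lemma fill_draw e m w : fill e m w = fill (upd e m (xi 0 w)) m.+1 (shift w).
Proof.
apply/funext => k; rewrite /fill /upd [(k < m.+1)%N]ltnS [(k <= m)%N]leq_eqVlt.
have [->|km] := eqVneq k m; first by rewrite ltnn subnn.
case: ltnP => //= mk; case: src => _ <- _.
by rewrite subnSK// ltn_neqAle eq_sym km.
Qed.

Lemma updC e k j x y : k != j -> upd (upd e k x) j y = upd (upd e j y) k x.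
Proof.
move=> kj; apply/funext => i; rewrite /upd.
by case: (eqVneq i j) => // ->; rewrite eq_sym (negbTE kj).
Qed.

Lemma measurable_fill d' (T : measurableType d') (e : T -> nat -> R) m k :
  (forall k, measurable_fun setT (e ^~ k)) ->
  measurable_fun setT (fun p : T * Omega => fill (e p.1) m p.2 k).
Proof.
move=> me; rewrite /fill; case: (ltnP k m) => _.
  exact: (measurableT_comp (me k) measurable_fst).
by case: src => mxi _ _; exact: (measurableT_comp (mxi _) measurable_snd).
Qed.

Lemma measurable_upd d' (T : measurableType d') (e : T -> nat -> R) k (g : T -> R) j :
  (forall k, measurable_fun setT (e ^~ k)) -> measurable_fun setT g ->
  measurable_fun setT (fun w => upd (e w) k (g w) j).
Proof. by move=> me mg; rewrite /upd; case: (j == k). Qed.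

Context {alpha : R}.
Implicit Types (Ks : seq (channel alpha)).
Variables (h : nat) (A B : nat -> R).

(** The input at time [t + i]: noise number [j] enters as new at time j - h and again, lagged, at
    time [j]. With this offset all indices are natural numbers. *)
Definition input t (n : nat -> R) i := A (t + i)%N * n (t + i + h)%N + B (t + i)%N * n (t + i)%N.

(* Expectation of u(Z) given the first m noise variables, when the remaining
   channels are Ks and the next time is t *)
Definition cond_exp Ks t (e : nat -> R) m (u : outs Ks -> R) : R :=
  \int[P]_w oint (input t (fill e m w)) u.

Lemma measurable_input d' (T : measurableType d') t (n : T -> nat -> R) i :
  (forall k, measurable_fun setT (n ^~ k)) ->
  measurable_fun setT (fun w => input t (n w) i).
Proof. by move=> mn; apply: measurable_funD; apply: measurable_funM. Qed.

Lemma bm_cond_exp_int Ks d' (T : measurableType d') t (e : T -> nat -> R) m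
    (u : T * outs Ks -> R) :
  (forall k, measurable_fun setT (e ^~ k)) -> bm u ->
  bm (fun p : T * Omega => oint (input t (fill (e p.1) m p.2)) (fun z => u (p.1, z))).
Proof.
move=> me bu; apply: (bm_oint (x := fun p => input t (fill (e p.1) m p.2))
  (u := fun q => u (q.1.1, q.2))).
  by move=> i; apply: measurable_input => k; exact: measurable_fill.
apply: (bm_comp _ bu); apply: measurable_fun_pair => //=.
exact: (measurableT_comp measurable_fst).
Qed.

Lemma bm_cond_exp Ks d' (T : measurableType d') t (e : T -> nat -> R) m
    (u : T * outs Ks -> R) :
  (forall k, measurable_fun setT (e ^~ k)) -> bm u ->
  bm (fun w => cond_exp t (e w) m (fun z => u (w, z))).
Proof. by move=> me bu; exact: (bm_integral2 P (bm_cond_exp_int t m me bu)). Qed.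

Lemma bm_cond_exp_int0 Ks t e m (u : outs Ks -> R) : bm u ->
  bm (fun w => oint (input t (fill e m w)) u).
Proof.
move=> bu.
apply: (bm_oint (x := fun w => input t (fill e m w)) (u := fun q => u q.2)).
  move=> i; apply: measurable_input => k; rewrite /fill; case: (ltnP k m) => _ //.
  by case: src.
exact: (bm_comp measurable_snd bu).
Qed.

Lemma cond_exp_nil t e m u : cond_exp (Ks := [::]) t e m u = u tt.
Proof. by rewrite /cond_exp; under eq_Rintegral do rewrite oint_nil; exact: bint_cst. Qed.

Lemma cond_exp_draw Ks t e m (u : outs Ks -> R) : bm u ->
  cond_exp t e m u = \int[gauss]_y cond_exp t (upd e m y) m.+1 u.
Proof.
move=> bu; rewrite /cond_exp.
pose f (p : R * Omega) := oint (input t (fill (upd e m p.1) m.+1 p.2)) u.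
transitivity (\int[P]_w f (xi 0 w, shift w)).
  by apply: eq_Rintegral => w _; rewrite fill_draw.
case: (src) => _ _ -> //.
apply: (bm_cond_exp_int (e := fun y => upd e m y) t m.+1 (u := fun q => u q.2)).
  by move=> k; apply: (@measurable_upd _ R (fun=> e)).
exact: (bm_comp measurable_snd bu).
Qed.

Lemma cond_exp_emit K Ks t e m (u : outs (K :: Ks) -> R) : bm u -> (t + h < m)%N ->
  cond_exp t e m u =
  \int[@channel_law _ _ K (A t * e (t + h)%N + B t * e t)]_z
    cond_exp t.+1 e m (fun z' => u (z, z')).
Proof.
move=> bu tm; rewrite /cond_exp.
have tm' : (t < m)%N by apply: leq_ltn_trans tm; exact: leq_addr.
transitivity (\int[P]_w \int[@channel_law _ _ K (A t * e (t + h)%N + B t * e t)]_z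
    oint (input t.+1 (fill e m w)) (fun z' => u (z, z'))).
  apply: eq_Rintegral => w _; rewrite (oint_cons _ bu).
  rewrite {1}/input /fill !addn0 tm tm'; apply: eq_Rintegral => z _.
  by congr oint; apply/funext => i; rewrite /input addnS.
apply: (bint_Fubini P _ (f := fun p => oint (input t.+1 (fill e m p.1))
  (fun z' => u (p.2, z')))).
apply: (bm_oint (x := fun p : Omega * out K => input t.+1 (fill e m p.1))
  (u := fun q => u (q.1.2, q.2))).
  move=> i; apply: measurable_input => k; rewrite /fill; case: (ltnP k m) => _ //.
  by case: src => mxi _ _; exact: (measurableT_comp (mxi _) measurable_fst).
apply: (bm_comp _ bu); apply: measurable_fun_pair => //=.
exact: (measurableT_comp measurable_snd).
Qed.

(** One unit of time: once noise [t + h] is drawn, the input at time [t] is known, so channel [t]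
    can emit, whatever the later noise. *)
Lemma cond_exp_step K Ks t e (u : outs (K :: Ks) -> R) : bm u -> (0 < h)%N ->
  cond_exp t e (t + h) u =
  \int[gauss]_y \int[@channel_law _ _ K (A t * y + B t * e t)]_z
    cond_exp t.+1 (upd e (t + h) y) (t.+1 + h) (fun z' => u (z, z')).
Proof.
move=> bu h0; rewrite cond_exp_draw//; apply: eq_Rintegral => y _.
by rewrite cond_exp_emit// /upd eqxx -[X in X == _]addn0 eqn_add2l eq_sym gtn_eqF.
Qed.

Lemma eq_cond_exp Ks t e e' m (u : outs Ks -> R) :
  (forall w i, input t (fill e m w) i = input t (fill e' m w) i) ->
  cond_exp t e m u = cond_exp t e' m u.
Proof.
move=> ee'; apply: eq_Rintegral => w _; congr oint; apply/funext => i; exact: ee'.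
Qed.

Lemma cond_exp_past Ks t e k y m (u : outs Ks -> R) : (k < t)%N ->
  cond_exp t (upd e k y) m u = cond_exp t e m u.
Proof.
move=> kt; apply: eq_cond_exp => w i; rewrite /input /fill /upd.
have n1 : (t + i == k)%N = false by rewrite gtn_eqF// (leq_trans kt)// leq_addr.
have n2 : (t + i + h == k)%N = false.
  by rewrite gtn_eqF// (leq_trans kt)// -addnA leq_addr.
by rewrite n1 n2.
Qed.

(** From time [t] on, noise [k] below [t + h] can only enter as the lagged term at time [k], where
    its coefficient vanishes. *)
Lemma cond_exp_unused Ks t e k y m (u : outs Ks -> R) : (k < t + h)%N -> B k = 0 ->
  cond_exp t (upd e k y) m u = cond_exp t e m u.
Proof.
move=> kt Bk; apply: eq_cond_exp => w i; rewrite /input /fill /upd.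
have n2 : (t + i + h == k)%N = false.
  by rewrite gtn_eqF// (leq_trans kt)// -addnA leq_add2l leq_addl.
rewrite n2.
by have [->|//] := eqVneq (t + i)%N k; rewrite Bk !mul0r.
Qed.

Lemma cond_expD Ks t e m (u v : outs Ks -> R) : bm u -> bm v ->
  cond_exp t e m (fun z => u z + v z) = cond_exp t e m u + cond_exp t e m v.
Proof.
move=> bu bv; rewrite /cond_exp -bintD; [|exact: bm_cond_exp_int0..].
by apply: eq_Rintegral => w _; rewrite /oint bintD.
Qed.

Lemma cond_expZ Ks t e m (u : outs Ks -> R) c : bm u ->
  cond_exp t e m (fun z => c * u z) = c * cond_exp t e m u.
Proof.
move=> bu; rewrite /cond_exp -bintZ; [|exact: bm_cond_exp_int0].
by apply: eq_Rintegral => w _; rewrite /oint bintZ.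
Qed.

Lemma cond_exp_cst Ks t e m c : cond_exp t e m (fun _ : outs Ks => c) = c.
Proof.
rewrite /cond_exp; under eq_Rintegral do rewrite /oint bint_cst.
exact: bint_cst.
Qed.

Lemma cond_exp_ge0 Ks t e m (u : outs Ks -> R) :
  (forall z, 0 <= u z) -> 0 <= cond_exp t e m u.
Proof. by move=> u0; apply: Rintegral_ge0 => w _; apply: Rintegral_ge0. Qed.

Lemma le_cond_exp Ks t e m (u v : outs Ks -> R) : bm u -> bm v ->
  (forall z, u z <= v z) -> cond_exp t e m u <= cond_exp t e m v.
Proof.
move=> bu bv uv; apply: le_bint; [exact: bm_cond_exp_int0..|].
by move=> w; exact: le_bint.
Qed.

End NoiseSource.

(** * Comparison of hybrid processes *)

Section Hybrid.
Context {R : realType} d {Omega : measurableType d} (P : probability Omega R).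
Variables (xi : nat -> Omega -> R) (shift : Omega -> Omega).
Hypothesis src : noise_source P xi shift.
Context {alpha : R}.
Implicit Types (Ks : seq (channel alpha)).
Variables (h : nat) (h0 : (0 < h)%N) (a b : R).

(* Coefficients of the hybrid process in which only the residue classes below r
   modulo h are correlated *)
Definition coef1 r t : R := if (t %% h < r)%N then a else 1.
Definition coef2 r t : R := if (t %% h < r)%N then b else 0.

Definition hyb r Ks t e m (u : outs Ks -> R) : R :=
  cond_exp P xi h (coef1 r) (coef2 r) t e m u.

Variables (D c : R) (Phi : (R -> R) -> R -> Prop).
Hypothesis pot : potential (alpha := alpha) a b D c Phi.
Hypothesis (D1 : 1 <= D).
Variables (r : nat) (rh : (r < h)%N).

Let coef_other t : (t %% h)%N != r ->
  (coef1 r.+1 t = coef1 r t) * (coef2 r.+1 t = coef2 r t).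
Proof. by move=> tr; rewrite /coef1 /coef2 ltnS leq_eqVlt (negbTE tr). Qed.

Let coef_active t : (t %% h)%N = r ->
  [/\ coef1 r.+1 t = a, coef2 r.+1 t = b, coef1 r t = 1 & coef2 r t = 0].
Proof. by move=> tr; rewrite /coef1 /coef2 tr ltnS leqnn ltnn. Qed.

Lemma bm_hyb r' Ks d' (T : measurableType d') t (e : T -> nat -> R) m
    (u : T * outs Ks -> R) :
  (forall k, measurable_fun setT (e ^~ k)) -> bm u ->
  bm (fun w => hyb r' t (e w) m (fun z => u (w, z))).
Proof. exact: (bm_cond_exp src). Qed.

Lemma hyb_unused Ks t e k y m (u : outs Ks -> R) : (k < t + h)%N -> (k %% h)%N = r ->
  hyb r t (upd e k y) m u = hyb r t e m u.
Proof.
move=> kt kr; apply: cond_exp_unused => //.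
by rewrite /coef2 kr ltnn.
Qed.

Let Phi_eq F F' B B' : Phi F B -> F' =1 F -> B' = B -> Phi F' B'.
Proof. by move=> FB /funext -> ->. Qed.

(** The window from [t] to [t + h - 1] holds exactly one index of residue [r], namely [k]; noise [k]
    is the memory by which the hybrids differ. In hybrid [r] that class is white, so the right-hand
    side does not depend on noise [k] and can serve as a constant bound. *)
Lemma potential_hybrid Ks t e k (u : outs Ks -> R) : bm u ->
  (t <= k < t + h)%N -> (k %% h)%N = r ->
  Phi (fun y => hyb r.+1 t (upd e k y) (t + h) u)
    (D ^+ size Ks * hyb r t e (t + h) (fun z => u z ^+ 2)).
Proof.
have [Phi_cst Phi_le Phi_mix Phi_step _] := pot.
elim: Ks t e k u => [|K Ks IH] t e k u bu /andP[tk kth] kr.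
  rewrite /hyb cond_exp_nil expr0 mul1r.
  by under eq_fun do rewrite cond_exp_nil; exact: Phi_cst.
have bu2 : bm (fun z => u z ^+ 2) by exact: bmX.
have buz z : bm (fun z' => u (z, z')) by exact: (bm_pair1 z bu).
have DKs : 0 <= D ^+ size Ks by rewrite exprn_ge0// (le_trans _ D1).
rewrite {2}/hyb (cond_exp_step src)//.
under eq_fun do rewrite /hyb (cond_exp_step src)//.
(* If [k = t], the channel reads the memory: its input is a y + b e_t, and the memory passes from
   noise [t] to the new noise [t + h], as in [Phi_step]. *)
have [kt|kt] := eqVneq k t.
- have tr : (t %% h)%N = r by rewrite -kt.
  have [-> -> -> ->] := coef_active tr; rewrite {}kt.
  pose f (p : out K * R) :=
    hyb r.+1 t.+1 (upd e (t + h) p.2) (t.+1 + h) (fun z' => u (p.1, z')).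
  pose B0 z := hyb r t.+1 e (t.+1 + h) (fun z' => u (z, z') ^+ 2).
  have bf : bm f.
    apply: (bm_hyb r.+1 (T := (out K * R)%type) t.+1 (e := fun p => upd e (t + h) p.2)
      (t.+1 + h) (u := fun q => u (q.1.1, q.2))).
      by move=> j; apply: (measurable_upd (e := fun=> e)) => //; exact: measurable_snd.
    apply: (bm_comp _ bu); apply: measurable_fun_pair => //=.
    exact: (measurableT_comp measurable_fst).
  have bB0 : bm B0.
    exact: (bm_hyb r (T := out K) t.+1 (e := fun=> e) (t.+1 + h)
      (u := fun q => u q ^+ 2)).
  have bB : bm (fun z => D ^+ size Ks * B0 z) by apply: bmM => //; exact: bm_cst.
  have fB z : Phi (fun y => f (z, y)) (D ^+ size Ks * B0 z).
    apply: (IH t.+1 e (t + h)%N _ (buz z)); last by rewrite modnDr.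
    by rewrite addSn ltnS leqnn andbT -addn1 leq_add2l.
  have := Phi_step K f _ bf bB fB.
  rewrite mix_lawZ// mulrA -exprS => PhiK.
  apply: (Phi_eq PhiK) => [y|].
    apply: eq_Rintegral => y' _.
    have -> : upd e t y t = y by rewrite /upd eqxx.
    apply: eq_Rintegral => z _.
    rewrite /f /= updC; last by rewrite -[X in X != _]addn0 eqn_add2l eq_sym -lt0n.
    exact: cond_exp_past.
  rewrite [in RHS]/mix_law /=; apply: (f_equal ( *%R _)).
  apply: eq_Rintegral => y _; rewrite mul1r mul0r addr0.
  apply: eq_Rintegral => z _; rewrite /B0.
  apply: hyb_unused; last by rewrite modnDr.
  by rewrite addSn ltnS.
(* Otherwise [t] has another residue: both hybrids use the same coefficients and the output does not
   involve noise [k], so the new noise and the output are averaged by [Phi_mix]. *)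
have tr : (t %% h)%N != r.
  apply: contra kt => /eqP tr; rewrite -(subnKC tk) -[X in _ == X]addn0 eqn_add2l.
  have /eqP : ((k - t) + t = 0 + t %[mod h])%N by rewrite subnK// add0n kr tr.
  have kth' : (k - t < h)%N by rewrite ltn_subLR.
  by rewrite eqn_modDr mod0n modn_small.
have [E1 E2] := coef_other tr; rewrite E1 E2.
pose x y' := coef1 r t * y' + coef2 r t * e t.
pose f (p : R * R * out K) := hyb r.+1 t.+1 (upd (upd e (t + h) p.1.1) k p.1.2)
  (t.+1 + h) (fun z' => u (p.2, z')).
pose B0 (p : R * out K) := hyb r t.+1 (upd e (t + h) p.1) (t.+1 + h)
  (fun z' => u (p.2, z') ^+ 2).
have mx : measurable_fun setT x by exact: measurable_affine.
have bf : bm f.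
  apply: (bm_hyb r.+1 (T := (R * R * out K)%type) t.+1
    (e := fun p => upd (upd e (t + h) p.1.1) k p.1.2) (t.+1 + h)
    (u := fun q => u (q.1.2, q.2))).
    move=> j; apply: (measurable_upd (e := fun p : R * R * out K => upd e (t + h) p.1.1)).
      move=> j'; apply: (measurable_upd (e := fun=> e)) => //.
      exact: (measurableT_comp measurable_fst).
    exact: (measurableT_comp measurable_snd).
  apply: (bm_comp _ bu); apply: measurable_fun_pair => //=.
  exact: (measurableT_comp measurable_snd).
have bB0 : bm B0.
  apply: (bm_hyb r (T := (R * out K)%type) t.+1 (e := fun p => upd e (t + h) p.1)
    (t.+1 + h) (u := fun q => u (q.1.2, q.2) ^+ 2)).
    by move=> j; apply: (measurable_upd (e := fun=> e)) => //; exact: measurable_fst.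
  apply: (bm_comp _ bu2); apply: measurable_fun_pair => //=.
  exact: (measurableT_comp measurable_snd).
have bB : bm (fun p => D ^+ size Ks * B0 p) by apply: bmM => //; exact: bm_cst.
have fB y' z : Phi (fun y => f (y', y, z)) (D ^+ size Ks * B0 (y', z)).
  apply: (IH t.+1 (upd e (t + h) y') k _ (buz z)) => //.
  by rewrite ltn_neqAle eq_sym kt tk/= addSn ltnS ltnW.
pose f1 (p : measurableTypeR R * R) :=
  \int[@channel_law _ _ K (x p.1)]_z f (p, z).
pose B1 (y' : measurableTypeR R) :=
  \int[@channel_law _ _ K (x y')]_z (D ^+ size Ks * B0 (y', z)).
have bf1 : bm f1.
  exact: (bm_integral_channel (T := (R * R)%type) (g := fun p => x p.1) (f := f)
    (measurableT_comp mx measurable_fst) bf).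
have bB1 : bm B1.
  exact: (bm_integral_channel (T := R) (f := fun p => D ^+ size Ks * B0 p)).
have f1B y' : Phi (fun y => f1 (y', y)) (B1 y').
  apply: (Phi_mix _ _ (@channel_law _ _ K (x y')) (fun p => f (y', p.2, p.1))
    (fun z => D ^+ size Ks * B0 (y', z))).
  - apply: (bm_comp _ bf); apply: measurable_fun_pair => //=.
    by apply: measurable_fun_pair => //.
  - exact: (bm_pair1 y' bB).
  - exact: fB.
apply: (Phi_le _ (\int[gauss]_y' B1 y')); last first.
  apply: (Phi_eq (Phi_mix _ _ gauss f1 B1 bf1 bB1 f1B)) => [y|//].
  apply: eq_Rintegral => y' _; rewrite /f1 /x.
  have -> : upd e k y t = e t by rewrite /upd eq_sym (negbTE kt).
  apply: eq_Rintegral => z _; rewrite /f /= updC//.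
  by rewrite ltn_eqF.
pose I0 := \int[gauss]_y \int[@channel_law _ _ K (x y)]_z B0 (y, z).
have I00 : 0 <= I0.
  apply: Rintegral_ge0 => y _; apply: Rintegral_ge0 => z _.
  by apply: cond_exp_ge0 => z'; exact: sqr_ge0.
have bB0y y' : bm (fun z => B0 (y', z)) by exact: (bm_pair1 y' bB0).
have bI0 : bm (fun y : measurableTypeR R => \int[@channel_law _ _ K (x y)]_z B0 (y, z)).
  exact: (bm_integral_channel (T := R) (g := x) (f := B0) mx bB0).
have -> : \int[gauss]_y' B1 y' = D ^+ size Ks * I0.
  rewrite /I0 -(bintZ gauss _ bI0).
  by apply: eq_Rintegral => y' _; exact: (bintZ _ _ (bB0y y')).
(* Such a step costs nothing; a factor [D] is given away so that the exponent counts all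
   channels. *)
apply: (@le_trans _ _ (D * (D ^+ size Ks * I0))); last by rewrite /= exprS -mulrA.
by rewrite ler_peMl// mulr_ge0.
Qed.

Lemma hyb_draw r' Ks t e m (u : outs Ks -> R) : bm u ->
  hyb r' t e m u = \int[gauss]_y hyb r' t (upd e m y) m.+1 u.
Proof. exact: (cond_exp_draw src). Qed.

Lemma bm_hyb_upd r' Ks d' (T : measurableType d') t e m k k' (u : outs Ks -> R)
    (g g' : T -> R) : bm u -> measurable_fun setT g -> measurable_fun setT g' ->
  bm (fun p => hyb r' t (upd (upd e k (g p)) k' (g' p)) m u).
Proof.
move=> bu mg mg'.
apply: (bm_hyb r' t (e := fun p => upd (upd e k (g p)) k' (g' p)) m
  (u := fun q => u q.2)).
  move=> j; apply: (measurable_upd (e := fun p => upd e k (g p))) => // j'.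
  exact: (measurable_upd (e := fun=> e)).
exact: (bm_comp measurable_snd bu).
Qed.

Lemma bm_hyb_upd1 r' Ks d' (T : measurableType d') t e m k (u : outs Ks -> R)
    (g : T -> R) : bm u -> measurable_fun setT g ->
  bm (fun p => hyb r' t (upd e k (g p)) m u).
Proof.
move=> bu mg.
apply: (bm_hyb r' t (e := fun p => upd e k (g p)) m (u := fun q => u q.2)).
  by move=> j; apply: (measurable_upd (e := fun=> e)).
exact: (bm_comp measurable_snd bu).
Qed.

(** Noises [m] to [h - 1] are averaged by [Phi_mix] while noise [r] stays free; once the first
    window is full, [potential_hybrid] applies at time 0. *)
Lemma potential_initial Ks e m (u : outs Ks -> R) : bm u -> (r < m <= h)%N ->
  Phi (fun y => hyb r.+1 0 (upd e r y) m u)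
    (D ^+ size Ks * hyb r 0 e m (fun z => u z ^+ 2)).
Proof.
move=> bu; have bu2 : bm (fun z => u z ^+ 2) by exact: bmX.
have [_ _ Phi_mix _ _] := pot.
move En : (h - m)%N => n; elim: n m e En => [|n IH] m e En /andP[rm mh].
  have -> : m = (0 + h)%N.
    by apply/eqP; rewrite add0n eqn_leq mh -subn_eq0 En eqxx.
  by apply: potential_hybrid => //; rewrite modn_small.
have mh' : (m < h)%N by rewrite -subn_gt0 En.
have En' : (h - m.+1)%N = n by rewrite subnS En.
pose f (p : measurableTypeR R * R) := hyb r.+1 0 (upd (upd e m p.1) r p.2) m.+1 u.
pose B (y' : measurableTypeR R) := D ^+ size Ks *
  hyb r 0 (upd e m y') m.+1 (fun z => u z ^+ 2).
have bf : bm f.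
  apply: (bm_hyb_upd _ (T := (R * R)%type)) => //.
have bB0 : bm (fun y' : measurableTypeR R =>
    hyb r 0 (upd e m y') m.+1 (fun z => u z ^+ 2)).
  exact: (bm_hyb_upd1 r (T := R)).
have bB : bm B by apply: bmM => //; exact: bm_cst.
have fB y' : Phi (fun y => f (y', y)) (B y').
  by apply: IH => //; rewrite ltnS (ltnW rm).
apply: (Phi_eq (Phi_mix _ _ gauss f B bf bB fB)) => [y|].
  rewrite (hyb_draw r.+1 0 (upd e r y) m bu).
  apply: eq_Rintegral => y' _; rewrite /f /= updC//.
  by rewrite ltn_eqF.
by rewrite /B (bintZ gauss _ bB0) -(hyb_draw r 0 e m bu2).
Qed.

(** The noises before [r] are averaged by Jensen's inequality and noise [r] by [Phi_final], which
    brings in [c]. On the right, noise [r] has no influence on hybrid [r]. *)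
Lemma hybrid_sqr_le Ks e m (u : outs Ks -> R) : bm u -> (m <= r)%N ->
  hyb r.+1 0 e m u ^+ 2 <=
    c * D ^+ size Ks * hyb r 0 e m (fun z => u z ^+ 2).
Proof.
move=> bu; have bu2 : bm (fun z => u z ^+ 2) by exact: bmX.
have [_ _ _ _ Phi_final] := pot.
move En : (r - m)%N => n; elim: n m e En => [|n IH] m e En mr.
  have -> : m = r by apply/eqP; rewrite eqn_leq mr -subn_eq0 En eqxx.
  rewrite -mulrA (hyb_draw r.+1 0 e r bu) (hyb_draw r 0 e r bu2).
  have -> : \int[gauss]_y hyb r 0 (upd e r y) r.+1 (fun z => u z ^+ 2) =
      hyb r 0 e r.+1 (fun z => u z ^+ 2).
    rewrite -[RHS](bint_cst gauss); apply: eq_Rintegral => y _.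
    by apply: hyb_unused; rewrite ?modn_small.
  apply: Phi_final; last by apply: potential_initial; rewrite // ltnSn.
  exact: bm_hyb_upd1.
have mr' : (m < r)%N by rewrite -subn_gt0 En.
have En' : (r - m.+1)%N = n by rewrite subnS En.
rewrite (hyb_draw r.+1 0 e m bu) (hyb_draw r 0 e m bu2).
have b1 : bm (fun y : measurableTypeR R => hyb r.+1 0 (upd e m y) m.+1 u).
  exact: (bm_hyb_upd1 _ (T := R)).
have b2 : bm (fun y : measurableTypeR R =>
    hyb r 0 (upd e m y) m.+1 (fun z => u z ^+ 2)).
  exact: (bm_hyb_upd1 _ (T := R)).
apply: (le_trans (bint_sqr gauss b1)); rewrite -(bintZ gauss _ b2); apply: le_bint.
- exact: (bmX 2 b1).
- by apply: bmM => //; exact: bm_cst.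
- by move=> y; exact: IH.
Qed.

(* The second moment bound, applied to shifts of u, controls the bias. *)
Lemma hybrid_dist Ks e (u : outs Ks -> R) : bm u -> 1 <= c ->
  (forall z, 0 <= u z <= 1) ->
  (hyb r.+1 0 e 0 u - hyb r 0 e 0 u) ^+ 2 <= c * D ^+ size Ks - 1.
Proof.
move=> bu c1 u01; set E1 := hyb r.+1 0 e 0; set E0 := hyb r 0 e 0.
have bu2 : bm (fun z => u z ^+ 2) by exact: bmX.
have Q1 : 1 <= c * D ^+ size Ks.
  by rewrite -[leLHS]mul1r ler_pM// exprn_ege1.
set p0 := E0 u; set p1 := E1 u.
have v0 : 0 <= E0 (fun z => (u z - p0) ^+ 2).
  by apply: cond_exp_ge0 => z; exact: sqr_ge0.
have bc s : bm (fun _ : outs Ks => s : R) by exact: bm_cst.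
have shiftE r' s : hyb r' 0 e 0 (fun z => u z + s) = hyb r' 0 e 0 u + s.
  by rewrite /hyb (cond_expD src)// cond_exp_cst.
have bd : bm (fun z => u z - p0) by exact: bmD.
have bd2 : bm (fun z => (u z - p0) ^+ 2) by exact: bmX.
have vE s : E0 (fun z => (u z - p0 + s) ^+ 2) =
    E0 (fun z => (u z - p0) ^+ 2) + s ^+ 2.
  rewrite (_ : (fun z => (u z - p0 + s) ^+ 2) =
    (fun z => ((u z - p0) ^+ 2 + s ^+ 2) + (2 * s) * (u z - p0))); last first.
    by apply/funext => z; ring.
  have bd3 : bm (fun z => (u z - p0) ^+ 2 + s ^+ 2) by exact: bmD.
  have bd4 : bm (fun z => 2 * s * (u z - p0)) by exact: bmM.
  rewrite /E0 {1}/hyb (cond_expD src h _ _ 0 e 0 bd3 bd4) (cond_expD src h _ _ 0 e 0 bd2 (bc _)).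
  rewrite cond_exp_cst (cond_expZ src h _ _ 0 e 0 _ bd).
  by rewrite -/(hyb r 0 e 0 (fun z => u z - p0)) shiftE subrr mulr0 addr0.
have v1 : E0 (fun z => (u z - p0) ^+ 2) <= 1.
  have p01 : 0 <= p0 <= 1.
    apply/andP; split; first by apply: cond_exp_ge0 => z; case/andP: (u01 z).
    rewrite -[leRHS](cond_exp_cst P xi h (coef1 r) (coef2 r) Ks 0 e 0).
    by apply: (le_cond_exp src) => // z; case/andP: (u01 z).
  rewrite -[leRHS](cond_exp_cst P xi h (coef1 r) (coef2 r) Ks 0 e 0).
  apply: (le_cond_exp src) => // z.
  by move: p01 (u01 z) => /andP[p00 p01] /andP[uz0 uz1]; nra.
apply: (@le_trans _ _ ((c * D ^+ size Ks - 1) * E0 (fun z => (u z - p0) ^+ 2))).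
  apply: (sqr_le_of_shifts Q1 v0) => s; rewrite -vE.
  have bus : bm (fun z => u z - p0 + s) by apply: bmD => //; apply: bmB.
  have := hybrid_sqr_le e bus (leq0n r).
  suff -> : hyb r.+1 0 e 0 (fun z => u z - p0 + s) = p1 - p0 + s by [].
  rewrite (_ : (fun z => u z - p0 + s) = (fun z => u z + (s - p0))).
    by rewrite shiftE addrA addrAC.
  by apply/funext => z; rewrite addrAC addrA.
by rewrite ler_piMr// subr_ge0.
Qed.

End Hybrid.

(** * Fair coin tossing *)

Section Coin.

Fixpoint code (w : nat -> bool) n : nat :=
  if n is n'.+1 then ((code w n').*2 + w n')%N else 0%N.

Definition cylinder n m : set (nat -> bool) := [set w | code w n = m].

Definition cylinders : set (set (nat -> bool)) :=
  [set C | exists n m, C = cylinder n m].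

Lemma code_double w n : ((code w n.+1)./2 = code w n) * (odd (code w n.+1) = w n).
Proof.
by rewrite /= addnC half_bit_double oddD odd_double addbF oddb.
Qed.

Lemma code_prefix w w' n k : code w (n + k) = code w' (n + k) -> code w n = code w' n.
Proof.
elim: k => [|k IH]; first by rewrite addn0.
by rewrite addnS => e; apply: IH; rewrite -(code_double w) -(code_double w') e.
Qed.

Lemma cylinder_sub n k m w : code w (n + k) = m ->
  cylinder (n + k) m `<=` cylinder n (code w n).
Proof. by move=> wm w' /= w'm; apply: (@code_prefix _ _ n k); rewrite w'm. Qed.

Lemma cylinderI n k m m' :
  cylinder n m `&` cylinder (n + k) m' = cylinder (n + k) m' \/
  cylinder n m `&` cylinder (n + k) m' = set0.
Proof.
have [->|/set0P[w [wm wm']]] := eqVneq (cylinder n m `&` cylinder (n + k) m') set0.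
  by right.
left; apply/seteqP; split => w'; first by case.
by move=> w'm'; split => //; move: (cylinder_sub wm' w'm'); rewrite /cylinder /= wm.
Qed.

(** Sequences of bits, with the sigma-algebra of finite prefixes. Splitting a sequence by parity
    makes this space a copy of its own square, just what a first noise variable and an independent
    shift require. *)
Definition coin := g_sigma_algebraType cylinders.

Lemma measurable_cylinder n m : measurable (cylinder n m : set coin).
Proof. by apply: sub_sigma_algebra; exists n, m. Qed.

Lemma code_bound w n : (code w n < 2 ^ n)%N.
Proof.
elim: n => //= n IH; rewrite expnS mul2n -addn1.
by move: IH; rewrite -ltn_double -[X in (_ < X)%N]addn0; case: (w n); lia.
Qed.

End Coin.

Section CoinMeasure.
Context {R : realType}.

Definition unif01 : set (measurableTypeR R) -> \bar R :=
  mrestr (@lebesgue_measure R) (measurable_itv `[0%R, 1%R[).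

HB.instance Definition _ := Measure.on unif01.

Let unif01T : unif01 setT = 1%E.
Proof.
by rewrite /unif01 /mrestr setTI lebesgue_measure_itv /= lte_fin ltr01 oppr0 adde0.
Qed.

HB.instance Definition _ := Measure_isProbability.Build _ _ _ unif01 unif01T.

(** Outside [0, 1) all digits are 0, which keeps the map total and measurable; [unif01] gives no
    mass to these points. *)
Definition digits (u : R) : coin := fun k => (0 <= u < 1) && odd (Num.truncn (2 ^+ k.+1 * u)).

Lemma code_digits (u : R) n : 0 <= u < 1 -> code (digits u) n = Num.truncn (2 ^+ n * u).
Proof.
move=> u01; have /andP[u0 u1] := u01; elim: n => [|n IH] /=.
  by apply/esym/truncn_def; rewrite expr0 mul1r u0 u1.
rewrite IH /digits u01 /=.
have m0 : 0 <= 2 ^+ n * u by rewrite mulr_ge0// exprn_ge0.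
have m0' : 0 <= 2 ^+ n.+1 * u by rewrite mulr_ge0// exprn_ge0.
have /andP[a1 a2] := truncn_itv m0; have /andP[b1 b2] := truncn_itv m0'.
set a := Num.truncn _ in a1 a2 *; set b := Num.truncn _ in b1 b2 *.
rewrite exprS -mulrA in b1 b2.
have ab : (a.*2 < b.+1)%N.
  by rewrite -(ltr_nat R) (le_lt_trans _ b2)// -mul2n natrM ler_pM2l.
have ba : (b < a.*2.+2)%N.
  by rewrite -(ltr_nat R) (le_lt_trans b1)// -doubleS -mul2n natrM ltr_pM2l.
rewrite -[RHS](odd_double_half b) addnC; congr (_ + _)%N.
by rewrite -!mul2n; move: ab ba; rewrite -!mul2n; lia.
Qed.

Lemma code_digits_out (u : R) n : ~~ (0 <= u < 1) -> code (digits u) n = 0%N.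
Proof.
move=> u01; elim: n => //= n ->.
by rewrite /digits (negbTE u01).
Qed.

Lemma digits_cylinder n m : (digits @^-1` cylinder n m) `&` `[0%R, 1%R[ =
  if (m < 2 ^ n)%N then `[m%:R / 2 ^+ n, m.+1%:R / 2 ^+ n[%classic else set0.
Proof.
have p0 : 0 < 2 ^+ n :> R by rewrite exprn_gt0.
have cE (u : R) : 0 <= u < 1 -> (code (digits u) n == m) =
    (m%:R / 2 ^+ n <= u < m.+1%:R / 2 ^+ n).
  move=> u01; rewrite code_digits//; have /andP[u0 _] := u01.
  rewrite truncn_eq; last by rewrite mulr_ge0// ltW.
  by rewrite ler_pdivrMr// ltr_pdivlMr// mulrC.
case: ifPn => [mn|]; last first.
  rewrite -leqNgt => mn; apply/seteqP; split => // u [] /= cu _.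
  by have := code_bound (digits u) n; rewrite cu ltnNge mn.
apply/seteqP; split => u /=; rewrite !in_itv /=.
  by move=> [cu u01]; rewrite -cE// cu.
move=> mu; have u01 : 0 <= u < 1.
  have /andP[mu1 mu2] := mu; rewrite (le_trans _ mu1) ?divr_ge0 ?(ltW p0)//=.
  by rewrite (lt_le_trans mu2)// ler_pdivrMr// mul1r -natrX ler_nat.
by split => //; apply/eqP; rewrite cE.
Qed.

Lemma measurable_digits : measurable_fun setT digits.
Proof.
apply: (@measurability _ _ _ coin setT digits cylinders (erefl _)) => _ [_ [n [m ->]] <-]; rewrite setTI.
rewrite -(setIT (digits @^-1` _)) -(setUv `[0%R, 1%R[%classic) setIUr.
apply: measurableU.
  by rewrite digits_cylinder; case: ifP => _ //; exact: measurable_itv.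
have [m0|m0] := eqVneq m 0%N.
  rewrite (_ : _ `&` _ = ~` `[0%R, 1%R[%classic).
    by apply: measurableC; exact: measurable_itv.
  apply/seteqP; split => u; first by case.
  move=> /= nu; split => //; rewrite /cylinder /= m0 code_digits_out//.
  by apply/negP; move: nu; rewrite in_itv.
rewrite (_ : _ `&` _ = set0)//; apply/seteqP; split => // u /= [cu nu].
move: cu; rewrite /cylinder /= code_digits_out; first by move=> /esym/eqP; apply/negP.
by apply/negP; move: nu; rewrite in_itv.
Qed.

HB.instance Definition _ :=
  isMeasurableFun.Build _ _ _ _ (digits : measurableTypeR R -> coin) measurable_digits.

Definition coin_prob : probability coin R := distribution unif01 digits.

Lemma coin_prob_cylinder n m :
  coin_prob (cylinder n m) = if (m < 2 ^ n)%N then (2 ^- n)%:E else 0%E.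
Proof.
rewrite /coin_prob /= /distribution /pushforward /= /unif01 /mrestr digits_cylinder.
case: ifP => _; last exact: measure0.
have p0 : 0 < 2 ^- n :> R by rewrite invr_gt0 exprn_gt0.
rewrite lebesgue_measure_itv /= lte_fin ltr_pM2r// ltr_nat ltnSn.
by rewrite -EFinB -mulrBl -natrB// subSnn mul1r.
Qed.

Definition even_bits (w : coin) : coin := fun k => w k.*2.
Definition odd_bits (w : coin) : coin := fun k => w k.*2.+1.

(** The code of a prefix of length 2n in terms of the codes of its even and odd bits. The base case
    [m + m'] keeps track of overflow: it is 0 only if both codes are in range, so [code_split] and
    [interleave_lt] hold without bounds on [m] and [m']. *)
Fixpoint interleave n m m' : nat :=
  if n is n'.+1 then
    ((interleave n' m./2 m'./2).*2 + odd m).*2 + odd m'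
  else (m + m')%N.

Lemma code_eqS (w : nat -> bool) n m :
  (code w n.+1 = m) <-> (code w n = m./2) /\ w n = odd m.
Proof.
split=> [<-|[wm wn]]; first by rewrite !code_double.
by rewrite -(odd_double_half m) /= wm wn addnC.
Qed.

Lemma code_split (w : coin) n m m' :
  (code (even_bits w) n = m /\ code (odd_bits w) n = m') <->
  code w n.*2 = interleave n m m'.
Proof.
elim: n m m' => [|n IH] m m'.
  rewrite /=; split; first by move=> [<- <-].
  by move/esym/eqP; rewrite addn_eq0 => /andP[/eqP -> /eqP ->].
rewrite (code_eqS (even_bits w)) (code_eqS (odd_bits w)) doubleS.
rewrite (code_eqS w n.*2.+1) (code_eqS w n.*2).
have -> : ((interleave n.+1 m m')./2)./2 = interleave n m./2 m'./2.
  by rewrite /= addnC half_bit_double addnC half_bit_double.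
have -> : odd (interleave n.+1 m m')./2 = odd m.
  by rewrite /= addnC half_bit_double oddD odd_double oddb.
have -> : odd (interleave n.+1 m m') = odd m'.
  by rewrite /= oddD odd_double oddb.
by rewrite -IH /even_bits /odd_bits; tauto.
Qed.

Lemma interleave_lt n m m' : (interleave n m m' < 2 ^ n.*2)%N =
  (m < 2 ^ n)%N && (m' < 2 ^ n)%N.
Proof.
elim: n m m' => [|n IH] m m' /=; first by case: m m' => [|m] [|m'].
have H (x : nat) (c : bool) p : (x.*2 + c < 2 ^ p.+1)%N = (x < 2 ^ p)%N.
  by rewrite expnS mul2n; case: c; lia.
rewrite doubleS !H IH.
by rewrite -{2}(odd_double_half m) -{2}(odd_double_half m') ![(odd _ + _)%N]addnC !H.
Qed.

Lemma measurable_even_bits : measurable_fun setT even_bits.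
Proof.
apply: (@measurability _ _ _ coin setT even_bits cylinders (erefl _)) => _ [_ [n [m ->]] <-].
rewrite setTI (_ : _ @^-1` _ = \bigcup_m' cylinder n.*2 (interleave n m m')).
  by apply: bigcup_measurable => k _; exact: measurable_cylinder.
apply/seteqP; split => w /=.
  by move=> wm; exists (code (odd_bits w) n) => //; apply/code_split.
by move=> [m' _ /code_split[]].
Qed.

Lemma measurable_odd_bits : measurable_fun setT odd_bits.
Proof.
apply: (@measurability _ _ _ coin setT odd_bits cylinders (erefl _)) => _ [_ [n [m ->]] <-].
rewrite setTI (_ : _ @^-1` _ = \bigcup_m' cylinder n.*2 (interleave n m' m)).
  by apply: bigcup_measurable => k _; exact: measurable_cylinder.
apply/seteqP; split => w /=.
  by move=> wm; exists (code (even_bits w) n) => //; apply/code_split.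
by move=> [m' _ /code_split[]].
Qed.

(** Both sides have the same depth, so that the preimage of a rectangle under [split_bits] is a
    single cylinder of depth 2n. *)
Definition rectangles : set (set (coin * coin)) :=
  [set C | exists n m m', C = cylinder n m `*` cylinder n m'].

Lemma rectangles_setI : setI_closed rectangles.
Proof.
move=> _ _ [n1 [m1 [m1' ->]]] [n2 [m2 [m2' ->]]]; rewrite -setXI.
wlog nn' : n1 m1 m1' n2 m2 m2' / (n1 <= n2)%N.
  move=> H; case: (leqP n1 n2) => [|/ltnW] nn'; first exact: H.
  rewrite setIC [X in _ `*` X]setIC; exact: H.
rewrite -(subnKC nn').
have E0 : rectangles set0.
  (* The empty prefix has code 0, so [cylinder 0 1] is empty. *)
  exists 0%N, 1%N, 1%N; apply/seteqP; split => // -[w w'] [] //.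
case: (cylinderI n1 (n2 - n1) m1 m2) => ->; last by rewrite set0X.
case: (cylinderI n1 (n2 - n1) m1' m2') => ->; last by rewrite setX0.
by exists (n1 + (n2 - n1))%N, m2, m2'.
Qed.

Let rect_space := g_sigma_algebraType rectangles.

Let measurable_rect_fst : measurable_fun setT (fst : rect_space -> coin).
Proof.
apply: (@measurability _ _ _ coin setT (fst : rect_space -> coin) cylinders (erefl _)) => _ [_ [n [m ->]] <-].
rewrite setTI (_ : _ @^-1` _ = \bigcup_m' (cylinder n m `*` cylinder n m')).
  by apply: bigcup_measurable => k _; apply: sub_sigma_algebra; exists n, m, k.
apply/seteqP; split => -[w w'] /=; last by case=> m' _ [].
by move=> wm; exists (code w' n).
Qed.

Let measurable_rect_snd : measurable_fun setT (snd : rect_space -> coin).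
Proof.
apply: (@measurability _ _ _ coin setT (snd : rect_space -> coin) cylinders (erefl _)) => _ [_ [n [m ->]] <-].
rewrite setTI (_ : _ @^-1` _ = \bigcup_m' (cylinder n m' `*` cylinder n m)).
  by apply: bigcup_measurable => k _; apply: sub_sigma_algebra; exists n, k, m.
apply/seteqP; split => -[w w'] /=; last by case=> m' _ [].
by move=> wm; exists (code w n).
Qed.

Lemma measurable_rectangles :
  (measurable : set (set (coin * coin))) = <<s rectangles >>.
Proof.
apply/seteqP; split; apply: smallest_sub; try exact: smallest_sigma_algebra.
- move=> A [[B mB <-]|[B mB <-]]; rewrite setTI.
    by have := measurable_rect_fst measurableT mB; rewrite setTI.
  by have := measurable_rect_snd measurableT mB; rewrite setTI.
- by move=> _ [n [m [m' ->]]]; apply: measurableX; exact: measurable_cylinder.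
Qed.

Definition split_bits (w : coin) : coin * coin := (even_bits w, odd_bits w).

Lemma measurable_split_bits : measurable_fun setT split_bits.
Proof.
by apply: measurable_fun_pair; [exact: measurable_even_bits|exact: measurable_odd_bits].
Qed.

HB.instance Definition _ := isMeasurableFun.Build _ _ _ _ split_bits measurable_split_bits.

(** Even and odd bits are independent fair sequences: on rectangles both sides are 2^-2n or 0, and
    rectangles form a generating pi-system. *)
Lemma coin_prob_split (A : set (coin * coin)) : measurable A ->
  coin_prob (split_bits @^-1` A) = (coin_prob \x coin_prob)%E A.
Proof.
move=> mA.
apply: (measure_unique rectangles (fun=> setT) measurable_rectangles rectangles_setI _ _
  (distribution coin_prob split_bits) (coin_prob \x coin_prob)%E) => //.
- move=> _; exists 0%N, 0%N, 0%N; apply/seteqP; split => // -[w w'] _; by split.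
- by apply/seteqP; split => // w _; exists 0%N.
- move=> _ [n [m [m' ->]]].
  transitivity (coin_prob (cylinder n m) * coin_prob (cylinder n m'))%E; last first.
    by apply/esym; apply: product_measure1E; exact: measurable_cylinder.
  rewrite [LHS](_ : _ = coin_prob (cylinder n.*2 (interleave n m m'))); last first.
    congr (coin_prob _).
    by apply/seteqP; split => w /=; rewrite /cylinder /= => /code_split.
  rewrite !coin_prob_cylinder interleave_lt.
  case: (m < 2 ^ n)%N; case: (m' < 2 ^ n)%N => /=; rewrite ?mule0 ?mul0e//.
  by rewrite -EFinM -addnn exprD invfM.
- by move=> k; rewrite (le_lt_trans (probability_le1 _ _))// ltry.
Qed.

End CoinMeasure.

(** * Gaussian noise from coin tosses *)

Section CoinValue.
Context {R : realType}.

Let partial_val (n : nat) (w : coin) : R := (code w n)%:R / 2 ^+ n.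

Let measurable_partial_val n : measurable_fun setT (partial_val n).
Proof.
move=> _ Y mY; rewrite setTI.
rewrite (_ : _ @^-1` _ = \bigcup_(m in [set m | Y (m%:R / 2 ^+ n)]) cylinder n m).
  by apply: bigcup_measurable => k _; exact: measurable_cylinder.
apply/seteqP; split => w /=; first by move=> Yw; exists (code w n).
by move=> [m Ym wm]; move: Ym; rewrite /= -wm.
Qed.

(* The real number in [0, 1] with the given binary digits *)
Definition coin_val (w : coin) : R := limn_sup (partial_val ^~ w).

Let partial_val_bound n w : 0 <= partial_val n w <= 1.
Proof.
have p0 : 0 < 2 ^+ n :> R by rewrite exprn_gt0.
rewrite /partial_val divr_ge0 ?(ltW p0)//= ler_pdivrMr// mul1r -natrX ler_nat.
by rewrite ltnW// code_bound.
Qed.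

Lemma measurable_coin_val : measurable_fun setT coin_val.
Proof.
apply: measurable_fun_limn_sup => //.
- by move=> w _; exists 1 => _ [n _ <-]; case/andP: (partial_val_bound n w).
- by move=> w _; exists 0 => _ [n _ <-]; case/andP: (partial_val_bound n w).
Qed.

Lemma coin_val_digits (u : R) : 0 <= u < 1 -> coin_val (digits u) = u.
Proof.
move=> u01; have /andP[u0 u1] := u01.
suff cu : partial_val ^~ (digits u) @ \oo --> u.
  by rewrite /coin_val; apply: cvg_lim => //; exact: cvg_sups.
have half_cvg : (fun n => 2^-1 ^+ n : R) @ \oo --> (0 : R).
  by apply: cvg_expr; rewrite ger0_norm ?invf_lt1 ?ltr1n// invr_ge0.
apply: (@squeeze_cvgr _ _ _ _ (fun n => u - 2^-1 ^+ n) (fun=> u)); last 2 first.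
- by rewrite -[X in _ --> X]subr0; apply: (@cvgB _ R^o) => //; exact: cvg_cst.
- exact: cvg_cst.
near=> n.
have p0 : 0 < 2 ^+ n :> R by rewrite exprn_gt0.
have x0 : 0 <= 2 ^+ n * u by rewrite mulr_ge0// ltW.
have /andP[a1 a2] := truncn_itv x0.
rewrite /partial_val code_digits//; apply/andP; split.
  rewrite lerBlDr -(ler_pM2l p0) mulrDr mulrCA divff ?gt_eqF// mulr1.
  by rewrite exprVn divff ?gt_eqF// natr1 ltW.
by rewrite ler_pdivrMr// (mulrC u).
Unshelve. all: by end_near. Qed.

End CoinValue.

Section Quantile.
Context {R : realType} (Q : probability (measurableTypeR R) R).

Lemma probability_rays (m1 m2 : probability (measurableTypeR R) R) :
  (forall x, m1 `]-oo, x]%classic = m2 `]-oo, x]%classic) ->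
  forall A, measurable A -> m1 A = m2 A.
Proof.
move=> m12; apply: (@measure_unique _ _ (measurableTypeR R) (@RGenOInfty.G R)
  (fun n => `](- n%:R)%R, +oo[%classic) (RGenOInfty.measurableE R) _ _ _ m1 m2).
- move=> _ _ [x ->] [y ->]; exists (Num.max x y).
  by apply/seteqP; split => z /=; rewrite !in_itv /= !andbT gt_max => /andP.
- by move=> n; exists (- n%:R).
- apply/seteqP; split => // x _; exists (Num.truncn `|x|).+1 => //=.
  by rewrite in_itv /= andbT ltrNl (le_lt_trans (ler_norm _))// normrN truncnS_gt.
- move=> _ [x ->]; rewrite -setCitvl.
  have mx : measurable (`]-oo, x]%classic : set (measurableTypeR R)) by [].
  apply: (etrans (probability_setC m1 mx)); apply: esym.
  by apply: (etrans (probability_setC m2 mx)); rewrite m12.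
- by move=> k; rewrite (le_lt_trans (probability_le1 _ _))// ltry.
Qed.

Let F (x : R) : R := fine (Q `]-oo, x]%classic).

Let F_fin x : (F x)%:E = Q `]-oo, x]%classic.
Proof. by rewrite /F fineK// fin_num_measure. Qed.

Let F_nd : {homo F : x y / x <= y}.
Proof.
move=> x y xy; rewrite -lee_fin !F_fin; apply: le_measure; rewrite ?inE//.
exact: subitvPr.
Qed.

Let idTR : measurableTypeR R -> R := idfun.

#[local] HB.instance Definition _ :=
  @isMeasurableFun.Build _ _ _ _ idTR (@measurable_id _ _ setT).

Let F_cdf x : (F x)%:E = cdf (idTR : {RV Q >-> R}) x.
Proof. by rewrite F_fin. Qed.

Let F_cdfE : EFin \o F = cdf (idTR : {RV Q >-> R}).
Proof. by apply/funext => x; exact: F_cdf. Qed.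

Let F_above (u : R) : u < 1 -> exists x, u < F x.
Proof.
move=> u1; have := @cvg_cdfy1 _ _ _ Q (idTR : {RV Q >-> R}); rewrite -F_cdfE.
move/fine_cvgP => [_ /cvgr_gt/(_ _ u1)] H.
by have [x] := filter_ex H; exists x.
Qed.

Let F_below (u : R) : 0 < u -> exists x, F x < u.
Proof.
move=> u0; have := @cvg_cdfNy0 _ _ _ Q (idTR : {RV Q >-> R}); rewrite -F_cdfE.
move/fine_cvgP => [_ /cvgr_lt/(_ _ u0)] H.
by have [x] := filter_ex H; exists x.
Qed.

Let F_right (u x : R) : F x < u -> exists2 y, x < y & F y < u.
Proof.
move=> xu; have := @cdf_right_continuous _ _ _ Q (idTR : {RV Q >-> R}) x.
rewrite -F_cdfE => /fine_cvgP[_ /cvgr_lt/(_ _ xu)] H.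
near x^'+ => y; exists y; first by near: y; exact: nbhs_right_gt.
by near: y.
Unshelve. all: by end_near. Qed.

Definition quantile (u : R) : R := if 0 < u < 1 then sup [set x | F x < u] else 0.

(** The Galois connection between quantile and distribution function. Right continuity of [F] is
    what gives the forward direction: if F x < u, then F y < u for some y > x. *)
Let quantile_le (u x : R) : 0 < u < 1 -> (quantile u <= x) = (u <= F x).
Proof.
move=> u01; rewrite /quantile u01; have /andP[u0 u1] := u01.
have [z zu] := F_below u0; have [z' z'u] := F_above u1.
have ub : ubound [set x | F x < u] z'.
  move=> y /= yu; rewrite leNgt; apply/negP => /ltW/F_nd.
  by move=> /(lt_le_trans z'u)/(lt_trans yu); rewrite ltxx.
have hs : has_sup [set x | F x < u] by split; [exists z|exists z'].
apply/idP/idP => [sx|ux]; last first.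
  apply: ge_sup; first by exists z.
  move=> y /= yu; rewrite leNgt; apply/negP => /ltW/F_nd.
  by move=> /(le_trans ux)/(lt_le_trans yu); rewrite ltxx.
rewrite leNgt; apply/negP => /F_right[y xy yu].
have : y <= sup [set x | F x < u] by exact: sup_upper_bound.
by move=> /le_trans/(_ sx); rewrite leNgt xy.
Qed.

Lemma measurable_quantile : measurable_fun setT (quantile : measurableTypeR R -> measurableTypeR R).
Proof.
apply: (@measurability _ _ _ (measurableTypeR R) _ _ (@RGenOInfty.G R)).
  exact: RGenOInfty.measurableE.
move=> _ [_ [x ->] <-]; rewrite setTI -setCitvl preimage_setC.
apply: measurableC.
have qE : quantile @^-1` `]-oo, x] =
    (`]0, 1[ `&` `]-oo, F x]) `|` ((~` `]0, 1[) `&` [set _ | 0 <= x]).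
  apply/seteqP; split => u /=; rewrite !in_itv /=.
    have [u01|u01] := boolP (0 < u < 1); first by rewrite quantile_le//; left.
    by rewrite /quantile (negbTE u01) => x0; right.
  case=> -[u01]; first by rewrite quantile_le.
  by rewrite /quantile; move/negP/negbTE: u01 => ->.
apply: (eq_ind_r (fun A => @measurable _ (measurableTypeR R) A) _ qE).
apply: measurableU; first by apply: measurableI; exact: measurable_itv.
apply: measurableI; first by apply: measurableC; exact: measurable_itv.
by case: (0 <= x); [rewrite (_ : [set _ | _] = setT)|rewrite (_ : [set _ | _] = set0)];
  rewrite //; apply/seteqP; split.
Qed.

HB.instance Definition _ :=
  isMeasurableFun.Build _ _ _ _ (quantile : measurableTypeR R -> measurableTypeR R)
    measurable_quantile.

Lemma quantile_law (A : set R) : measurable A -> unif01 (quantile @^-1` A) = Q A.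
Proof.
move=> mA; apply: (probability_rays (m1 := distribution unif01
  (quantile : measurableTypeR R -> measurableTypeR R)) (m2 := Q)) => // x.
rewrite -F_fin /distribution /pushforward /= /unif01 /mrestr.
have Fx0 : 0 <= F x by exact: fine_ge0.
have Fx1 : F x <= 1 by rewrite -lee_fin F_fin probability_le1.
have mI : measurable (quantile @^-1` `]-oo, x] `&` `[0%R, 1%R[).
  apply: measurableI; last exact: measurable_itv.
  have := measurable_quantile measurableT (measurable_itv `]-oo, x]).
  by rewrite setTI.
(* Within [0, 1) the preimage of the ray lies between []0, F x[] and [[0, F x]], so the default
   value of [quantile] at 0 does not matter. *)
have I1 : lebesgue_measure `]0, F x[%classic = (F x)%:E.
  rewrite lebesgue_measure_itv /= lte_fin; case: ltP => [_|]; first by rewrite oppr0 adde0.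
  by move=> F0; congr EFin; apply/eqP; rewrite eq_le Fx0 F0.
have I2 : lebesgue_measure `[0, F x]%classic = (F x)%:E.
  rewrite lebesgue_measure_itv /= lte_fin; case: ltP => [_|]; first by rewrite oppr0 adde0.
  by move=> F0; congr EFin; apply/eqP; rewrite eq_le Fx0 F0.
apply/eqP; rewrite eq_le; apply/andP; split.
  rewrite -[leRHS]I2; apply: le_measure; rewrite ?inE//.
  move=> u /= [ux]; rewrite !in_itv /= => /andP[u0 u1]; rewrite u0 /=.
  move: u0; rewrite le_eqVlt => /predU1P[<-//|u0].
  by rewrite -quantile_le ?u0 ?u1//; move: ux; rewrite in_itv.
rewrite -[leLHS]I1; apply: le_measure; rewrite ?inE//.
move=> u /=; rewrite !in_itv /= => /andP[u0 uF].
have u01 : 0 < u < 1 by rewrite u0 (lt_le_trans uF).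
by split; [rewrite quantile_le// ltW|case/andP: u01 => /ltW -> ->].
Qed.

End Quantile.

Section CoinNoise.
Context {R : realType}.

Local Notation P := (@coin_prob R).

Definition coin_gauss (w : coin) : R := quantile gauss (coin_val w).

Lemma measurable_coin_gauss : measurable_fun setT (coin_gauss : coin -> measurableTypeR R).
Proof. exact: (measurableT_comp (measurable_quantile gauss) measurable_coin_val). Qed.

Lemma coin_gauss_law (A : set R) : measurable A -> P (coin_gauss @^-1` A) = gauss A.
Proof.
move=> mA; rewrite -(quantile_law gauss mA).
rewrite /coin_prob /= /distribution /pushforward /= /unif01 /mrestr.
congr (lebesgue_measure _); apply/seteqP.
by split => u /= []; rewrite in_itv /= => uA u01; split => //; move: uA;
  rewrite /coin_gauss coin_val_digits.
Qed.

(** Each variable uses the even bits of what its predecessors left over, so different variables read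
    disjoint sets of bits. *)
Definition noise n (w : coin) : R := coin_gauss (even_bits (iter n odd_bits w)).

Lemma coin_noise : noise_source P noise odd_bits.
Proof.
have mi n : measurable_fun setT (iter n odd_bits : coin -> coin).
  elim: n => [|n IH] /=; first exact: measurable_id.
  exact: (measurableT_comp measurable_odd_bits IH).
split => [n|n w|f bf].
- apply: (measurableT_comp measurable_coin_gauss).
  exact: (measurableT_comp measurable_even_bits (mi n)).
- by rewrite /noise iterSr.
pose g (p : coin * coin) := f (coin_gauss p.1, p.2).
have mg1 : measurable_fun setT (fun p : coin * coin => (coin_gauss p.1, p.2)).
  apply: measurable_fun_pair => //.
  exact: (measurableT_comp measurable_coin_gauss measurable_fst).
have bg : bm g by exact: (bm_comp mg1 bf).
transitivity (\int[(P \x P)%E]_p g p).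
  rewrite /Rintegral; congr fine.
  transitivity (\int[distribution P split_bits]_p (g p)%:E)%E.
    rewrite integral_distribution//; first by apply/measurable_EFinP; case: bg.
    exact: (bm_integrable P (bm_comp measurable_split_bits bg)).
  by apply: eq_measure_integral => A mA _; exact: coin_prob_split.
rewrite bint_prod//.
pose k (y : R) := \int[P]_w f (y, w).
have bk : bm k by exact: (bm_integral2 P bf).
transitivity (\int[P]_w k (coin_gauss w)) => //.
rewrite /Rintegral; congr fine.
pose X : {mfun coin >-> measurableTypeR R} :=
  HB.pack (coin_gauss : coin -> measurableTypeR R)
    (isMeasurableFun.Build _ _ _ _ (coin_gauss : coin -> measurableTypeR R) measurable_coin_gauss).
transitivity (\int[distribution P X]_y (k y)%:E)%E.
  rewrite integral_distribution//; first by apply/measurable_EFinP; case: bk.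
  exact: (bm_integrable P (bm_comp measurable_coin_gauss bk)).
by apply: eq_measure_integral => A mA _; exact: coin_gauss_law.
Qed.

End CoinNoise.

(** * Normal laws *)

Section GaussianSums.
Context {R : realType}.

Lemma ge0_gaussN (f : R -> \bar R) :
  measurable_fun setT f -> (forall x, (0 <= f x)%E) ->
  (\int[gauss]_x f (- x)%R = \int[gauss]_x f x)%E.
Proof.
move=> mf f0.
have mN : measurable_fun setT (-%R : measurableTypeR R -> measurableTypeR R).
  exact: oppr_measurable.
rewrite (ge0_integral_normal 0 1 mf f0).
rewrite (ge0_integral_normal 0 1 (f := fun x => f (- x))) => [|| //].
  pose g x := (f x * (normal_pdf 0 1 x)%:E)%E.
  have g0 x : (0 <= g x)%E by rewrite mule_ge0// lee_fin normal_pdf_ge0.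
  have mg : measurable_fun setT g.
    by apply: emeasurable_funM => //; apply/measurable_EFinP; exact: measurable_normal_pdf.
  transitivity (\int[lebesgue_measure]_x g (- x)%R)%E.
    apply: eq_integral => x _; rewrite /g; congr (_ * EFin _)%E.
    by rewrite !normal_pdf_gt0E// !subr0 sqrrN.
  rewrite -[LHS](@ge0_integral_pushforward _ _ (measurableTypeR R) (measurableTypeR R) _
    -%R mN lebesgue_measure setT g measurableT mg (fun x _ => g0 x)).
  by apply: eq_measure_integral => B mB _; exact: lebesgue_measureN.
exact: (measurableT_comp mf).
Qed.

Lemma gaussN (G : R -> R) : bm G -> \int[gauss]_x G (- x) = \int[gauss]_x G x.
Proof.
move=> bG; have [mG [M GM]] := bG.
have bM : bm (T := measurableTypeR R) (fun=> M) by exact: bm_cst.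
have mN : measurable_fun setT (-%R : R -> measurableTypeR R) by exact: oppr_measurable.
have bGN : bm (T := measurableTypeR R) (fun x => G (- x)) by exact: (bm_comp mN bG).
apply: (addIr (\int[gauss]_x (fun=> M) x)).
rewrite -(bintD gauss bGN bM) -(bintD gauss bG bM) /Rintegral; congr fine.
apply: (ge0_gaussN (f := fun x => (G x + M)%:E)).
- by apply/measurable_EFinP; apply: measurable_funD.
- by move=> x; rewrite lee_fin; have := GM x; rewrite ler_norml => /andP[]; lra.
Qed.

(** Up to scaling by r, the root of s^2 + c^2, this is the rotation with coefficients s/r and c/r.
    The case [s = 0], excluded there, uses symmetry when [c] is negative. *)
Lemma gauss_add (s c : R) (G : R -> R) : 0 <= s -> bm G ->
  \int[gauss]_y \int[gauss]_x G (s * x + c * y) =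
  \int[gauss]_x G (Num.sqrt (s ^+ 2 + c ^+ 2) * x).
Proof.
move=> s0 bG; have bGl (k : R) : bm (T := measurableTypeR R) (fun x => G (k * x)).
  exact: (bm_comp (mulrl_measurable k) bG).
move: s0; rewrite le_eqVlt => /predU1P[<-|s0].
  rewrite expr0n add0r sqrtr_sqr.
  transitivity (\int[gauss]_y G (c * y)).
    apply: eq_Rintegral => y _; rewrite -[RHS](bint_cst gauss).
    by apply: eq_Rintegral => x _; rewrite mul0r add0r.
  have [c0|c0] := ler0P c; last by [].
  rewrite -(gaussN (bGl c)); apply: eq_Rintegral => x _.
  by rewrite mulrN mulNr.
set r := Num.sqrt _.
have r2 : r ^+ 2 = s ^+ 2 + c ^+ 2 by rewrite sqr_sqrtr// addr_ge0// sqr_ge0.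
have r0 : 0 < r by rewrite sqrtr_gt0 ltr_pwDl// ?sqr_ge0// exprn_gt0.
have rn : r != 0 by rewrite gt_eqF.
have a0 : 0 < s / r by exact: divr_gt0.
have ab1 : (s / r) ^+ 2 + (c / r) ^+ 2 = 1.
  by rewrite !expr_div_n -mulrDl -r2 divff// expf_neq0.
rewrite -(gauss_rotation a0 ab1 (bGl r)).
apply: eq_Rintegral => y _; apply: eq_Rintegral => x _.
by congr G; field.
Qed.

Lemma gauss_exp_sqr (t : R) : t < 2^-1 ->
  (\int[gauss]_x (expR (t * x ^+ 2))%:E = ((Num.sqrt (1 - 2 * t))^-1)%:E)%E.
Proof.
move=> t2; have := gauss_exp_quadratic 0 t2.
rewrite expr0n mul0r expR0 mulr1 => <-.
by apply: eq_integral => x _; rewrite mul0r addr0.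
Qed.

Lemma invsqrt_taylor_le (t : R) : 0 < t -> t <= 4^-1 ->
  (Num.sqrt (1 - 2 * t))^-1 <= 1 + t + 4 * t ^+ 2.
Proof.
move=> t0 t4; apply: invsqrt_le; [lra|nra|].
rewrite -subr_ge0; have -> : (1 + t + 4 * t ^+ 2) ^+ 2 * (1 - 2 * t) - 1 =
  t ^+ 2 * (5 - 10 * t - 32 * t ^+ 3) by ring.
have : t ^+ 3 <= 4^-1 ^+ 3 by apply: lerXn2r; rewrite ?nnegrE; lra.
by move=> t3; rewrite mulr_ge0 ?sqr_ge0//; lra.
Qed.

Lemma invsqrt_taylor_ge (t : R) : 0 < t -> t <= 4^-1 ->
  (Num.sqrt (1 + 2 * t))^-1 <= 1 - t + 2 * t ^+ 2.
Proof.
move=> t0 t4; apply: invsqrt_le; [lra|nra|].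
rewrite -subr_ge0; have -> : (1 - t + 2 * t ^+ 2) ^+ 2 * (1 + 2 * t) - 1 =
  t ^+ 2 * (1 + 6 * t - 4 * t ^+ 2 + 8 * t ^+ 3) by ring.
have : 0 <= t ^+ 3 by rewrite exprn_ge0// ltW.
by move=> t3; rewrite mulr_ge0 ?sqr_ge0//; nra.
Qed.

Let M := (\int[gauss]_x (x ^+ 2)%:E : \bar R)%E.

Let measurable_sqr : measurable_fun setT (fun x : measurableTypeR R => x ^+ 2).
Proof. exact: measurable_funX. Qed.

Let M0 : (0 <= M)%E.
Proof. by apply: integral_ge0 => x _; rewrite lee_fin sqr_ge0. Qed.

Let MZ (t : R) : 0 < t -> (\int[gauss]_x (t%:E * (x ^+ 2)%:E) = t%:E * M)%E.
Proof.
move=> t0; apply: (@ge0_integralZl_EFin _ (measurableTypeR R) _ gauss setT).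
- exact: measurableT.
- by move=> x _; rewrite lee_fin sqr_ge0.
- by apply/measurable_EFinP.
- exact: ltW.
Qed.

Let M_upper (t : R) : 0 < t < 2^-1 -> (1 + t%:E * M <= ((Num.sqrt (1 - 2 * t))^-1)%:E)%E.
Proof.
move=> /andP[t0 t2]; rewrite -gauss_exp_sqr//.
have -> : (1 + t%:E * M = \int[gauss]_x (1 + t%:E * (x ^+ 2)%:E))%E.
  rewrite ge0_integralD//=.
  - rewrite MZ//; congr (_ + _)%E; rewrite integral_cst// mul1e; apply/esym.
    exact: (@probability_setT _ _ _ gauss).
  - by move=> x _; rewrite -EFinM lee_fin mulr_ge0 ?sqr_ge0// (ltW t0).
  - by apply: measurable_funeM; apply/measurable_EFinP.
apply: ge0_le_integral => //.
- by move=> x _; rewrite -EFinM -EFinD lee_fin; apply: addr_ge0 => //; apply: mulr_ge0; rewrite ?sqr_ge0// ltW.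
- apply: emeasurable_funD => //.
  by apply: measurable_funeM; apply/measurable_EFinP.
- by apply/measurable_EFinP; apply: measurableT_comp => //; apply: measurable_funM.
- by move=> x _; rewrite -EFinM -EFinD lee_fin expR_ge1Dx.
Qed.

Let M_lower (t : R) : 0 < t -> (1 <= ((Num.sqrt (1 + 2 * t))^-1)%:E + t%:E * M)%E.
Proof.
move=> t0.
have -> : (((Num.sqrt (1 + 2 * t))^-1)%:E + t%:E * M =
    \int[gauss]_x ((expR (- t * x ^+ 2))%:E + t%:E * (x ^+ 2)%:E))%E.
  rewrite ge0_integralD//=.
  - by rewrite MZ//; congr (_ + _)%E; rewrite gauss_exp_sqr ?mulrN ?opprK//; lra.
  - by apply/measurable_EFinP; apply: measurableT_comp => //; apply: measurable_funM.
  - by move=> x _; rewrite -EFinM lee_fin mulr_ge0 ?sqr_ge0// (ltW t0).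
  - by apply: measurable_funeM; apply/measurable_EFinP.
have {1}-> : (1 = \int[gauss]_x 1 :> \bar R)%E.
  by rewrite integral_cst// mul1e; apply/esym; exact: (@probability_setT _ _ _ gauss).
apply: ge0_le_integral => //.
- apply: emeasurable_funD; last by apply: measurable_funeM; apply/measurable_EFinP.
  by apply/measurable_EFinP; apply: measurableT_comp => //; apply: measurable_funM.
- move=> x _; rewrite -EFinM -EFinD lee_fin.
  by have := expR_ge1Dx (- t * x ^+ 2); rewrite mulNr; lra.
Qed.

(** The second moment comes from the known integral of exp(t x^2), through 1 + t x^2 <= exp(t x^2)
    with [t] of either sign, as [t] tends to 0. The remainders 4t^2 and 2t^2, divided by [t], are at
    most [e] for t <= e/4. *)
Lemma gauss_sqr : (\int[gauss]_x (x ^+ 2)%:E = 1 :> \bar R)%E.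
Proof.
rewrite -/M; have Mfin : M \is a fin_num.
  rewrite ge0_fin_numE//; have := @M_upper 4^-1; case: (M) M0 => [r _ _||//].
    by rewrite ltry.
  by move=> _; rewrite gt0_muley ?lte_fin// => /(_ ltac:(apply/andP; split; lra)).
have [m Mm] : exists m, M = m%:E by exists (fine M); rewrite fineK.
rewrite Mm; congr EFin; apply/eqP; rewrite eq_le; apply/andP; split.
  apply/ler_addgt0Pl => e e0; pose t := Num.min 4^-1 (e / 4).
  have t0 : 0 < t by rewrite lt_min; apply/andP; split; lra.
  have t4 : t <= 4^-1 by rewrite ge_min lexx.
  have te : t <= e / 4 by rewrite ge_min lexx orbT.
  have tt : 0 < t < 2^-1 by apply/andP; split; lra.
  have := M_upper tt; rewrite Mm -EFinM -EFinD lee_fin => H.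
  have : (Num.sqrt (1 - 2 * t))^-1 <= 1 + t + 4 * t ^+ 2.
    exact: invsqrt_taylor_le.
  by move=> /(le_trans H); clear -t0 te; nra.
apply/ler_addgt0Pl => e e0; pose t := Num.min 4^-1 (e / 4).
have t0 : 0 < t by rewrite lt_min; apply/andP; split; lra.
have t4 : t <= 4^-1 by rewrite ge_min lexx.
have te : t <= e / 4 by rewrite ge_min lexx orbT.
have := M_lower t0; rewrite Mm -EFinM -EFinD lee_fin => H.
have : (Num.sqrt (1 + 2 * t))^-1 <= 1 - t + 2 * t ^+ 2.
  exact: invsqrt_taylor_ge.
by move: H; clear -t0 te; nra.
Qed.

End GaussianSums.

Section NormalLaw.
Context {R : realType} d {Omega : measurableType d} (P : probability Omega R).

(** Stated with bounded test functions to match [noise_source]; a standard deviation 0 is allowed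
    and gives the Dirac mass at 0. *)
Definition centered_normal (Y : Omega -> R) (s : R) : Prop :=
  measurable_fun setT Y /\
  forall G : R -> R, bm G -> \int[P]_w G (Y w) = \int[gauss]_x G (s * x).

Lemma bm_indic (A : set R) : measurable A -> bm (\1_A : R -> R).
Proof.
move=> mA; split; first exact: measurable_indic.
by exists 1 => x; rewrite indicE; case: (_ \in _); rewrite ?normr1 ?normr0.
Qed.

Section Law.
Variables (Y : Omega -> R) (s : R).
Hypothesis (YN : centered_normal Y s).

Lemma centered_normal_prob (A : set R) : measurable A ->
  P (Y @^-1` A) = gauss ((fun x => s * x) @^-1` A).
Proof.
move=> mA; have [mY Yl] := YN.
have ms : measurable_fun setT (fun x : measurableTypeR R => s * x : measurableTypeR R).
  exact: mulrl_measurable.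
have mYA : measurable (Y @^-1` A) by rewrite -[_ @^-1` _]setTI; exact: mY.
have msA : measurable ((fun x => s * x) @^-1` A : set (measurableTypeR R)).
  by rewrite -[_ @^-1` _]setTI; exact: ms.
have := congr1 EFin (Yl _ (bm_indic mA)).
rewrite -(bint_EFin P (bm_comp mY (bm_indic mA))).
rewrite -(bint_EFin gauss (bm_comp ms (bm_indic mA))).
have e1 : (\int[P]_w (\1_A (Y w))%:E)%E = P (Y @^-1` A).
  by have := integral_indic P measurableT mYA; rewrite setIT.
have e2 : (\int[gauss]_x (\1_A (s * x)%R)%:E)%E = gauss ((fun x => s * x) @^-1` A).
  by have := integral_indic gauss (D := setT) measurableT msA; rewrite setIT.
by rewrite e1 e2.
Qed.

Lemma ge0_centered_normal (f : R -> \bar R) :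
  measurable_fun setT f -> (forall x, (0 <= f x)%E) ->
  (\int[P]_w f (Y w) = \int[gauss]_x f (s * x)%R)%E.
Proof.
move=> mf f0; have [mY _] := YN.
have ms : measurable_fun setT (fun x : measurableTypeR R => s * x : measurableTypeR R).
  exact: mulrl_measurable.
have mY' : measurable_fun setT (Y : Omega -> measurableTypeR R) by [].
rewrite -[LHS](@ge0_integral_pushforward _ _ Omega (measurableTypeR R) _ Y mY' P setT f
  measurableT mf (fun x _ => f0 x)).
rewrite -[RHS](@ge0_integral_pushforward _ _ (measurableTypeR R) (measurableTypeR R) _
  (fun x => s * x) ms gauss setT f measurableT mf (fun x _ => f0 x)).
apply: eq_measure_integral => A mA _; exact: centered_normal_prob.
Qed.

Lemma centered_normal_gaussian (A : set R) : 0 <= s -> measurable A ->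
  P (Y @^-1` A) = gaussian_law 0 s A.
Proof.
move=> s0 mA; rewrite centered_normal_prob// /gaussian_law; case: eqP => [->|/eqP sn].
  rewrite diracE; case: (pselect (A 0)) => A0.
    rewrite mem_set// (_ : _ @^-1` _ = setT); last first.
      by apply/seteqP; split => x //= _; rewrite mul0r.
    exact: (@probability_setT _ _ _ gauss).
  rewrite memNset// (_ : _ @^-1` _ = set0) ?measure0//.
  by apply/seteqP; split => x //=; rewrite mul0r.
have sp : 0 < s by rewrite lt_def sn.
have ms : measurable_fun setT (fun x : measurableTypeR R => s * x : measurableTypeR R).
  exact: mulrl_measurable.
have msA : measurable ((fun x => s * x) @^-1` A : set (measurableTypeR R)).
  by rewrite -[_ @^-1` _]setTI; exact: ms.
have mi : measurable_fun setT (EFin \o \1_A : R -> \bar R).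
  by apply/measurable_EFinP; exact: measurable_indic.
have i0 x : (0 <= (EFin \o \1_A : R -> \bar R) x)%E by rewrite lee_fin.
have := ge0_gauss_affine 0 sp mi i0.
have -> : (\int[normal_prob 0 s]_x (EFin \o \1_A) x)%E = normal_prob 0 s A.
  by have := integral_indic (normal_prob 0 s) measurableT mA; rewrite setIT.
move=> <-; have := integral_indic gauss (D := setT) measurableT msA.
rewrite setIT => <-; apply: eq_integral => x _ /=.
by rewrite addr0.
Qed.

Lemma centered_normal_sqr : (\int[P]_w (Y w ^+ 2)%:E = (s ^+ 2)%:E)%E.
Proof.
rewrite (ge0_centered_normal (f := fun x => (x ^+ 2)%:E)); last 2 first.
- by apply/measurable_EFinP; exact: measurable_funX.
- by move=> x; rewrite lee_fin sqr_ge0.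
under eq_integral do rewrite exprMn EFinM.
rewrite (@ge0_integralZl_EFin _ (measurableTypeR R) _ gauss setT).
- by rewrite gauss_sqr mule1.
- exact: measurableT.
- by move=> x _; rewrite lee_fin sqr_ge0.
- by apply/measurable_EFinP; exact: measurable_funX.
- exact: sqr_ge0.
Qed.

Lemma centered_normal_integrable_sqr :
  P.-integrable setT (EFin \o (fun w => Y w ^+ 2)).
Proof.
have [mY _] := YN; apply/integrableP; split.
  by apply/measurable_EFinP; exact: measurable_funX.
rewrite (_ : integral _ _ _ = (\int[P]_w (Y w ^+ 2)%:E)%E).
  by rewrite centered_normal_sqr ltry.
by apply: eq_integral => w _ /=; rewrite ger0_norm// sqr_ge0.
Qed.

Lemma centered_normal_integrable : P.-integrable setT (EFin \o Y).
Proof.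
have [mY _] := YN.
apply: (le_integrable measurableT (f := EFin \o Y) (g := EFin \o (fun w => 1 + Y w ^+ 2))) => //.
- exact/measurable_EFinP.
- move=> w _ /=; rewrite lee_fin [leRHS]ger0_norm ?addr_ge0 ?sqr_ge0//.
  by rewrite ler_norml; apply/andP; split; nra.
have i1 := finite_measure_integrable_cst P 1 (@measurableT _ Omega).
by have := integrableD measurableT i1 centered_normal_integrable_sqr.
Qed.

(** Positive and negative parts have the same integral by symmetry of [gauss], and it is finite
    because [Y] is integrable. *)
Lemma centered_normal_mean : (\int[P]_w (Y w)%:E = 0)%E.
Proof.
rewrite integralE.
have mM (c : R -> R) : measurable_fun setT c ->
    measurable_fun setT (fun x => (Num.max (c x) 0)%:E).
  by move=> mc; apply/measurable_EFinP; apply: measurable_maxr.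
have -> : (\int[P]_w ((fun w => (Y w)%:E)^\+ w) =
    \int[gauss]_x (Num.max (s * x) 0)%:E)%E.
  rewrite -(ge0_centered_normal (f := fun x => (Num.max x 0)%:E)).
  - by apply: eq_integral => w _; rewrite funeposE EFin_max.
  - by apply: (mM idfun); exact: measurable_id.
  - by move=> x; rewrite lee_fin le_max lexx orbT.
have -> : (\int[P]_w ((fun w => (Y w)%:E)^\- w) =
    \int[gauss]_x (Num.max (s * x) 0)%:E)%E.
  rewrite -(ge0_gaussN (f := fun x => (Num.max (s * x) 0)%:E)).
  - rewrite (_ : (fun x => _) = (fun x => (Num.max (- (s * x)) 0)%:E)); last first.
      by apply/funext => x; rewrite mulrN.
    rewrite -(ge0_centered_normal (f := fun x => (Num.max (- x) 0)%:E)).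
    + by apply: eq_integral => w _; rewrite funenegE EFin_max.
    + by apply: (mM -%R); exact: oppr_measurable.
    + by move=> x; rewrite lee_fin le_max lexx orbT.
  - by apply: mM; exact: mulrl_measurable.
  - by move=> x; rewrite lee_fin le_max lexx orbT.
set I := integral _ _ _; suff : I \is a fin_num by move=> If; rewrite subee.
rewrite /I -(ge0_centered_normal (f := fun x => (Num.max x 0)%:E)).
- apply: integrable_fin_num => //.
  rewrite (_ : (fun w => _) = (fun w => (Y w)%:E)^\+)%E.
    exact: (integrable_funepos measurableT centered_normal_integrable).
  by apply/funext => w; rewrite funeposE EFin_max.
- by apply: (mM idfun); exact: measurable_id.
- by move=> x; rewrite lee_fin le_max lexx orbT.
Qed.

End Law.
End NormalLaw.

(** * Moving averages *)

Section LinearForms.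
Context {R : realType} d {Omega : measurableType d} (P : probability Omega R).
Variables (xi : nat -> Omega -> R) (shift : Omega -> Omega).
Hypothesis src : noise_source P xi shift.

Definition lform (c : nat -> R) n w := \sum_(k < n) c k * xi k w.

Lemma measurable_lform c n : measurable_fun setT (lform c n).
Proof.
have [mxi _ _] := src; rewrite /lform; apply: measurable_sum => k.
exact: measurable_funM.
Qed.

Lemma lform_recl c n w :
  lform c n.+1 w = c 0%N * xi 0 w + lform (fun k => c k.+1) n (shift w).
Proof.
have [_ xiS _] := src; rewrite /lform big_ord_recl; congr (_ + _).
by apply: eq_bigr => k _; rewrite -xiS.
Qed.

(** Induction on [n] by drawing the first noise variable; the offset [z] is there to absorb its
    contribution. *)
Lemma lform_law c n (z : R) (G : R -> R) : bm G ->
  \int[P]_w G (lform c n w + z) =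
  \int[gauss]_x G (Num.sqrt (\sum_(k < n) c k ^+ 2) * x + z).
Proof.
elim: n c z => [|n IH] c z bG.
  rewrite big_ord0 sqrtr0.
  transitivity (G z).
    rewrite -[RHS](bint_cst P); apply: eq_Rintegral => w _.
    by rewrite /lform big_ord0 add0r.
  rewrite -[LHS](bint_cst gauss); apply: eq_Rintegral => x _.
  by rewrite mul0r add0r.
pose f (p : R * Omega) := G (lform (fun k => c k.+1) n p.2 + (c 0%N * p.1 + z)).
have bf : bm f.
  apply: (bm_comp _ bG); apply: measurable_funD.
    exact: (measurableT_comp (measurable_lform _ _) measurable_snd).
  apply: measurable_funD => //; apply: measurable_funM => //.
have [_ _ /(_ _ bf) srcf] := src.
transitivity (\int[P]_w f (xi 0 w, shift w)).
  by apply: eq_Rintegral => w _; rewrite /f lform_recl; congr G => /=; ring.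
rewrite srcf.
pose s := Num.sqrt (\sum_(k < n) c k.+1 ^+ 2).
have bGz : bm (fun x : R => G (x + z)).
  by apply: (bm_comp _ bG); apply: measurable_funD.
transitivity (\int[gauss]_y \int[gauss]_x G ((s * x + c 0%N * y) + z)).
  apply: eq_Rintegral => y _; rewrite /f /= IH//.
  by apply: eq_Rintegral => x _; rewrite addrA.
rewrite (gauss_add _ (sqrtr_ge0 _) bGz) big_ord_recl sqr_sqrtr.
  by rewrite [c 0%N ^+ 2 + _]addrC.
by apply: sumr_ge0 => k _; exact: sqr_ge0.
Qed.

Lemma lform_normal c n :
  centered_normal P (lform c n) (Num.sqrt (\sum_(k < n) c k ^+ 2)).
Proof.
split; first exact: measurable_lform.
move=> G bG; transitivity (\int[P]_w G (lform c n w + 0)).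
  by apply: eq_Rintegral => w _; rewrite addr0.
by rewrite lform_law//; apply: eq_Rintegral => x _; rewrite addr0.
Qed.

Definition in_span n (Y : Omega -> R) := exists c, forall w, Y w = lform c n w.

Lemma in_spanD n Y Y' : in_span n Y -> in_span n Y' -> in_span n (fun w => Y w + Y' w).
Proof.
move=> [c Yc] [c' Yc']; exists (fun k => c k + c' k) => w.
by rewrite Yc Yc' /lform -big_split; apply: eq_bigr => k _; rewrite mulrDl.
Qed.

Lemma in_spanZ n Y a : in_span n Y -> in_span n (fun w => a * Y w).
Proof.
move=> [c Yc]; exists (fun k => a * c k) => w.
by rewrite Yc /lform mulr_sumr; apply: eq_bigr => k _; rewrite mulrA.
Qed.

Lemma in_span0 n : in_span n (fun=> 0).
Proof. by exists (fun=> 0) => w; rewrite /lform big1// => k _; rewrite mul0r. Qed.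

Lemma in_span_sum n m (Y : 'I_m -> Omega -> R) : (forall i, in_span n (Y i)) ->
  in_span n (fun w => \sum_(i < m) Y i w).
Proof.
elim: m Y => [|m IH] Y sY.
  by have [c H] := in_span0 n; exists c => w; rewrite big_ord0.
have [c H] := in_spanD (sY ord0) (IH (fun i => Y (lift ord0 i)) (fun i => sY _)).
by exists c => w; rewrite -H big_ord_recl.
Qed.

Let delta (k j : nat) : R := (j == k)%:R.

Lemma lform_delta n k w : (k < n)%N -> lform (delta k) n w = xi k w.
Proof.
move=> kn; rewrite /lform (bigD1 (Ordinal kn))//= /delta eqxx mul1r big1 ?addr0//.
move=> j jk; rewrite (_ : (_ == _) = false) ?mul0r//; apply/negbTE.
by apply: contra jk => /eqP jk; apply/eqP/val_inj.
Qed.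

Lemma in_span_xi n k : (k < n)%N -> in_span n (xi k).
Proof. by move=> kn; exists (delta k) => w; rewrite lform_delta. Qed.

Lemma in_span_normal n Y : in_span n Y -> exists2 s, 0 <= s & centered_normal P Y s.
Proof.
move=> [c Yc]; exists (Num.sqrt (\sum_(k < n) c k ^+ 2)); first exact: sqrtr_ge0.
by rewrite (_ : Y = lform c n); [exact: lform_normal|apply/funext => w].
Qed.

Lemma noise_normal k : centered_normal P (xi k) 1.
Proof.
have := lform_normal (delta k) k.+1.
rewrite (_ : lform _ _ = xi k); last by apply/funext => w; rewrite lform_delta.
rewrite big_ord_recr big1 /=; last first.
  by move=> j _; rewrite /delta ltn_eqF// expr0n.
by rewrite /delta eqxx expr1n add0r sqrtr1.
Qed.

(** For polarization: sum and difference have the same normal law, so the product, a quarter of the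
    difference of their squares, is integrable with mean 0. *)
Lemma noise_pair_normal k l : k != l -> exists s,
  centered_normal P (fun w => xi k w + xi l w) s /\
  centered_normal P (fun w => xi k w - xi l w) s.
Proof.
move=> kl; set n := (k + l).+1.
have kn : (k < n)%N by rewrite ltnS leq_addr.
have ln : (l < n)%N by rewrite ltnS leq_addl.
pose c (e : R) j := delta k j + e * delta l j.
exists (Num.sqrt (\sum_(j < n) c 1 j ^+ 2)).
have cE e w : lform (c e) n w = xi k w + e * xi l w.
  rewrite -(lform_delta w kn) -(lform_delta w ln) /lform mulr_sumr -big_split.
  by apply: eq_bigr => j _; rewrite /= mulrDl mulrA.
split.
  rewrite (_ : (fun w => _) = lform (c 1) n); first exact: lform_normal.
  by apply/funext => w; rewrite cE mul1r.
have -> : \sum_(j < n) c 1 j ^+ 2 = \sum_(j < n) c (-1) j ^+ 2.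
  apply: eq_bigr => j _; rewrite /c /delta.
  by case: (eqVneq (j : nat) k) => [->|_]; rewrite ?(negbTE kl) /=; ring.
rewrite (_ : (fun w => _) = lform (c (-1)) n); first exact: lform_normal.
by apply/funext => w; rewrite cE mulN1r.
Qed.

Lemma noise_prod_integrable k l : P.-integrable setT (EFin \o (fun w => xi k w * xi l w)).
Proof.
have [->|kl] := eqVneq k l.
  exact: (centered_normal_integrable_sqr (noise_normal l)).
have [s [N1 N2]] := noise_pair_normal kl.
have := integrableZl measurableT 4^-1 (integrableB measurableT
  (centered_normal_integrable_sqr N1) (centered_normal_integrable_sqr N2)).
apply: eq_integrable => // w _ /=.
by congr EFin; field.
Qed.

Lemma noise_cov k l : \int[P]_w (xi k w * xi l w) = (k == l)%:R.
Proof.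
rewrite /Rintegral; have [->|kl] := eqVneq k l.
  by rewrite (centered_normal_sqr (noise_normal l)) expr1n.
have [s [N1 N2]] := noise_pair_normal kl.
have := @RintegralB _ _ _ P setT _ _ measurableT
  (centered_normal_integrable_sqr N1) (centered_normal_integrable_sqr N2).
rewrite /Rintegral (centered_normal_sqr N1) (centered_normal_sqr N2) subrr.
rewrite -[in X in X -> _]/(Rintegral _ _ _) (_ : (fun _ => _) = (fun w => 4 * (xi k w * xi l w))).
  rewrite RintegralZl//; last exact: noise_prod_integrable.
  by move=> /eqP; rewrite mulf_eq0 pnatr_eq0 /= => /eqP.
by apply/funext => w; ring.
Qed.

Lemma noise_prod_sum a b a' b' p q p' q' :
  (\int[P]_w ((a * xi p w + b * xi q w) * (a' * xi p' w + b' * xi q' w))%:E =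
   (a * a' * (p == p')%:R + a * b' * (p == q')%:R +
    (b * a' * (q == p')%:R + b * b' * (q == q')%:R))%:E)%E.
Proof.
pose m k l w := xi k w * xi l w.
have im c k l : P.-integrable setT (EFin \o (fun w => c * m k l w)).
  exact: (integrableZl measurableT c (noise_prod_integrable k l)).
have iD (F G : Omega -> R) : P.-integrable setT (EFin \o F) ->
    P.-integrable setT (EFin \o G) -> P.-integrable setT (EFin \o (fun w => F w + G w)).
  exact: integrableD.
have mE c k l : \int[P]_w (c * m k l w) = c * (k == l)%:R.
  by rewrite RintegralZl ?noise_cov//; exact: noise_prod_integrable.
transitivity (\int[P]_w ((a * a' * m p p' w + a * b' * m p q' w) +
    (b * a' * m q p' w + b * b' * m q q' w))%:E)%E.
  by apply: eq_integral => w _; congr EFin; rewrite /m; ring.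
rewrite -[LHS]fineK; last by apply: integrable_fin_num => //; apply: (iD); apply: iD.
congr EFin; rewrite -/(Rintegral _ _ _) RintegralD//; [|exact: iD|exact: iD].
by rewrite !RintegralD// !mE.
Qed.

(** The even terms carry the nonnegative times, the only ones that the inputs of the channels
    involve; the process itself, indexed by all integers, also needs the odd terms. *)
Lemma noise_source_double : measurable_fun setT shift ->
  noise_source P (fun k => xi k.*2) (shift \o shift).
Proof.
move=> mshift; have [mxi xiS srcf] := src.
split => [n|n w|f bf] //=; first by rewrite doubleS !xiS.
pose g (p : R * Omega) := f (p.1, shift p.2).
have bg : bm g.
  apply: (bm_comp _ bf); apply: measurable_fun_pair => //=.
  exact: (measurableT_comp mshift measurable_snd).
transitivity (\int[P]_w g (xi 0 w, shift w)) => //.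
rewrite (srcf g bg); apply: eq_Rintegral => y _.
have by' : bm (fun w => f (y, w)) by exact: bm_pair1.
rewrite [LHS](srcf (fun p => f (y, p.2))); last exact: (bm_comp measurable_snd by').
by rewrite /= (bint_cst gauss).
Qed.

(* Two-sided noise is stored in the even and odd terms of one-sided noise. *)
Definition int_code (j : int) : nat :=
  match j with Posz k => k.*2 | Negz k => k.*2.+1 end.

Lemma int_code_inj : injective int_code.
Proof.
by case=> i [] j /=; [|lia|lia|] => ij; congr (_ _); lia.
Qed.

Section MovingAverage.
Variables (h : nat) (a b : R).

(* The offset h - 1 makes X_1, X_2, ... start with the noise at times 0, 1, ... *)
Definition ma_index (t : int) := int_code (t + h%:Z - 1).
Definition ma_lag (t : int) := int_code (t - 1).
Definition ma_fun (t : int) (w : Omega) : R :=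
  a * xi (ma_index t) w + b * xi (ma_lag t) w.

Lemma measurable_ma_fun t : measurable_fun setT (ma_fun t).
Proof.
by have [mxi _ _] := src; apply: measurable_funD; apply: measurable_funM.
Qed.

Definition moving_average (t : int) : {RV P >-> R} :=
  HB.pack (ma_fun t) (isMeasurableFun.Build _ _ _ _ (ma_fun t) (measurable_ma_fun t)).

Lemma in_span_ma n t : (ma_index t < n)%N -> (ma_lag t < n)%N -> in_span n (ma_fun t).
Proof.
move=> tn tn'; apply: in_spanD; apply: in_spanZ; exact: in_span_xi.
Qed.

Lemma moving_average_gaussian : gaussian_process moving_average.
Proof.
move=> m t c; pose n := (\max_(i < m) maxn (ma_index (t i)) (ma_lag (t i))).+1.
have tn i : (maxn (ma_index (t i)) (ma_lag (t i)) < n)%N.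
  by rewrite ltnS (leq_bigmax_cond (F := fun i => maxn (ma_index (t i)) (ma_lag (t i)))).
have /in_span_normal[s s0 sN] : in_span n (fun w => \sum_(i < m) c i * ma_fun (t i) w).
  apply: in_span_sum => i; apply: in_spanZ.
  by have := tn i; rewrite gtn_max => /andP[t1 t2]; exact: in_span_ma.
by exists 0, s => A mA; rewrite -(centered_normal_gaussian sN).
Qed.

Lemma moving_average_mean t : ('E_P[moving_average t] = 0)%E.
Proof.
pose n := (maxn (ma_index t) (ma_lag t)).+1.
have /in_span_normal[s s0 sN] : in_span n (ma_fun t).
  by apply: in_span_ma; rewrite ltnS ?leq_maxl ?leq_maxr.
by rewrite expectation_def (centered_normal_mean sN).
Qed.

Lemma moving_average_cov t u :
  covariance P (moving_average t) (moving_average u) =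
  ((a ^+ 2 + b ^+ 2) * (t == u)%:R +
   a * b * ((t + h%:Z == u)%:R + (u + h%:Z == t)%:R))%:E.
Proof.
rewrite unlock !moving_average_mean unlock.
transitivity (\int[P]_w (ma_fun t w * ma_fun u w)%:E)%E.
  apply: eq_integral => w _; congr EFin.
  by rewrite -[LHS]/((ma_fun t w - 0) * (ma_fun u w - 0)) !subr0.
rewrite /ma_fun noise_prod_sum /ma_index /ma_lag !(inj_eq int_code_inj); congr EFin.
rewrite !(inj_eq (addIr _)) [t == u + _]eq_sym; ring.
Qed.

Lemma moving_average_spectral f : (forall k, acov f k =
    (a ^+ 2 + b ^+ 2) * (k == 0)%:R + a * b * ((k == h%:Z)%:R + (k == - h%:Z)%:R)) ->
  has_spectral_density f moving_average.
Proof.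
move=> fE; split.
- exact: moving_average_gaussian.
- exact: moving_average_mean.
- move=> t k; rewrite !moving_average_cov; congr (_ * (_ : bool)%:R + _ * ((_ : bool)%:R + (_ : bool)%:R))%:E; lia.
- move=> k; rewrite moving_average_cov fE; congr (_ * (_ : bool)%:R + _ * ((_ : bool)%:R + (_ : bool)%:R))%:E; lia.
Qed.

End MovingAverage.
End LinearForms.

(** * The cosine density *)

Section CosineDensity.
Context {R : realType}.

Local Notation mu := (@lebesgue_measure R).
Local Notation circle := (`[- pi, pi]%classic : set R).

Let measurable_circle : measurable (circle : set (measurableTypeR R)).
Proof. exact: measurable_itv. Qed.

Lemma sin_int_pi (m : int) : sin (m%:~R * pi) = 0 :> R.
Proof.
have nat_pi (n : nat) : sin (n%:R * pi) = 0 :> R.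
  by have := alternatingn (@sinDpi R) n 0; rewrite add0r sin0 mulr0 mulr_natl.
by case: m => n; rewrite ?NegzE ?mulrNz ?mulNr ?sinN nat_pi ?oppr0.
Qed.

Let cont_cos (c : R) : continuous (fun x => cos (c * x)).
Proof.
move=> x; apply: continuous_comp; last exact: continuous_cos.
exact: mulrl_continuous.
Qed.

Let int_cont (f : R -> R) : continuous f -> mu.-integrable circle (EFin \o f).
Proof.
move=> cf; apply: continuous_compact_integrable; first exact: segment_compact.
exact: continuous_subspaceT.
Qed.

Let int_cos c : mu.-integrable circle (EFin \o (fun x => cos (c * x))).
Proof. exact/int_cont. Qed.

Lemma Rintegral_cos_int (m : int) :
  \int[mu]_(x in circle) cos (m%:~R * x) = 2 * pi * (m == 0)%:R.
Proof.
have pp : - pi < pi :> R by have := pi_gt0 R; lra.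
have [->|m0] := eqVneq m 0.
  under eq_Rintegral do rewrite mul0r cos0.
  rewrite Rintegral_cst// [X in fine X](_ : _ = (2 * pi)%:E) /= ?mul1r ?mulr1//.
  rewrite (lebesgue_measure_itv `[- pi, pi]) /= lte_fin pp -EFinB opprK.
  by rewrite mulr_natl mulr2n.
have c0 : m%:~R != 0 :> R by rewrite intr_eq0.
rewrite mulr0 /Rintegral.
rewrite (@continuous_FTC2 R _ (fun x => (m%:~R)^-1 * sin (m%:~R * x)) _ _ pp).
- by rewrite mulrN sinN sin_int_pi oppr0 mulr0 subee.
- exact: continuous_subspaceT.
- have dF x : derivable (fun x : R => (m%:~R)^-1 * sin (m%:~R * x)) x 1 by [].
  have cF : continuous (fun x : R => (m%:~R)^-1 * sin (m%:~R * x)).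
    by move=> x; apply/differentiable_continuous/derivable1_diffP/dF.
  split => //.
  + exact: cvg_at_right_filter (cF _).
  + exact: cvg_at_left_filter (cF _).
- move=> x _; rewrite derive1E derive_val.
  rewrite /GRing.scale /=; field.
  exact: c0.
Qed.

Definition cosine_density (h : nat) (d x : R) : R :=
  (1 + 2 * d * cos (h%:R * x)) / (2 * pi).

Section Density.
Variables (h : nat) (d : R).
Hypotheses (h0 : (0 < h)%N) (d2 : `|d| <= 2^-1).

Lemma cosine_density_spectral : spectral_density (cosine_density h d).
Proof.
have pp := pi_gt0 R.
split => [x _|x _|].
- rewrite /cosine_density divr_ge0//; last by rewrite mulr_ge0// ltW.
  have c1 := cos_geN1 (h%:R * x); have c2 := cos_le1 (h%:R * x).
  by move: d2; rewrite ler_norml => /andP[d3 d4]; nra.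
- by rewrite /cosine_density mulrN cosN.
- apply: int_cont => x; apply: cvgMl.
  apply: cvgD; first exact: cvg_cst.
  by apply: cvgMr; exact: cont_cos.
Qed.

Lemma acov_cosine_density (k : int) : acov (cosine_density h d) k =
  (k == 0)%:R + d * ((k == h%:Z)%:R + (k == - h%:Z)%:R).
Proof.
rewrite /acov /=; have pp := pi_gt0 R.
pose J (m : int) x : R := cos (m%:~R * x).
have iJ c m : mu.-integrable circle (EFin \o (fun x => c * J m x)).
  exact: (integrableZl measurable_circle c (int_cos m%:~R)).
have iD (F G : R -> R) : mu.-integrable circle (EFin \o F) ->
    mu.-integrable circle (EFin \o G) ->
    mu.-integrable circle (EFin \o (fun x => F x + G x)).
  exact: (integrableD measurable_circle).
transitivity (\int[mu]_(x in circle) ((2 * pi)^-1 * J k x +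
    ((2 * pi)^-1 * d * J (k + h%:Z) x + (2 * pi)^-1 * d * J (k - h%:Z) x))).
  apply: eq_Rintegral => x _.
  rewrite /J /cosine_density rmorphD rmorphB /= !mulrDl mulNr cosB cosD.
  by rewrite -pmulrn; ring.
rewrite RintegralD//; [|exact: iD].
have JE c m : \int[mu]_(x in circle) (c * J m x) = c * (2 * pi * (m == 0)%:R).
  rewrite -Rintegral_cos_int RintegralZl//; exact: (int_cos m%:~R).
rewrite RintegralD// !JE.
rewrite addr_eq0 subr_eq0 [_ + (k == - _)%:R]addrC.
move: pp; move: (pi : R) => p pp; field.
by rewrite gt_eqF.
Qed.

(** The variance is 1, so the first constraint is C0 >= 1; in the sum only the lags h and -h
    contribute, each h^(2s) d^2. *)
Lemma cosine_density_class (C0 C1 s : R) : 1 <= C0 ->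
  2 * (h%:R `^ (2 * s) * d ^+ 2) <= C1 ^+ 2 ->
  density_class C0 C1 s (cosine_density h d).
Proof.
move=> C01 hC1; have hz : (h%:Z == 0) = false by lia.
have hz' : (0 == h%:Z) = false by lia.
have hz2 : (0 == - h%:Z) = false by lia.
have a0 : acov (cosine_density h d) 0 = 1.
  by rewrite acov_cosine_density eqxx hz' hz2 addr0 mulr0 addr0.
split; first exact: cosine_density_spectral.
  by rewrite a0 C01 andbT invf_le1// (lt_le_trans _ C01).
have aE k : acor (cosine_density h d) k = acov (cosine_density h d) k.
  by rewrite /acor a0 divr1.
set a := fun k : int => (_ * _)%:E.
have a_ge0 k : (0 <= a k)%E by rewrite lee_fin mulr_ge0// ?powR_ge0// sqr_ge0.
have aout k : k != 0 -> k != h%:Z -> k != - h%:Z -> a k = 0%E.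
  move=> k0 k1 k2; rewrite /a aE acov_cosine_density (negbTE k0) (negbTE k1) (negbTE k2).
  by rewrite addr0 mulr0 addr0 normr0 expr0n mulr0.
have ah : a h%:Z = (h%:R `^ (2 * s) * d ^+ 2)%:E.
  rewrite /a aE acov_cosine_density hz eqxx (_ : (h%:Z == - _) = false) ?addr0 ?mulr1 ?add0r; last by lia.
  by rewrite real_normK ?num_real.
have aNh : a (- h%:Z) = (h%:R `^ (2 * s) * d ^+ 2)%:E.
  rewrite /a aE acov_cosine_density oppr_eq0 hz eqxx (_ : (- h%:Z == h%:Z) = false) ?add0r ?mulr1; last by lia.
  by rewrite real_normK ?num_real// normrN.
pose D := [set k : int | k != 0].
have e1 : D `&` [set h%:Z] = [set h%:Z].
  apply/seteqP; split => k /=; first by case.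
  by move=> ->; split => //; rewrite /D /=; lia.
have e2 : D `&` ~` [set h%:Z] `&` [set - h%:Z] = [set - h%:Z].
  apply/seteqP; split => k /=; first by case.
  by move=> ->; split => //; split; rewrite /D /=; [lia|lia].
rewrite -/D (esumID [set h%:Z] D)// e1.
rewrite (esumID [set - h%:Z] (D `&` ~` [set h%:Z]))// e2.
rewrite [X in (_ + (_ + X))%E]esum1; last first.
  by move=> k [[/= k0 /eqP k1] /eqP k2]; exact: aout.
rewrite !esum_set1// -[X in (X + _)%E]/(a h%:Z) -[X in (_ + (X + _))%E]/(a (- h%:Z)).
rewrite ah aNh adde0 -EFinD lee_fin (le_trans _ hC1)//.
by rewrite [leRHS]mulr_natl mulr2n.
Qed.

End Density.
End CosineDensity.

(** * The two-point bound *)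

(** The integral of a nonnegative function is a supremum over simple functions below it, hence
    monotone in general. This spares a proof that the inner integral of the risk is measurable. *)
Lemma ge0_le_integral_nonmeasurable (R : realType) d (T : measurableType d)
    (m : {measure set T -> \bar R}) (f g : T -> \bar R) :
  (forall x, 0 <= f x)%E -> (forall x, f x <= g x)%E ->
  (\int[m]_x f x <= \int[m]_x g x)%E.
Proof.
move=> f0 fg; have g0 x : (0 <= g x)%E by exact: le_trans (fg x).
rewrite !ge0_integralTE//; apply: le_ereal_sup => _ [k /= kf <-]; exists k => //= x.
exact: le_trans (kf x) (fg x).
Qed.

(** The two errors 1 - p0 and p1 add up to at least 3/4, so one of them is at least 3/8. *)
Lemma two_point_average (R : realFieldType) (q p0 p1 : R) :
  0 <= q -> `|p1 - p0| <= 4^-1 ->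
  q * (3 / 32) <= q / 4 * (1 - p0) \/ q * (3 / 32) <= q / 4 * p1.
Proof.
move=> q0; rewrite ler_norml => /andP[p01 _].
have H p : 3 / 8 <= p -> q * (3 / 32) <= q / 4 * p.
  by move=> p8; rewrite -mulrA ler_wpM2l//; lra.
have [p08|p08] := leP (3 / 8) (1 - p0); [left|right]; apply: H => //; lra.
Qed.

Section TwoPoints.
Context {R : realType} {alpha : R}.
Variables (Ks : seq (channel alpha)) (g : outs Ks -> R).
Hypothesis mg : measurable_fun setT g.

Lemma process_risk_ge (f : R -> R) (k : int) d (Omega : measurableType d)
    (P : probability Omega R) (X : int -> {RV P >-> R}) (eps : R) (u : outs Ks -> R) :
  0 <= eps -> bm u -> (forall z, 0 <= u z) ->
  (forall z, eps * u z <= `|g z - acov f k| ^+ 2) ->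
  ((eps * \int[P]_w oint (fun i => X i.+1%:Z w) u)%:E <= process_risk g f k X)%E.
Proof.
move=> e0 bu u0 ug.
have boi : bm (fun w => oint (fun i => X i.+1%:Z w) u).
  apply: (bm_oint (x := fun w i => X i.+1%:Z w) (u := fun q => u q.2)) => //.
  exact: (bm_comp measurable_snd bu).
rewrite -(bintZ P eps boi) -(bint_EFin P (bmM (bm_cst eps) boi)).
apply: ge0_le_integral_nonmeasurable => w.
  by rewrite lee_fin mulr_ge0//; apply: Rintegral_ge0.
rewrite /oint -(bintZ _ eps bu) -(bint_EFin _ (bmM (bm_cst eps) bu)).
apply: ge0_le_integral_nonmeasurable => z; rewrite lee_fin ?ug//.
exact: mulr_ge0.
Qed.

Local Notation P := (@coin_prob R).
Local Notation xi := (@noise R).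
Let xi2 (k : nat) := xi k.*2.

Let src : noise_source P xi odd_bits := coin_noise.

Let src2 : noise_source P xi2 (odd_bits \o odd_bits).
Proof. exact: (noise_source_double src measurable_odd_bits). Qed.

Variables (h : nat) (a b : R).
Hypothesis h0 : (0 < h)%N.

(** Time i + 1 reads the noises coded 2(i + h) and 2i, which are terms i + h and i of [xi2]. No
    value is prescribed, so [e] is arbitrary. White noise is the case [r = 0] and the full moving
    average the case [r = h]. *)
Lemma moving_average_hyb (a' b' : R) r (e : nat -> R) (u : outs Ks -> R) :
  (forall t, coef1 h a r t = a') -> (forall t, coef2 h b r t = b') ->
  \int[P]_w oint (fun i => moving_average src h a' b' i.+1%:Z w) u =
  hyb P xi2 h a b r 0 e 0 u.
Proof.
move=> ar br; apply: eq_Rintegral => w _; congr oint; apply/funext => i.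
rewrite /input /fill /= ar br !subn0 !add0n.
rewrite -[LHS]/(a' * xi (ma_index h i.+1%:Z) w + b' * xi (ma_lag i.+1%:Z) w).
rewrite /xi2 /ma_index /ma_lag.
have -> : i.+1%:Z + h%:Z - 1 = (i + h)%N by lia.
by have -> : i.+1%:Z - 1 = i by lia.
Qed.

Variables (D c : R) (Phi : (R -> R) -> R -> Prop).
Hypothesis pot : potential (alpha := alpha) a b D c Phi.
Hypotheses (D1 : 1 <= D) (c1 : 1 <= c) (ab1 : a ^+ 2 + b ^+ 2 = 1).
Hypothesis small : c * D ^+ size Ks - 1 <= ((4 * h%:R)^-1) ^+ 2.

Lemma hyb_total_dist (u : outs Ks -> R) : bm u -> (forall z, 0 <= u z <= 1) ->
  `|hyb P xi2 h a b h 0 (fun=> 0) 0 u - hyb P xi2 h a b 0 0 (fun=> 0) 0 u| <= 4^-1.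
Proof.
move=> bu u01; pose E r := hyb P xi2 h a b r 0 (fun=> 0) 0 u.
have hp : 0 < h%:R :> R by rewrite ltr0n.
have step r : (r < h)%N -> `|E r.+1 - E r| <= (4 * h%:R)^-1.
  move=> rh; have p4 : 0 <= (4 * h%:R)^-1 :> R by rewrite invr_ge0 mulr_ge0// ltW.
  rewrite -(@ler_pXn2r _ 2) ?nnegrE// real_normK ?num_real//.
  apply: le_trans small.
  exact: (hybrid_dist src2 h0 pot D1 rh (fun=> 0) bu c1 u01).
suff H r : (r <= h)%N -> `|E r - E 0%N| <= r%:R * (4 * h%:R)^-1.
  apply: le_trans (H h (leqnn h)) _.
  by rewrite invfM mulrCA divff ?mulr1// gt_eqF.
elim: r => [|r IH] rh; first by rewrite subrr normr0 mul0r.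
rewrite -(subrKA (E r)) -natr1 mulrDl mul1r addrC.
by apply: le_trans (ler_normD _ _) _; apply: lerD; [exact/IH/ltnW|exact: step].
Qed.

Variables (C0 C1 s : R).
Hypothesis class0 : density_class C0 C1 s (cosine_density h 0).
Hypothesis class1 : density_class C0 C1 s (cosine_density h (a * b)).

Lemma max_risk_ge_process a' b' : a' ^+ 2 + b' ^+ 2 = 1 ->
  density_class C0 C1 s (cosine_density h (a' * b')) ->
  (process_risk g (cosine_density h (a' * b')) h%:Z (moving_average src h a' b') <=
   max_risk C0 C1 s g h%:Z)%E.
Proof.
move=> ab1' cl; apply: (@le_trans _ _ (risk g (cosine_density h (a' * b')) h%:Z)).
  apply: ereal_sup_ubound; exists _, coin, P, (moving_average src h a' b').
  split => //; apply: moving_average_spectral => k.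
  by rewrite acov_cosine_density ab1' mul1r.
by apply: ereal_sup_ubound; exists (cosine_density h (a' * b')).
Qed.

Lemma two_point_risk : (((a * b) ^+ 2 * (3 / 32))%:E <= max_risk C0 C1 s g h%:Z)%E.
Proof.
(* The test is whether the estimate is closer to 0 than |ab|/2: if so, it errs by at least |ab|/2
   under the moving average, and otherwise under white noise. *)
pose dl := a * b; pose A := [set z | `|g z| < `|dl| / 2].
have mA : measurable A.
  rewrite -[A]setTI (_ : A = g @^-1` [set x | `|x| < `|dl| / 2])//.
  apply: mg => //; rewrite (_ : [set x | _] = ball (0 : R) (`|dl| / 2)).
    exact: measurable_ball.
  by apply/seteqP; split => x /=; rewrite -ball_normE /= sub0r normrN.
pose u : outs Ks -> R := \1_A.
have bu : bm u.
  split; first exact: measurable_indic.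
  by exists 1 => z; rewrite /u indicE; case: (_ \in _); rewrite ?normr1 ?normr0.
have u01 z : 0 <= u z <= 1 by rewrite /u indicE; case: (_ \in _); rewrite ?lexx ?ler01.
have bu' : bm (fun z => 1 - u z) by apply: bmB => //; exact: bm_cst.
have hz : (h%:Z == 0) = false by lia.
have hz2 : (h%:Z == - h%:Z) = false by lia.
pose e := (`|dl| / 2) ^+ 2.
have e0 : 0 <= e by exact: sqr_ge0.
have ug0 z : e * (1 - u z) <= `|g z - acov (cosine_density h (1 * 0)) h%:Z| ^+ 2.
  rewrite acov_cosine_density hz eqxx hz2 mulr0 mul0r addr0 subr0 /u indicE.
  have [zA|zA] := boolP (z \in A).
    by rewrite subrr mulr0 sqr_ge0.
  rewrite subr0 mulr1 /e lerXn2r ?nnegrE ?divr_ge0//.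
  by rewrite leNgt; apply/negP => H; move/negP: zA; apply; rewrite inE.
have ug1 z : e * u z <= `|g z - acov (cosine_density h dl) h%:Z| ^+ 2.
  rewrite acov_cosine_density hz eqxx hz2 addr0 mulr1 add0r /u indicE.
  have [|zA] := boolP (z \in A); last by rewrite mulr0 sqr_ge0.
  rewrite inE /A /= => zA; rewrite mulr1 /e lerXn2r ?nnegrE ?divr_ge0//.
  have := ler_normD (dl - g z) (g z); rewrite subrK [`|dl - g z|]distrC; lra.
have R0 := process_risk_ge (moving_average src h 1 0) e0 bu'
  (fun z => ltac:(by rewrite subr_ge0; case/andP: (u01 z))) ug0.
have R1 := process_risk_ge (moving_average src h a b) e0 bu
  (fun z => ltac:(by case/andP: (u01 z))) ug1.
have cl0 : density_class C0 C1 s (cosine_density h (1 * 0)).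
  exact: (eq_ind_r (fun d => density_class C0 C1 s (cosine_density h d)) class0 (mulr0 1)).
have n10 : 1 ^+ 2 + 0 ^+ 2 = 1 :> R by ring.
have M0 := le_trans R0 (max_risk_ge_process n10 cl0).
have M1 := le_trans R1 (max_risk_ge_process ab1 class1).
pose E r (v : outs Ks -> R) := hyb P xi2 h a b r 0 (fun=> 0) 0 v.
have dist : `|E h u - E 0%N u| <= 4^-1 by exact: hyb_total_dist.
have E0 : E 0%N (fun z => 1 - u z) = 1 - E 0%N u.
  apply/eqP; rewrite eq_sym subr_eq eq_sym; apply/eqP.
  rewrite /E /hyb -(cond_expD src2)// -[RHS](cond_exp_cst P xi2 h (coef1 h a 0) (coef2 h b 0) Ks 0 (fun=> 0) 0).
  by congr cond_exp; apply/funext => z; rewrite subrK.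
move: M0; rewrite (moving_average_hyb (r := 0%N) (fun=> 0)) // -/(E 0%N _) E0 => M0.
move: M1; rewrite (moving_average_hyb (r := h) (fun=> 0)); last 2 first.
- by move=> t; rewrite /coef1 ltn_pmod.
- by move=> t; rewrite /coef2 ltn_pmod.
rewrite -/(E h _) => M1.
have eE : e = (a * b) ^+ 2 / 4 by rewrite /e expr_div_n real_normK ?num_real// /dl; field.
have [q|q] := two_point_average (sqr_ge0 (a * b)) dist.
  by apply: le_trans M0; rewrite lee_fin eE.
by apply: le_trans M1; rewrite lee_fin eE.
Qed.

End TwoPoints.

(** * Choice of the constants *)

Lemma exp1D_le (R : realType) (x : R) n : 0 <= x -> n%:R * x <= 2^-1 ->
  (1 + x) ^+ n <= 1 + 2 * (n%:R * x).
Proof.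
move=> x0; elim: n => [|n IH] nx; first by rewrite expr0 mul0r mulr0 addr0.
have nS : n.+1%:R * x = n%:R * x + x by rewrite -natr1 mulrDl mul1r.
have nx' : n%:R * x + x <= 2^-1 by rewrite -nS.
have nx0 : 0 <= n%:R * x by rewrite mulr_ge0.
have /IH H : n%:R * x <= 2^-1 by lra.
rewrite exprSr nS; move: H nx0 nx'.
move: (n%:R * x) ((1 + x) ^+ n) => p q qp p0 px.
apply: (@le_trans _ _ ((1 + 2 * p) * (1 + x))); first by rewrite ler_pM2r//; lra.
rewrite -subr_ge0 (_ : _ - _ = x * (1 - 2 * p)); last by ring.
by rewrite mulr_ge0//; lra.
Qed.

Lemma expR_sub1_le (R : realType) (alpha : R) : 0 < alpha -> alpha <= 8^-1 ->
  0 <= expR alpha - 1 <= 2 * alpha.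
Proof.
move=> a0 a8; apply/andP; split; first by rewrite subr_ge0 -expR0 ler_expR ltW.
have e0 := expR_gt0 alpha; have := expR_ge1Dx (- alpha); rewrite expRN => H.
have : (1 - alpha) * expR alpha <= 1.
  by rewrite -ler_pdivlMr// mul1r.
move=> e1; have : (1 - alpha) * expR alpha <= (1 - alpha) * (1 + 2 * alpha).
  by apply: le_trans e1 _; nra.
by rewrite ler_pM2l; lra.
Qed.

Section Choice.
Context {R : realType}.
Variables (h : nat) (h0 : (0 < h)%N) (beta : R).
Hypotheses (beta0 : 0 < beta)
  (beta1 : beta * (2 ^+ 20 * ((h.+1)%:R * h%:R ^+ 2)) <= 1).
Variables (N : nat) (alpha : R).
Hypotheses (hN : (h < N)%N) (alpha0 : 0 < alpha).

Definition privacy_rate : R := Num.min 1 ((Num.min (alpha ^+ 4) 1 * (N - h)%:R)^-1).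

Let kappa := Num.min (alpha ^+ 4) 1.

Let kappa0 : 0 < kappa. Proof. by rewrite lt_min ltr01 exprn_gt0. Qed.

Let Nh0 : 0 < (N - h)%:R :> R. Proof. by rewrite ltr0n subn_gt0. Qed.

Lemma privacy_rate_gt0 : 0 < privacy_rate.
Proof. by rewrite lt_min ltr01 invr_gt0 mulr_gt0. Qed.

(** N = h + (N - h) and N - h >= 1; this is where h + 1 enters the constant. *)
Let N_le : N%:R <= (h.+1)%:R * (N - h)%:R :> R.
Proof. by rewrite -natrM ler_nat; nia. Qed.

Let rate_le : kappa * (N%:R * (beta * privacy_rate)) <= beta * (h.+1)%:R.
Proof.
have k0 := kappa0; have n0 := Nh0; have r0 := privacy_rate_gt0.
have r1 : privacy_rate * (kappa * (N - h)%:R) <= 1.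
  rewrite -ler_pdivlMr ?mulr_gt0// mul1r.
  by rewrite ge_min lexx orbT.
apply: (@le_trans _ _ (kappa * (((h.+1)%:R * (N - h)%:R) * (beta * privacy_rate)))).
  apply: ler_wpM2l; first exact: ltW.
  by apply: ler_wpM2r => //; rewrite mulr_ge0// ltW.
rewrite (_ : kappa * _ = (beta * (h.+1)%:R) * (privacy_rate * (kappa * (N - h)%:R))); last by ring.
by rewrite ler_piMr// mulr_ge0// ltW.
Qed.

(** Together with [beta1] the hypothesis gives m x <= 1/(32h^2), and (1 + x)^m - 1 <= 2 m x is then
    within the 1/(16h^2) allowed to one hybrid step. *)
Let budget (m : nat) (x : R) : 0 <= x -> m%:R * x <= 2 ^+ 15 * (beta * (h.+1)%:R) ->
  (1 + x) ^+ m - 1 <= ((4 * h%:R)^-1) ^+ 2.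
Proof.
move=> x0 mx; have hp : 1 <= h%:R :> R by rewrite ler1n.
have H : m%:R * x * (32 * h%:R ^+ 2) <= 1.
  apply: le_trans beta1.
  apply: (@le_trans _ _ (2 ^+ 15 * (beta * (h.+1)%:R) * (32 * h%:R ^+ 2))).
    by rewrite ler_pM2r// mulr_gt0// exprn_gt0// (lt_le_trans _ hp).
  rewrite le_eqVlt; apply/orP; left; apply/eqP; ring.
have h2 : 0 < 32 * h%:R ^+ 2 :> R by rewrite mulr_gt0// exprn_gt0// (lt_le_trans _ hp).
have H' : m%:R * x <= (32 * h%:R ^+ 2)^-1 by rewrite -[leRHS]mul1r ler_pdivlMr.
have q32 : (32 * h%:R ^+ 2)^-1 <= 32^-1 :> R.
  by rewrite lef_pV2 ?posrE// ler_peMr// exprn_ege1.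
have /(exp1D_le x0) : m%:R * x <= 2^-1 by lra.
rewrite (_ : ((4 * h%:R)^-1) ^+ 2 = 2 * (32 * h%:R ^+ 2)^-1); first by lra.
by field; rewrite gt_eqF// (lt_le_trans _ hp).
Qed.

(** For alpha > 1/8 the truncated alpha^4 is at least 2^-12. The coefficient 4 doubles to 8 because
    N + 1 <= 2N, and 8 * 2^12 is the 2^15 of [budget]. *)
Lemma noisy_budget (b : R) : b ^+ 2 = beta * privacy_rate -> 8^-1 < alpha ->
  (1 + 4 * b ^+ 2) * (1 + 4 * b ^+ 2) ^+ N - 1 <= ((4 * h%:R)^-1) ^+ 2.
Proof.
move=> b2 a8; rewrite -exprS; apply: budget; first by rewrite mulr_ge0 ?sqr_ge0.
have k8 : 4096^-1 <= kappa.
  rewrite le_min; apply/andP; split; last by lra.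
  rewrite (_ : 4096^-1 = 8^-1 ^+ 4); last by field.
  by rewrite lerXn2r ?nnegrE; lra.
have N1 : (N.+1)%:R <= 2 * N%:R :> R.
  by rewrite -[N.+1%:R]natr1; have : 1 <= N%:R :> R; [rewrite ler1n; exact: leq_ltn_trans hN|lra].
have b20 := sqr_ge0 b.
apply: (@le_trans _ _ (2 * N%:R * (4 * b ^+ 2))); first by rewrite ler_wpM2r// mulr_ge0.
apply: (@le_trans _ _ (2 ^+ 15 * (kappa * (N%:R * b ^+ 2)))); last first.
  by rewrite ler_pM2l ?exprn_gt0// b2 rate_le.
have q0 : 0 <= N%:R * b ^+ 2 by rewrite mulr_ge0.
have : 4096^-1 * (N%:R * b ^+ 2) <= kappa * (N%:R * b ^+ 2) by rewrite ler_wpM2r.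
rewrite (_ : 2 * N%:R * (4 * b ^+ 2) = 8 * (N%:R * b ^+ 2)); last by ring.
rewrite (_ : 2 ^+ 15 = 8 * 4096); last by ring.
by move: (N%:R * b ^+ 2) (kappa * _) => p q; lra.
Qed.

(** Here tau <= 2 alpha, so tau^4 <= 16 alpha^4, and 80 * 16 = 1280 is below 2^15. *)
Lemma private_budget (b : R) : b ^+ 2 = beta * privacy_rate -> alpha <= 8^-1 ->
  1 * (1 + 80 * b ^+ 2 * ((expR alpha - 1) ^+ 2) ^+ 2) ^+ N - 1 <= ((4 * h%:R)^-1) ^+ 2.
Proof.
move=> b2 a8; have b20 := sqr_ge0 b.
rewrite mul1r; apply: budget; first by rewrite mulr_ge0 ?sqr_ge0// mulr_ge0.
have /andP[t0 t1] := expR_sub1_le alpha0 a8.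
have tau4 : ((expR alpha - 1) ^+ 2) ^+ 2 <= 16 * alpha ^+ 4.
  rewrite -exprM (_ : 16 * alpha ^+ 4 = (2 * alpha) ^+ 4); last by ring.
  by rewrite lerXn2r ?nnegrE// mulr_ge0// ltW.
have k4 : kappa = alpha ^+ 4.
  by apply/min_idPl; apply: exprn_ile1; [exact: ltW|lra].
apply: (@le_trans _ _ (2 ^+ 15 * (kappa * (N%:R * b ^+ 2)))); last first.
  by rewrite ler_pM2l ?exprn_gt0// b2 rate_le.
have a4 : 0 <= alpha ^+ 4 by rewrite exprn_ge0// ltW.
apply: (@le_trans _ _ (N%:R * (80 * b ^+ 2 * (16 * alpha ^+ 4)))).
  by rewrite ler_wpM2l// ler_wpM2l// mulr_ge0.
rewrite k4.
have : 0 <= alpha ^+ 4 * (N%:R * b ^+ 2) by apply: mulr_ge0 => //; exact: mulr_ge0.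
rewrite (_ : 2 ^+ 15 = 8 * 4096); last by ring.
rewrite (_ : N%:R * (80 * b ^+ 2 * _) = 1280 * (alpha ^+ 4 * (N%:R * b ^+ 2))); last by ring.
by move: (alpha ^+ 4 * _) => x x0; lra.
Qed.

End Choice.

Theorem proposition4 (R : realType) (C1 s : R) (hC1 : 0 < C1) (hs : 2^-1 < s)
    (h : nat) (hh : (1 <= h)%N) :
  exists c : R, 0 < c /\
    forall (C0 : R), 1 <= C0 ->
    forall (N : nat) (alpha : R), (h + 1 <= N)%N -> 0 < alpha ->
      ((c * Num.min 1 ((Num.min (alpha ^+ 4) 1 * (N - h)%:R)^-1))%:E
        <= minimax_risk C0 C1 s alpha N h%:Z)%E.
Proof.
have hp : 0 < h%:R :> R by rewrite ltr0n.
have pw : 0 < h%:R `^ (2 * s) by exact: powR_gt0.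
pose q := 2 ^+ 20 * ((h.+1)%:R * h%:R ^+ 2) : R.
have q0 : 0 < q by rewrite !mulr_gt0 ?exprn_gt0.
have q8 : 8 <= q.
  have h1 : 1 <= h%:R :> R by rewrite ler1n.
  have h3 : 1 <= (h.+1)%:R * h%:R ^+ 2 :> R by rewrite mulr_ege1 ?exprn_ege1// ler1n.
  by apply: (@le_trans _ _ (2 ^+ 20 * 1)); [lra|rewrite ler_pM2l ?exprn_gt0].
(* The first bound keeps the two laws close; the second keeps the perturbed density in the
   smoothness class. *)
pose beta := Num.min q^-1 (C1 ^+ 2 / (2 * h%:R `^ (2 * s))).
have beta0 : 0 < beta by rewrite lt_min invr_gt0 q0 divr_gt0 ?exprn_gt0 ?mulr_gt0.
have beta1 : beta * q <= 1 by rewrite -ler_pdivlMr// mul1r ge_min lexx.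
have beta2 : 2 * (h%:R `^ (2 * s) * beta) <= C1 ^+ 2.
  rewrite mulrA mulrC -ler_pdivlMr ?mulr_gt0//.
  by rewrite ge_min lexx orbT.
have beta8 : beta <= 8^-1.
  by apply: (@le_trans _ _ q^-1); [rewrite ge_min lexx|rewrite lef_pV2 ?posrE].
(* With b^2 = beta * rate <= 1/8, the two-point bound (ab)^2 * 3/32 is at least (7/8)(3/32) b^2,
   which exceeds b^2/16. *)
exists (beta / 16); split; first by rewrite divr_gt0.
move=> C0 C01 N alpha; rewrite addn1 => hN alpha0.
rewrite -/(privacy_rate h N alpha); set rate := privacy_rate _ _ _.
have rate0 : 0 < rate by exact: privacy_rate_gt0.
have rate1 : rate <= 1 by rewrite ge_min lexx.
pose b := Num.sqrt (beta * rate); pose a := Num.sqrt (1 - beta * rate).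
have br0 : 0 < beta * rate by exact: mulr_gt0.
have br : beta * rate <= beta by rewrite ler_piMr// ltW.
have b2 : b ^+ 2 = beta * rate by rewrite sqr_sqrtr// ltW.
have a2 : a ^+ 2 = 1 - beta * rate by rewrite sqr_sqrtr//; lra.
have a0 : 0 < a by rewrite sqrtr_gt0; lra.
have b0 : 0 < b by rewrite sqrtr_gt0.
have ab1 : a ^+ 2 + b ^+ 2 = 1 by rewrite a2 b2 subrK.
have b8 : b ^+ 2 <= 8^-1 by rewrite b2; lra.
have class0 : density_class C0 C1 s (cosine_density h 0).
  apply: cosine_density_class => //; first by rewrite normr0.
  by rewrite expr0n !mulr0 sqr_ge0.
have class1 : density_class C0 C1 s (cosine_density h (a * b)).
  apply: cosine_density_class => //.
    rewrite gtr0_norm ?mulr_gt0//.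
    by have := sqr_ge0 (a - b); rewrite sqrrB; lra.
  apply: le_trans beta2; rewrite ler_pM2l// ler_pM2l//.
  by rewrite exprMn b2 a2; nra.
apply/ereal_infP => _ [Ks KsN ->]; apply/ereal_infP => _ [g /= mg <-].
apply: (@le_trans _ _ ((a * b) ^+ 2 * (3 / 32))%:E).
  by rewrite lee_fin exprMn a2 b2; nra.
have x0 : 0 <= 4 * b ^+ 2 by rewrite mulr_ge0// sqr_ge0.
(* For large alpha the weighted supremum norm is enough; for small alpha the norm adapted to privacy
   takes over. *)
have [a8|a8] := leP alpha 8^-1; last first.
  have D1 : 1 <= 1 + 4 * b ^+ 2 by lra.
  apply: (two_point_risk mg hh (potential_weight _ a0 ab1 b8) D1 D1 ab1 _ class0 class1).
  by rewrite KsN; exact: (noisy_budget hh beta0 beta1 hN alpha0 b2 a8).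
have /andP[t0 t1] := expR_sub1_le alpha0 a8.
have tau8 : (expR alpha - 1) ^+ 2 <= 8^-1 by nra.
have D1 : 1 <= 1 + 80 * b ^+ 2 * ((expR alpha - 1) ^+ 2) ^+ 2.
  by rewrite lerDl mulr_ge0 ?sqr_ge0// mulr_ge0// sqr_ge0.
have bn : b != 0 by rewrite gt_eqF.
apply: (two_point_risk mg hh (potential_private a0 ab1 bn b8 alpha0 tau8) D1 (lexx _) ab1 _
  class0 class1).
by rewrite KsN; exact: (private_budget hh beta0 beta1 hN alpha0 b2 a8).
Qed.
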